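(* Let $A\in\mathbb{R}^{m\times n}$ be a random matrix whose rows are drawn independently from the standard Gaussian distribution $\mathcal{N}(\mathbf{0},I_n)$, and let $\eta\sim\mathcal{N}(\mathbf{0},\sigma^2 I_m)$ be independent of $A$. Then for any $0<\varepsilon,\delta<1$ and $1\le s<n$, the map $\Phi^\eta_A(x)=\mathrm{sgn}(Ax+\eta)$ has the $(s,\delta,\sigma)$-RIP, i.e. $$\sup_{x,y\in\mathbb{S}^{n-1}_s}\left|d_{\mathcal{H}^m}(\Phi^\eta_A x,\Phi^\eta_A y)-d^\sigma(x,y)\right|\le\delta ,$$ with probability at least $1-\varepsilon$, provided $$m\gtrsim\delta^{-2}\left[\log(2/\varepsilon)+s\log(n/s)\right].$$
   Context: $\mathbb{S}^{n-1}$ is the Euclidean unit sphere of $\mathbb{R}^n$, and $\mathbb{S}^{n-1}_s$ is the set of its elements having at most $s$ nonzero coordinates. $\mathcal{H}^m=\{\pm1\}^m$ is the Hamming cube with the normalized Hamming metric $d_{\mathcal{H}^m}(a,b)=\frac1m|\{1\le k\le m: a_k\ne b_k\}|$. The function $\mathrm{sgn}$ is applied component-wise, with $\mathrm{sgn}(t)=+1$ if $t>0$ and $\mathrm{sgn}(t)=-1$ if $t\le 0$. For $x,y\in\mathbb{S}^{n-1}$, $$d^\sigma(x,y)=\frac1\pi\arccos\left(\frac{\langle x,y\rangle+\sigma^2}{1+\sigma^2}\right),$$ where $\sigma^2$ is the variance of the entries of $\eta$. The notation $a\gtrsim b$ means $a\ge Cb$ for an absolute constant $C>0$. $\log$ is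 the natural logarithm.
   Formalization: The term s log(n/s) in the condition on m is replaced by s log(en/s); as printed the claim fails for s near n (e.g. s = n−1, σ = 0, fixed m, n = m+2), and for s ≤ n/2 the two agree up to an absolute constant. *)

(* Defs.v *)
From HB Require Import structures.
From mathcomp Require Import all_boot all_order all_algebra.
From mathcomp Require Import all_classical all_reals all_analysis.
Set Implicit Arguments.
Unset Strict Implicit.
Unset Printing Implicit Defensive.
Import Order.TTheory GRing.Theory Num.Theory.
Import numFieldNormedType.Exports.
Local Open Scope classical_set_scope.
Local Open Scope ring_scope.

Section Geometry.
Context {R : realType}.

Definition dotp n (x y : 'cV[R]_n) : R := \sum_i x i 0 * y i 0.

(* The norm [`|x|] on matrices is the sup norm, hence an explicit l2 norm. *)
Definition norm2 n (x : 'cV[R]_n) : R := Num.sqrt (dotp x x).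

Definition sparse_sphere n (s : nat) : set 'cV[R]_n :=
  [set x | norm2 x = 1 /\ (#|[set i | (x i 0 != 0)%R]%SET| <= s)%N].

(* [Num.sg] differs from [sgn] at 0, where [sgn] takes the value -1. *)
Definition sgn (t : R) : R := if 0 < t then 1 else -1.

Definition onebit_map m n (A : 'M[R]_(m, n)) (eta : 'cV[R]_m)
  (x : 'cV[R]_n) : 'cV[R]_m := map_mx sgn (A *m x + eta).

(* Elements of the Hamming cube {-1, 1}^m are column vectors with such
   entries; [onebit_map] only takes values of this form. *)
Definition hamming_dist m (a b : 'cV[R]_m) : R :=
  m%:R^-1 * #|[set k | (a k 0 != b k 0)%R]%SET|%:R.

Definition dsigma (sigma : R) n (x y : 'cV[R]_n) : R :=
  pi^-1 * acos ((dotp x y + sigma ^+ 2) / (1 + sigma ^+ 2)).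

Definition RIP m n (s : nat) (delta sigma : R)
    (Phi : 'cV[R]_n -> 'cV[R]_m) : Prop :=
  (ereal_sup [set `|hamming_dist (Phi xy.1) (Phi xy.2)
                     - dsigma sigma xy.1 xy.2|%:E
             | xy in sparse_sphere s `*` sparse_sphere s] <= delta%:E)%E.

End Geometry.

Section Probability.
Context d {T : measurableType d} {R : realType} (P : probability T R).

(* Inner-measure reading, so that measurability of [G] need not be assumed;
   for measurable [G] it says [p <= P G]. *)
Definition with_prob_at_least (p : R) (G : set T) : Prop :=
  exists E : set T, [/\ measurable E, E `<=` G & (p%:E <= P E)%E].

Definition mutually_independent d' (T' : measurableType d') (I : finType)
    (X : I -> T -> T') : Prop :=
  forall (J : {set I}) (B : I -> set T'),
    (forall i, i \in J -> measurable (B i)) ->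
    P (\bigcap_(i in [set` J]) X i @^-1` B i)
      = (\prod_(i in J) P (X i @^-1` B i))%E.

Definition independent2 d1 d2 (T1 : measurableType d1) (T2 : measurableType d2)
    (X : T -> T1) (Y : T -> T2) : Prop :=
  forall (B : set T1) (C : set T2), measurable B -> measurable C ->
    P (X @^-1` B `&` Y @^-1` C) = (P (X @^-1` B) * P (Y @^-1` C))%E.

(* N(0, sigma^2); the library's [normal_prob] with standard deviation 0 is not
   the Dirac mass but a junk value (the uniform law on [0, 1]). *)
Definition centered_normal (sigma : R) : set R -> \bar R :=
  if sigma == 0 then \d_(0 : R) else normal_prob 0 sigma.

(* N(0, sigma^2 I_k): independent coordinates, each of law N(0, sigma^2). *)
Definition gaussian_vector k (sigma : R)
    (X : T -> k.-tuple (measurableTypeR R)) : Prop :=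
  mutually_independent (fun (i : 'I_k) t => tnth (X t) i) /\
  forall (i : 'I_k) (B : set (measurableTypeR R)), measurable B ->
    P ((fun t => tnth (X t) i) @^-1` B) = centered_normal sigma B.

End Probability.

(* The library puts the product sigma-algebra on tuples but none on matrices,
   so random vectors and matrices are tuple-valued and then read as matrices. *)
Definition mx_of_tuples (R : realType) m n
    (a : m.-tuple (n.-tuple (measurableTypeR R))) : 'M[R]_(m, n) :=
  \matrix_(i, j) tnth (tnth a i) j.

Definition cV_of_tuple (R : realType) m
    (v : m.-tuple (measurableTypeR R)) : 'cV[R]_m := \col_i tnth v i.

(* s log(n/s) with the usual normalisation s log(e n/s) = s + s log(n/s).
   The two agree up to an absolute factor when s <= n/2; for s near n the
   former stays bounded, and a sample size of that order does not suffice. *)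
Definition sparse_complexity (R : realType) (n s : nat) : R :=
  s%:R * ln (expR 1 * n%:R / s%:R).

(* Main.v *)
(* For each pair (x, y) the normalized Hamming distance is an average of m
   independent indicators of mean d^sigma(x, y): two jointly Gaussian variables
   reduce by rotations to a planar pair, and the probability that a half-plane
   separates two directions is additive in the angle.

   Uniformity comes from chaining along grid nets of scale 8^-k.  The variance
   of the k-th link is of order 4^-k, so the Chernoff bound allows deviations
   delta (3/4)^k, summable over k, as long as 4^-k is at least of order delta;
   no logarithmic factor in 1/delta is lost.  At the last scale, the signs of x and of its
   net point u can only differ on a row where either <a, u> + eta is small,
   which is rare uniformly over the net, or <a, x - u> is large, which is rare
   because the Gaussian matrix is bounded on sparse vectors.  Only finite unions of
   events occur, hence no measurability question for the supremum. *)
Require Import Defs.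
From HB Require Import structures.
From mathcomp Require Import all_boot all_order all_algebra.
From mathcomp Require Import all_classical all_reals all_analysis.
From mathcomp Require Import measurable_realfun ring lra zify.
Import Order.TTheory GRing.Theory Num.Theory.
Import numFieldNormedType.Exports.
Set Implicit Arguments.
Unset Strict Implicit.
Unset Printing Implicit Defensive.
Local Open Scope classical_set_scope.
Local Open Scope ring_scope.

(** * Measures and real-valued probabilities *)

Section MeasureTools.
Context {R : realType}.
Local Open Scope ereal_scope.

(** When a direction moves by r, its sign changes with probability at most 4 tau + 8 r^2 / tau^2,
    which is best for tau of order r^(2/3). This explains the bases 8 and 4: r = 8^-k and tau = 4^-k
    match exactly because 8^2 = 4^3. The loss against the true order r is harmless, since chaining
    only asks for geometric decay. The squared deviation over the variance then grows like (9/4)^k,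
    while the log-cardinality of the nets is linear in k, so a single m serves at every level. The
    Chernoff parameter must stay at most 1, and this ties the last level to delta. Net points are
    not normalized: rounding towards 0 leaves them, from level 1 on, with squared norm between 1/4
    and 1, which the estimates tolerate. The exact value d^sigma is only computed at the two unit
    vectors themselves. Independence is given on products of one-dimensional sets, whereas sign
    events couple all coordinates. Uniqueness of finite measures on rectangles is what bridges this
    gap, for rotated pairs of coordinates and again for rows joined with their noise. *)

Definition image_measure d1 d2 (T1 : measurableType d1)
    (T2 : measurableType d2) (m : {measure set T1 -> \bar R}) (f : T1 -> T2)
    (mf : measurable_fun [set: T1] f) : {measure set T2 -> \bar R}.
Proof. by refine (pushforward m f). Defined.

Lemma measurable_preimage d1 d2 (T1 : measurableType d1)
    (T2 : measurableType d2) (f : T1 -> T2) (S : set T2) :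
  measurable_fun [set: T1] f -> measurable S -> measurable (f @^-1` S).
Proof. by move=> mf mS; rewrite -(setTI (_ @^-1` _)); exact: mf. Qed.

(** Rectangles are stable under intersection, generate the product sigma-algebra and include the
    whole space. Every extension of independence beyond rectangles goes through this lemma. *)
Lemma finite_measure_rect_unique d1 d2 (T1 : measurableType d1)
    (T2 : measurableType d2) (m1 m2 : {measure set (T1 * T2) -> \bar R}) :
  m1 setT < +oo ->
  (forall A B, measurable A -> measurable B ->
     m1 (A `*` B) = m2 (A `*` B)) ->
  forall S, measurable S -> m1 S = m2 S.
Proof.
move=> m1oo m12 S mS.
apply: (measure_unique [set A `*` B | A in measurable & B in measurable]
  (fun=> setT)) => //.
- exact: measurable_prod_measurableType.
- move=> _ _ [A1 mA1 [B1 mB1 <-]] [A2 mA2 [B2 mB2 <-]].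
  exists (A1 `&` A2); first exact: measurableI.
  exists (B1 `&` B2); first exact: measurableI.
  by rewrite setXI.
- by move=> i; exists setT => //; exists setT => //; rewrite setXTT.
- by rewrite bigcup_const.
- by move=> _ [A mA [B mB <-]]; exact: m12.
Qed.

Import HBNNSimple.

(* [nu] is the image under [Z] of the measure of density [W] with respect to
   [mu]. *)
Lemma ge0_integral_density d d' (T : measurableType d) (T' : measurableType d')
    (mu : {measure set T -> \bar R}) (nu : {measure set T' -> \bar R})
    (W : T -> R) (Z : T -> T') (h : T' -> \bar R) :
  measurable_fun [set: T] W -> (forall t, 0 <= W t)%R ->
  measurable_fun [set: T] Z ->
  (forall S, measurable S -> \int[mu]_(t in Z @^-1` S) (W t)%:E = nu S) ->
  measurable_fun [set: T'] h -> (forall z, 0 <= h z) ->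
  \int[mu]_t (h (Z t) * (W t)%:E) = \int[nu]_z h z.
Proof.
move=> mW W0 mZ WZ mh h0.
have mT : measurable [set: T'] by [].
pose h_ := nnsfun_approx mT mh.
have h_cvg z : EFin \o h_^~ z @ \oo --> h z by exact: cvg_nnsfun_approx.
have h_nd z : nondecreasing_seq (fun n => (h_ n z)%:E).
  by move=> m n mn; rewrite lee_fin; exact/lefP/nd_nnsfun_approx.
have mWZ (S : set T') : measurable S -> measurable (Z @^-1` S).
  exact: measurable_preimage.
have mEW : measurable_fun [set: T] (EFin \o W) by exact/measurable_EFinP.
(* Monotone convergence on both sides reduces the claim to simple functions, and then, term by term,
   to indicators, where it is the hypothesis on [W] and [nu]. *)
transitivity (limn (fun n => \int[nu]_z (h_ n z)%:E)); last first.
  rewrite -monotone_convergence//.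
  - by apply: eq_integral => z _; apply/cvg_lim => //; exact: h_cvg.
  - by move=> n; exact/measurable_EFinP/measurable_funP.
  - by move=> n z _; rewrite lee_fin.
transitivity (limn (fun n => \int[mu]_t ((h_ n (Z t))%:E * (W t)%:E))).
  rewrite -monotone_convergence//.
  - apply: eq_integral => t _; apply/esym/cvg_lim => //.
    by apply: cvgeZr => //; exact: h_cvg.
  - move=> n; apply: emeasurable_funM => //.
    by apply/measurable_EFinP; apply: measurableT_comp.
  - by move=> n t _; rewrite mule_ge0// lee_fin.
  - by move=> t _ m n mn; rewrite lee_wpmul2r ?lee_fin//; exact: h_nd.
congr (limn _); apply/funext => n.
have mr r : measurable (h_ n @^-1` [set r]) by exact: measurable_funPTI.
transitivity (\sum_(y \in range (h_ n))
    \int[nu]_z (y * \1_(h_ n @^-1` [set y]) z)%:E); last first.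
  rewrite -ge0_integral_fsum//.
  - by apply: eq_integral => z _; rewrite fsumEFin// -fimfunE.
  - by move=> r; exact/measurable_EFinP/measurable_funM.
  - by move=> r z _; exact: nnfun_muleindic_ge0.
transitivity (\int[mu]_t (\sum_(y \in range (h_ n))
    (y * \1_(h_ n @^-1` [set y]) (Z t))%:E * (W t)%:E)).
  apply: eq_integral => t _.
  rewrite -ge0_mule_fsuml => [|y]; last exact: nnfun_muleindic_ge0.
  by rewrite fsumEFin// -(fimfunE _ (Z t)).
rewrite ge0_integral_fsum//; last 2 first.
  - move=> r; apply: emeasurable_funM => //; apply/measurable_EFinP.
    apply: measurable_funM => //; apply: measurableT_comp => //.
  - by move=> r t _; apply: mule_ge0; [exact: nnfun_muleindic_ge0|rewrite lee_fin].
apply: eq_fsbigr => r rhn.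
under [RHS]eq_integral do rewrite EFinM.
rewrite integralZl_indic_nnsfun => //.
under eq_integral do rewrite EFinM -muleA.
rewrite ge0_integralZl//.
- rewrite [X in _ = _ * X]integral_indic// setIT -WZ//.
  rewrite [in RHS]integral_mkcond; congr (_ * _).
  by apply: eq_integral => t _; rewrite epatch_indic muleC.
- apply: emeasurable_funM => //; apply/measurable_EFinP.
  exact: measurableT_comp.
- by move=> t _; rewrite mule_ge0 ?lee_fin.
- by move: rhn; rewrite inE => -[t _ <-]; rewrite lee_fin.
Qed.

End MeasureTools.

Section RealProbability.
Context d {T : measurableType d} {R : realType} (P : probability T R).
Implicit Types (A B : set T) (f g : T -> R).

(** Real-valued, so that linear arithmetic applies to the bounds; nothing is lost, as a probability
    is finite. *)
Definition Pr A : R := fine (P A).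

Lemma EFin_Pr A : measurable A -> (Pr A)%:E = P A.
Proof. by move=> mA; rewrite fineK// fin_num_measure. Qed.

Lemma Pr_ge0 A : 0 <= Pr A.
Proof. exact: fine_ge0. Qed.

Lemma Pr_le1 A : measurable A -> Pr A <= 1.
Proof. by move=> mA; rewrite -lee_fin EFin_Pr// probability_le1. Qed.

Lemma Pr_setT : Pr setT = 1.
Proof. by rewrite /Pr probability_setT. Qed.

Lemma Pr_le A B : measurable A -> measurable B -> A `<=` B -> Pr A <= Pr B.
Proof. by move=> mA mB AB; rewrite -lee_fin !EFin_Pr// le_measure// inE. Qed.

Lemma Pr_setU_le A B : measurable A -> measurable B ->
  Pr (A `|` B) <= Pr A + Pr B.
Proof.
move=> mA mB; rewrite -lee_fin EFinD !EFin_Pr//; last exact: measurableU.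
exact: measureU2.
Qed.

Lemma Pr_setU A B : measurable A -> measurable B -> A `&` B = set0 ->
  Pr (A `|` B) = Pr A + Pr B.
Proof.
move=> mA mB AB; apply: EFin_inj.
by rewrite EFinD !EFin_Pr//; [exact: measureU|exact: measurableU].
Qed.

Lemma Pr_setC A : measurable A -> Pr (~` A) = 1 - Pr A.
Proof.
move=> mA; apply: EFin_inj; rewrite EFinB !EFin_Pr//; last exact: measurableC.
exact: probability_setC.
Qed.

Lemma Pr_bigsetU_le (I : Type) (r : seq I) (Q : pred I) (F : I -> set T) :
  (forall i, Q i -> measurable (F i)) ->
  Pr (\big[setU/set0]_(i <- r | Q i) F i) <= \sum_(i <- r | Q i) Pr (F i).
Proof.
move=> mF.
suff [] : measurable (\big[setU/set0]_(i <- r | Q i) F i) /\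
  Pr (\big[setU/set0]_(i <- r | Q i) F i) <= \sum_(i <- r | Q i) Pr (F i) by [].
elim/big_ind2 : _ => [|A x B y [mA Ax] [mB By]|i Qi]; last by split; [exact: mF|].
  by split => //; rewrite /Pr measure0.
split; first exact: measurableU.
by rewrite (le_trans (Pr_setU_le mA mB))// lerD.
Qed.

(** Comparing strict positivity builds in the convention that the sign of 0 is -1; see [sgn_neq]. *)
Definition mismatch f g := [set t | (0 < f t) != (0 < g t)].

Lemma measurable_gt0 f : measurable_fun [set: T] f -> measurable [set t | 0 < f t].
Proof.
move=> mf; rewrite (_ : [set _ | _] = f @^-1` `]0, +oo[%classic).
  by apply: measurable_preimage.
by apply/seteqP; split => t /=; rewrite in_itv/= andbT.
Qed.

Lemma measurable_mismatch f g : measurable_fun [set: T] f ->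
  measurable_fun [set: T] g -> measurable (mismatch f g).
Proof.
move=> mf mg; rewrite (_ : mismatch f g =
    ([set t | 0 < f t] `\` [set t | 0 < g t]) `|`
    ([set t | 0 < g t] `\` [set t | 0 < f t])).
  by apply: measurableU; apply: measurableD; exact: measurable_gt0.
apply/seteqP; rewrite /mismatch; split => t /=; case: (0 < f t); case: (0 < g t) => //=.
- by move=> _; left.
- by move=> _; right.
- by case=> -[].
- by case=> -[].
Qed.

End RealProbability.

(** * The Gaussian law on the line and in the plane *)

Section GaussianPlane.
Context {R : realType}.
Local Open Scope ereal_scope.

Local Notation mR := (measurableTypeR R).
Local Notation mu := (@lebesgue_measure R).
Local Notation phi := (@normal_pdf R 0 1).

Definition gauss : probability mR R := @normal_prob R 0 1.

Lemma phiE (x : R) : phi x = (normal_peak 1 * expR (- x ^+ 2 / 2))%R.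
Proof.
by rewrite normal_pdfE ?oner_eq0//= /normal_fun subr0 expr1n.
Qed.

Lemma ge0_integral_gauss (f : R -> \bar R) :
  measurable_fun [set: R] f -> (forall x, 0 <= f x) ->
  \int[gauss]_x f x = \int[mu]_x (f x * (phi x)%:E).
Proof.
move=> mf f0; symmetry.
apply: (@ge0_integral_density R _ _ mR mR mu gauss phi idfun) => //.
- exact: measurable_normal_pdf.
- by move=> t; exact: normal_pdf_ge0.
- exact: measurable_id.
Qed.

Lemma lebesgue_measureD (a : R) (A : set mR) : measurable A ->
  mu ((fun x => x + a)%R @^-1` A) = mu A.
Proof.
move=> mA.
have mf : measurable_fun [set: mR] (fun x : mR => (x + a)%R : mR).
  by apply: measurable_funD.
apply/esym; apply: (@lebesgue_measure_unique _ (image_measure mu mf)) => //= _ [[b c]] _ <-.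
rewrite /image_measure/= /pushforward/=.
have -> : (fun x => x + a)%R @^-1` `]b, c]%classic = `](b - a)%R, (c - a)%R]%classic.
  by apply/seteqP; split => x /=; rewrite !in_itv/= ltrBlDr lerBrDr.
rewrite !lebesgue_measure_itv/= !lte_fin ltrD2r.
by case: ifP => // _; rewrite -!EFinB opprB addrA addrNK.
Qed.


Lemma lebesgue_measureZ (a : R) (A : set mR) : (0 < a)%R -> measurable A ->
  mu ((fun x => a^-1 * x)%R @^-1` A) = a%:E * mu A.
Proof.
move=> a0 mA.
have mf : measurable_fun [set: mR] (fun x : mR => (a^-1 * x)%R : mR).
  exact: measurable_funM.
have a0' : (0 <= a^-1)%R by rewrite invr_ge0 ltW.
pose nu := mscale (NngNum a0') (image_measure mu mf).
suff -> : mu A = nu A.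
  by rewrite /nu/= /mscale/= muleA -EFinM divff ?gt_eqF// mul1e.
apply: (@lebesgue_measure_unique _ nu) => //= _ [[b c]] _ <-.
rewrite /nu /mscale/= /image_measure/= /pushforward/=.
have -> : (fun x => a^-1 * x)%R @^-1` `]b, c]%classic = `](a * b)%R, (a * c)%R]%classic.
  apply/seteqP; split => x /=; rewrite !in_itv/=.
    by rewrite ltr_pdivlMl// ler_pdivrMl.
  by rewrite ltr_pdivlMl// ler_pdivrMl.
rewrite !lebesgue_measure_itv/= !lte_fin ltr_pM2l//.
case: ifP => _; last by rewrite mule0.
by rewrite -!EFinD -EFinM -mulrBr mulrA mulVf ?gt_eqF// mul1r.
Qed.

(** This turns noise of positive variance into one more standard coordinate. *)
Lemma normal_probZ (s : R) (B : set mR) : (0 < s)%R -> measurable B ->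
  normal_prob 0 s ((fun x => s^-1 * x)%R @^-1` B) = gauss B.
Proof.
move=> s0 mB.
have s1 : (s^-1 != 0)%R by rewrite invr_eq0 gt_eqF.
have mf : measurable_fun [set: mR] (fun x : mR => (s^-1 * x)%R : mR).
  exact: measurable_funM.
have mphi : measurable_fun [set: R] (fun x => (s^-1 * phi x)%:E).
  apply/measurable_EFinP; apply: measurable_funM => //.
  exact: measurable_normal_pdf.
have phi0 x : 0 <= (s^-1 * phi x)%:E.
  by rewrite lee_fin mulr_ge0 ?normal_pdf_ge0// invr_ge0 ltW.
have s0' : (0 <= s)%R by exact: ltW.
transitivity (\int[image_measure mu mf]_(x in B) (s^-1 * phi x)%:E).
  rewrite ge0_integral_pushforward//; last exact: measurable_funTS.
  apply: eq_integral => x _ /=; congr EFin.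
  rewrite normal_pdfE ?gt_eqF// phiE /normal_fun subr0 mulrA; congr (_ * _)%R.
    rewrite /normal_peak expr1n mul1r -mulrnAr sqrtrM ?sqr_ge0// sqrtr_sqr.
    by rewrite gtr0_norm// invfM.
  congr expR; rewrite exprMn -mulr_natr invfM -mulrA; field.
  by rewrite gt_eqF.
transitivity (\int[mscale (NngNum s0') mu]_(x in B) (s^-1 * phi x)%:E).
  apply: eq_measure_integral => A mA _.
  by rewrite /image_measure/= /pushforward/= lebesgue_measureZ.
rewrite ge0_integral_mscale//; last exact: measurable_funTS.
rewrite /gauss/= /normal_prob.
under eq_integral do rewrite EFinM.
rewrite ge0_integralZl//; last 3 first.
- apply/measurable_EFinP/measurable_funTS; exact: measurable_normal_pdf.
- by move=> x _; rewrite lee_fin normal_pdf_ge0.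
- by rewrite lee_fin invr_ge0.
by rewrite muleA -EFinM divff ?gt_eqF// mul1e.
Qed.

(** The density is at most 1, so mass is bounded by length. *)
Lemma gauss_itv_le (c : R) : (0 <= c)%R -> gauss `[(- c)%R, c]%classic <= (2 * c)%:E.
Proof.
move=> c0; rewrite /gauss/= /normal_prob.
apply: (@le_trans _ _ (\int[mu]_(x in `[(- c)%R, c]%classic) cst 1 x)).
  apply: ge0_le_integral => //.
  - by move=> x _; rewrite lee_fin normal_pdf_ge0.
  - apply/measurable_EFinP/measurable_funTS; exact: measurable_normal_pdf.
  - move=> x _; rewrite lee_fin (le_trans (normal_pdf_ub _ _ _))//.
    have pi2 : (2 <= pi :> R)%R := pi_ge2 R.
    have pi1 : (1 <= pi *+ 2 :> R)%R by rewrite mulr2n; lra.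
    have s1 : (1 <= Num.sqrt (pi *+ 2) :> R)%R.
      by rewrite -[leLHS]sqrtr1 ler_sqrt// (le_trans _ pi1).
    by rewrite /normal_peak expr1n mul1r invf_le1// (lt_le_trans _ s1).
rewrite (integral_cst _ _ 1)// mul1e [leLHS]lebesgue_measure_itv/= lte_fin.
case: ifP => _; last by rewrite lee_fin mulr_ge0.
by rewrite -EFinB lee_fin opprK mulr2n mulrDl mul1r.
Qed.

(** Since x^2/4 - x^2/2 = -x^2/4, the integrand is at most sqrt 2 times the density of variance
    2. *)
Lemma gauss_exp_sqr_le (c : R) : (c ^+ 2 <= 1)%R ->
  \int[gauss]_x (expR ((c * x) ^+ 2 / 4))%:E <= 2%:E.
Proof.
move=> c1.
rewrite ge0_integral_gauss; last 2 first.
- apply/measurable_EFinP/measurableT_comp => //; apply: measurable_funM => //.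
  by apply: measurable_funX; exact: measurable_funM.
- by move=> x; rewrite lee_fin expR_ge0.
have s20 : (Num.sqrt 2 != 0 :> R)%R by rewrite gt_eqF// sqrtr_gt0.
apply: (@le_trans _ _ (\int[mu]_x ((Num.sqrt 2)%:E * (normal_pdf 0 (Num.sqrt 2) x)%:E))).
  apply: ge0_le_integral => //.
  - by move=> x _; rewrite mule_ge0 ?lee_fin ?expR_ge0 ?normal_pdf_ge0.
  - apply: emeasurable_funM; apply/measurable_EFinP; last exact: measurable_normal_pdf.
    apply/measurableT_comp => //; apply: measurable_funM => //.
    by apply: measurable_funX; exact: measurable_funM.
  - apply: emeasurable_funM => //; apply/measurable_EFinP; exact: measurable_normal_pdf.
  - move=> x _; rewrite -!EFinM lee_fin phiE normal_pdfE// /normal_fun subr0.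
    rewrite /normal_peak expr1n mul1r sqr_sqrtr// -[(2 * pi *+ 2)%R]mulrnAr sqrtrM//.
    rewrite invfM !mulrA divff// mul1r mulrC mulrA [leRHS]mulrC ler_wpM2r ?invr_ge0//.
    rewrite -expRD ler_expR exprMn.
    have x0 := sqr_ge0 x.
    nra.
rewrite ge0_integralZl//; last 2 first.
- apply/measurable_EFinP; exact: measurable_normal_pdf.
- by move=> x _; rewrite lee_fin normal_pdf_ge0.
rewrite integral_normal_pdf mule1 lee_fin -[leRHS]sqr_sqrtr// expr2.
rewrite ler_peMr// -[leLHS]sqrtr1 ler_sqrt//; lra.
Qed.

End GaussianPlane.

(** * Rotation invariance of the planar Gaussian law *)

Section PlaneRotation.
Context {R : realType}.
Local Open Scope ereal_scope.

Local Notation mR := (measurableTypeR R).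
Local Notation mu := (@lebesgue_measure R).
Local Notation phi := (@normal_pdf R 0 1).
Local Notation gauss := (@gauss R).
Local Notation mu2 := (mu \x mu).
Local Notation gauss2 := (gauss \x gauss).

Lemma gauss2E (S : set (mR * mR)) : measurable S ->
  gauss2 S = \int[mu2]_(z in S) (phi z.1 * phi z.2)%:E.
Proof.
move=> mS.
have mphi : measurable_fun [set: mR] phi by exact: measurable_normal_pdf.
pose f (z : mR * mR) : \bar R := (phi z.1 * phi z.2 * \1_S z)%:E.
have mf : measurable_fun [set: mR * mR] f.
  apply/measurable_EFinP/measurable_funM => //.
  by apply: measurable_funM; apply: measurableT_comp.
have f0 z : 0 <= f z by rewrite lee_fin !mulr_ge0// normal_pdf_ge0.
transitivity (\int[mu2]_z f z); last first.
  rewrite [RHS]integral_mkcond; apply: eq_integral => z _.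
  by rewrite /f patchE indicE; case: ifP => _; rewrite ?mulr1 ?mulr0.
rewrite fubini_tonelli1//= /product_measure1.
rewrite ge0_integral_gauss//; last exact: measurable_fun_xsection.
apply: eq_integral => x _; rewrite muleC /fubini_F/= /f.
have mx : measurable (xsection S x) by exact: measurable_xsection.
rewrite /normal_prob [in LHS]integral_mkcond -ge0_integralZl//.
- apply: eq_integral => y _; rewrite patchE indicE mem_xsection.
  by case: ifP => _; rewrite ?mulr1 ?mulr0 ?mule0.
- apply/(measurable_restrictT _ _).1 => //; apply/measurable_EFinP/measurable_funTS => //.
- by move=> y _; apply: erestrict_ge0 => ? _; rewrite lee_fin normal_pdf_ge0.
- by rewrite lee_fin normal_pdf_ge0.
Qed.

Definition mu2_invariant (f : mR * mR -> mR * mR) :=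
  measurable_fun setT f /\ forall S, measurable S -> mu2 (f @^-1` S) = mu2 S.

Lemma mu2_invariant_comp f g :
  mu2_invariant f -> mu2_invariant g -> mu2_invariant (g \o f).
Proof.
move=> [mf fE] [mg gE]; split; first exact: measurableT_comp.
by move=> S mS; rewrite comp_preimage fE ?gE//; exact: measurable_preimage.
Qed.

Lemma mu2_invariant_swap : mu2_invariant (fun z => (z.2, z.1)).
Proof.
have msw : measurable_fun [set: mR * mR] (fun z : mR * mR => (z.2, z.1)).
  exact: measurable_fun_pair.
split=> // S mS; apply/esym.
apply: (@product_measure_unique _ _ _ _ _ mu mu (image_measure mu2 msw)) => //.
move=> A B mA mB; rewrite /image_measure/= /pushforward.
rewrite (_ : _ @^-1` _ = B `*` A); last by apply/seteqP; split => z [].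
by rewrite product_measure1E// muleC.
Qed.

(** Each vertical section is merely translated. *)
Lemma mu2_invariant_shear (a : R) : mu2_invariant (fun z => (z.1, z.2 + a * z.1)%R).
Proof.
have msh : measurable_fun [set: mR * mR]
    (fun z : mR * mR => (z.1, (z.2 + a * z.1)%R) : mR * mR).
  apply: measurable_fun_pair => //; apply: measurable_funD => //.
  exact: measurable_funM.
split=> // S mS; rewrite /product_measure1/=.
apply: eq_integral => x _ /=.
rewrite -[RHS](lebesgue_measureD (a * x)); last exact: measurable_xsection.
congr (mu _); apply/seteqP; split => y /=; by rewrite /xsection/= !inE.
Qed.

Lemma mu2_invariant_shear2 (a : R) : mu2_invariant (fun z => (z.1 + a * z.2, z.2)%R).
Proof.
have := mu2_invariant_comp mu2_invariant_swap
  (mu2_invariant_comp (mu2_invariant_shear a) mu2_invariant_swap).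
by congr mu2_invariant.
Qed.

Lemma mu2_invariant_flip : mu2_invariant (fun z => (z.1, - z.2)%R).
Proof.
have mfl : measurable_fun [set: mR * mR]
    (fun z : mR * mR => (z.1, (- z.2)%R) : mR * mR).
  by apply: measurable_fun_pair => //; exact: measurable_funN.
split=> // S mS; rewrite /product_measure1/=.
apply: eq_integral => x _ /=.
rewrite -[RHS]lebesgue_measureN; last exact: measurable_xsection.
congr (mu _); apply/seteqP; split => y /=; by rewrite /xsection/= !inE.
Qed.

(** The planar density depends on [z] only through its Euclidean norm. *)
Lemma gauss2_invariant f : mu2_invariant f ->
  (forall z, (f z).1 ^+ 2 + (f z).2 ^+ 2 = z.1 ^+ 2 + z.2 ^+ 2)%R ->
  forall S, measurable S -> gauss2 (f @^-1` S) = gauss2 S.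
Proof.
move=> [mf fE] fsqr S mS; rewrite !gauss2E//; last exact: measurable_preimage.
have mphi : measurable_fun [set: mR] phi by exact: measurable_normal_pdf.
transitivity (\int[image_measure mu2 mf]_(z in S) (phi z.1 * phi z.2)%:E).
  rewrite ge0_integral_pushforward//.
  - apply: eq_integral => z _ /=; congr EFin.
    rewrite !phiE mulrACA [RHS]mulrACA -!expRD; congr (_ * expR _)%R.
    by have := fsqr z; lra.
  - apply/measurable_EFinP/measurable_funTS.
    by apply: measurable_funM; apply: measurableT_comp.
  - by move=> z _; rewrite lee_fin mulr_ge0// normal_pdf_ge0.
by apply: eq_measure_integral => A mA _; exact: fE.
Qed.

Definition plane_rot (c s : R) (z : mR * mR) : mR * mR :=
  (c * z.1 + s * z.2, - s * z.1 + c * z.2)%R.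

(* A rotation is a product of three shears, unless it is a half-turn or the
   identity. *)
Lemma mu2_invariant_rot (c s : R) : (c ^+ 2 + s ^+ 2 = 1)%R ->
  mu2_invariant (plane_rot c s).
Proof.
have gen c' s' : (c' ^+ 2 + s' ^+ 2 = 1)%R -> (s' != 0)%R ->
    mu2_invariant (plane_rot c' s').
  (* [p] is the tangent of the half-angle; the three shears have parameters [p], [- s'], [p]. *)
  move=> cs1 s0; pose p := ((1 - c') / s')%R.
  have := mu2_invariant_comp (mu2_invariant_shear2 p)
    (mu2_invariant_comp (mu2_invariant_shear (- s')) (mu2_invariant_shear2 p)).
  congr mu2_invariant; apply/funext => -[x y]; rewrite /plane_rot/= /p.
  congr pair; last by field.
  have s2 : (s' ^+ 2 = 1 - c' ^+ 2)%R by rewrite -cs1 addrAC subrr add0r.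
  transitivity (c' * x + (1 - c' ^+ 2) / s' * y)%R; first by field.
  by rewrite -s2; field.
move=> cs1; have [s0|] := eqVneq s 0%R; last exact: gen.
(* Where the sine vanishes, the half-turn is two quarter-turns and the identity is four. *)
have quarter : (0 ^+ 2 + 1 ^+ 2 = 1 :> R)%R by rewrite expr0n expr1n add0r.
have half := mu2_invariant_comp (gen _ _ quarter (oner_neq0 _))
  (gen _ _ quarter (oner_neq0 _)).
move: cs1; rewrite s0 expr0n addr0 => /eqP; rewrite sqrf_eq1 => /orP[]/eqP ->.
  have := mu2_invariant_comp half half.
  congr mu2_invariant; apply/funext => -[x y]; rewrite /plane_rot/=.
  by congr pair; ring.
move: half; congr mu2_invariant; apply/funext => -[x y]; rewrite /plane_rot/=.
by congr pair; ring.
Qed.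

Lemma gauss2_rot (c s : R) (S : set (mR * mR)) : (c ^+ 2 + s ^+ 2 = 1)%R ->
  measurable S -> gauss2 (plane_rot c s @^-1` S) = gauss2 S.
Proof.
move=> cs1 mS; apply: gauss2_invariant => //; first exact: mu2_invariant_rot.
move=> [x y] /=; transitivity ((c ^+ 2 + s ^+ 2) * (x ^+ 2 + y ^+ 2))%R.
  by ring.
by rewrite cs1 mul1r.
Qed.

Lemma gauss2_flip (S : set (mR * mR)) :
  measurable S -> gauss2 ((fun z => (z.1, - z.2)%R) @^-1` S) = gauss2 S.
Proof.
move=> mS; apply: gauss2_invariant => //; first exact: mu2_invariant_flip.
by move=> z /=; rewrite sqrrN.
Qed.

Lemma Pr_gauss2_rot (c s : R) (S : set (mR * mR)) : (c ^+ 2 + s ^+ 2 = 1)%R ->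
  measurable S -> Pr gauss2 (plane_rot c s @^-1` S) = Pr gauss2 S.
Proof. by move=> cs1 mS; congr fine; exact: gauss2_rot. Qed.

Lemma Pr_gauss2_flip (S : set (mR * mR)) : measurable S ->
  Pr gauss2 ((fun z => (z.1, - z.2)%R) @^-1` S) = Pr gauss2 S.
Proof. by move=> mS; congr fine; exact: gauss2_flip. Qed.

End PlaneRotation.

(** * The probability that a random half-plane separates two directions *)

Section Angle.
Context {R : realType}.

Local Notation mR := (measurableTypeR R).
Local Notation gauss := (@gauss R).
Local Notation gauss2 := (gauss \x gauss)%E.

Definition ray_coord (th : R) (z : mR * mR) : R := cos th * z.1 + sin th * z.2.

Lemma measurable_ray_coord th : measurable_fun [set: mR * mR] (ray_coord th).
Proof. by apply: measurable_funD; apply: measurable_funM. Qed.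

Definition angle_prob (th : R) : R := Pr gauss2 (mismatch (ray_coord 0) (ray_coord th)).

Let mmis a b : measurable (mismatch (ray_coord a) (ray_coord b)).
Proof. by apply: measurable_mismatch; exact: measurable_ray_coord. Qed.

Lemma mismatch_ray_rot (a b : R) :
  Pr gauss2 (mismatch (ray_coord a) (ray_coord (a + b))) = angle_prob b.
Proof.
rewrite /angle_prob.
rewrite -(Pr_gauss2_rot (cos2Dsin2 a) (mmis 0 b)).
congr (Pr _ _).
apply/seteqP; split => -[x y]; rewrite /mismatch /ray_coord /plane_rot /=.
all: rewrite cosD sinD cos0 sin0 !mul1r !mul0r !addr0 => h.
all: apply: etrans h; congr (_ != (0 < _)); ring.
Qed.

(* For a, b >= 0 with a + b <= pi, the direction of angle a lies in the cone
   of those of angles 0 and a + b, so no half-plane separates it from both. *)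
Lemma ray_coord_cone (a b : R) z :
  sin (a + b) * ray_coord a z = sin b * ray_coord 0 z + sin a * ray_coord (a + b) z.
Proof.
rewrite /ray_coord cosD sinD cos0 sin0; have := cos2Dsin2 a.
move: (cos a) (sin a) (cos b) (sin b) => ca sa cb sb e.
rewrite mul0r addr0 mul1r.
transitivity ((sb * (ca ^+ 2 + sa ^+ 2) + sa * ca * cb - sb * sa ^+ 2) * z.1
  + (sa * ca * sb + sa ^+ 2 * cb) * z.2); first by ring.
by rewrite e; ring.
Qed.

Lemma angle_prob_ge0 a : 0 <= angle_prob a. Proof. exact: Pr_ge0. Qed.

Lemma angle_mismatch_disjoint (a b : R) z : 0 <= a -> 0 <= b -> a + b < pi ->
  mismatch (ray_coord 0) (ray_coord a) z ->
  ~ mismatch (ray_coord a) (ray_coord (a + b)) z.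
Proof.
move=> a0 b0 abpi; rewrite /mismatch/=.
have sa : 0 <= sin a by apply: sin_ge0_pi; lra.
have sb : 0 <= sin b by apply: sin_ge0_pi; lra.
have := ray_coord_cone a b z.
have [ab0|ab0] : a + b = 0 \/ 0 < a + b by lra.
  have -> : a = 0 by lra.
  by rewrite eqxx.
have sab : 0 < sin (a + b) by apply: sin_gt0_pi; lra.
(* Strictness matters when both outer coordinates are positive and the middle one is possibly 0,
   hence of negative sign: one weight of the cone identity must be positive. *)
have sab1 : 0 < sin a \/ 0 < sin b.
  have [a1|a1] : 0 < a \/ a = 0 by lra.
    by left; apply: sin_gt0_pi; lra.
  by right; move: sab; rewrite a1 add0r.
case: (ltP 0 (ray_coord 0 z)); case: (ltP 0 (ray_coord a z));
case: (ltP 0 (ray_coord (a + b) z)) => //= Z Y X E _ _.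
- have : sin (a + b) * ray_coord a z <= 0 by rewrite pmulr_rle0.
  rewrite E leNgt => /negP; apply.
  case: sab1 => s; [apply: ltr_wpDl|apply: ltr_pwDl].
  - by rewrite mulr_ge0// ltW.
  - by rewrite mulr_gt0.
  - by rewrite mulr_gt0.
  - by rewrite mulr_ge0// ltW.
- have : 0 < sin (a + b) * ray_coord a z by rewrite mulr_gt0.
  by rewrite E ltNge => /negP; apply; rewrite -[leRHS]addr0 lerD// mulr_ge0_le0.
Qed.

(** If the outer signs differ, the middle one differs from exactly one of them; if they agree,
    disjointness forces all three to agree. At a + b = pi the sine of the sum vanishes, and
    [angle_probC] takes over. *)
Lemma angle_probD (a b : R) : 0 <= a -> 0 <= b -> a + b < pi ->
  angle_prob (a + b) = angle_prob a + angle_prob b.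
Proof.
move=> a0 b0 abpi; rewrite -(mismatch_ray_rot a b) /angle_prob.
rewrite -(Pr_setU gauss2 (mmis 0 a) (mmis a (a + b))); last first.
  apply/seteqP; split => z // -[h1 h2].
  exact: (angle_mismatch_disjoint a0 b0 abpi h1 h2).
congr (Pr _ _); apply/seteqP; split => z /=.
  rewrite /mismatch/=; case: (0 < ray_coord 0 z); case: (0 < ray_coord a z);
  case: (0 < ray_coord (a + b) z) => //= _; by [left|right].
have := @angle_mismatch_disjoint a b z a0 b0 abpi; rewrite /mismatch/=.
case: (0 < ray_coord 0 z); case: (0 < ray_coord a z);
case: (0 < ray_coord (a + b) z) => //= h [] //; by case: (h isT).
Qed.

Let measurable_axis0 : measurable [set z : mR * mR | z.1 = 0].
Proof.
rewrite (_ : [set _ | _] = fst @^-1` [set 0])//.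
exact: measurable_preimage.
Qed.

Lemma gauss2_axis0 : Pr gauss2 [set z | z.1 = 0] = 0.
Proof.
apply: EFin_inj; rewrite (EFin_Pr _ measurable_axis0).
  rewrite (_ : [set _ | _] = [set 0] `*` setT); last first.
    by apply/seteqP; split => -[x y]//= [].
  rewrite [LHS]product_measure1E//.
  have g0 : gauss [set 0] = 0%E.
    apply/eqP; rewrite eq_le measure_ge0 andbT.
    by have := @gauss_itv_le R 0 (lexx _); rewrite oppr0 set_itv1 mulr0.
by rewrite [X in (X * _)%E]g0 mul0e.
Qed.

(** Directions 0 and pi have opposite coordinates, so off the null line z.1 = 0 every third
    direction is separated from exactly one of them. *)
Lemma angle_probC (a : R) : angle_prob a + angle_prob (pi - a) = 1.
Proof.
pose A := mismatch (ray_coord 0) (ray_coord a).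
pose B := mismatch (ray_coord a) (ray_coord pi).
have Bpi : Pr gauss2 B = angle_prob (pi - a).
  by rewrite -(mismatch_ray_rot a (pi - a)) [a + _]addrC subrK.
have m0 := measurable_axis0.
have mA : measurable A by exact: mmis.
have mB : measurable B by exact: mmis.
have AB z : z.1 != 0 -> (A z <-> ~ B z).
  move=> z0.
  have r0 : ray_coord 0 z = z.1 by rewrite /ray_coord sin0 cos0 mul0r addr0 mul1r.
  have rpi : ray_coord pi z = - z.1.
    by rewrite /ray_coord sinpi cospi mul0r addr0 mulN1r.
  rewrite /A /B /mismatch/= r0 rpi oppr_gt0.
  have -> : (z.1 < 0) = ~~ (0 < z.1) by rewrite ltNge le_eqVlt eq_sym (negbTE z0).
  move: (0 < z.1) (0 < ray_coord a z) => u v; clear.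
  by case: u; case: v; split=> // h; case: (h isT).
rewrite -Bpi; apply/eqP; rewrite eq_le; apply/andP; split.
- have : Pr gauss2 A <= Pr gauss2 (~` B `|` [set z | z.1 = 0]).
    apply: Pr_le mA (measurableU _ _ (measurableC mB) m0) _.
    move=> z Az; have [z0|z0] := eqVneq z.1 0; first by right.
    by left; apply: (AB z z0).1.
  move/le_trans => /(_ _ (Pr_setU_le _ (measurableC mB) m0)).
  by rewrite (Pr_setC _ mB) gauss2_axis0 addr0 lerBrDr.
- have : Pr gauss2 (~` B) <= Pr gauss2 (A `|` [set z | z.1 = 0]).
    apply: Pr_le (measurableC mB) (measurableU _ _ mA m0) _.
    move=> z Bz; have [z0|z0] := eqVneq z.1 0; first by right.
    by left; apply: (AB z z0).2.
  move/le_trans => /(_ _ (Pr_setU_le _ mA m0)).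
  by rewrite (Pr_setC _ mB) gauss2_axis0 addr0 lerBlDr.
Qed.

Lemma angle_prob_pihalf : angle_prob (pi / 2) = 2^-1.
Proof.
have := angle_probC (pi / 2).
have -> : pi - pi / 2 = pi / 2 :> R by lra.
by lra.
Qed.

Lemma angle_prob_mulrn (n : nat) (h : R) : 0 <= h -> n%:R * h < pi ->
  angle_prob (n%:R * h) = n%:R * angle_prob h.
Proof.
move=> h0; elim: n => [|n ih] hpi.
  rewrite !mul0r; have := @angle_probD 0 0 (lexx _) (lexx _).
  by rewrite addr0 => /(_ (pi_gt0 R)); lra.
rewrite -!natr1 !mulrDl !mul1r in hpi *.
rewrite angle_probD// ?ih ?mulr_ge0//.
by apply: le_lt_trans hpi; rewrite lerDl.
Qed.

Lemma angle_prob_le a b : 0 <= a -> a <= b -> b < pi -> angle_prob a <= angle_prob b.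
Proof.
move=> a0 ab bpi; rewrite -[b](subrK a) addrC angle_probD ?subr_ge0//.
  by rewrite lerDl angle_prob_ge0.
by rewrite addrC subrK.
Qed.

(** A monotone additive function is linear: [th] is squeezed between consecutive multiples of pi /
    (2 n), whose values are known because [n] such steps make a right angle, of probability 1/2. *)
Lemma angle_prob_approx (n : nat) (th : R) : (1 < n)%N -> 0 <= th -> th <= pi / 2 ->
  `|angle_prob th - th / pi| <= n%:R^-1.
Proof.
move=> n1 th0 thpi.
have pi0 := pi_gt0 R.
have n0 : 0 < n%:R :> R by rewrite ltr0n ltnW.
have n2 : 2 <= n%:R :> R by rewrite ler_nat.
have [h hE] : exists h : R, h = pi / (2 * n%:R) by eexists.
have h0 : 0 < h by rewrite hE divr_gt0// mulr_gt0.
have nh : n%:R * h = pi / 2 by rewrite hE; field; rewrite gt_eqF.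
have Fh : angle_prob h = (2 * n%:R)^-1.
  have := @angle_prob_mulrn n h (ltW h0); rewrite nh angle_prob_pihalf.
  move=> /(_ ltac:(lra)) e; rewrite invfM e mulrC mulKf// gt_eqF//.
have [j /andP[jl ju]] : exists j : nat, j%:R <= th / h < j.+1%:R.
  by exists (Num.truncn (th / h)); rewrite truncn_itv// divr_ge0// ltW.
rewrite ler_pdivlMr// in jl; rewrite ltr_pdivrMr// in ju.
(* This is where n >= 2 enters: the multiple of [h] just above [th] stays below pi, inside the range
   of additivity. *)
have hpi4 : h <= pi / 4.
  rewrite hE ler_pM2l// lef_pV2 ?posrE ?mulr_gt0//; lra.
rewrite -natr1 mulrDl mul1r in ju.
have jh1 : j.+1%:R * h <= th + h by rewrite -natr1; lra.
have j1pi : j.+1%:R * h < pi by lra.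
have jh0 : 0 <= j%:R * h by rewrite mulr_ge0// ltW.
have j1E : j.+1%:R * h = j%:R * h + h by rewrite -natr1 mulrDl mul1r.
have l1 : j%:R * angle_prob h <= angle_prob th.
  rewrite -(angle_prob_mulrn (ltW h0)); last by lra.
  have thpi1 : th < pi by lra.
  exact: angle_prob_le jh0 jl thpi1.
have l2 : angle_prob th <= j.+1%:R * angle_prob h.
  have thj : th <= j.+1%:R * h by rewrite j1E ltW.
  rewrite -(angle_prob_mulrn (ltW h0) j1pi).
  exact: angle_prob_le th0 thj j1pi.
have thE : th / pi = th / h * (2 * n%:R)^-1.
  by rewrite hE invf_div mulrA mulrAC mulfK// gt_eqF// mulr_gt0.
have q0 : 0 < (2 * n%:R)^-1 :> R by rewrite invr_gt0 mulr_gt0.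
have q1 : (2 * n%:R)^-1 * 2 = n%:R^-1 :> R by field; rewrite gt_eqF.
rewrite Fh in l1 l2; rewrite thE.
move: (2 * n%:R)^-1 q0 q1 l1 l2 => q q0 <- l1 l2.
have t1 : j%:R * q <= th / h * q by rewrite (ler_pM2r q0) (ler_pdivlMr _ _ h0).
have t2 : th / h * q <= (j%:R + 1) * q.
  by rewrite (ler_pM2r q0) (ler_pdivrMr _ _ h0) mulrDl mul1r ltW.
move: l2; rewrite -natr1 => l2.
move: (th / h * q) (angle_prob th) t1 t2 l1 l2 => v w t1 t2 l1 l2.
by rewrite ler_norml; lra.
Qed.

Lemma angle_probE (th : R) : 0 <= th <= pi -> angle_prob th = th / pi.
Proof.
have pi0 := pi_gt0 R.
have half t : 0 <= t -> t <= pi / 2 -> angle_prob t = t / pi.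
  move=> t0 tpi; apply/eqP; rewrite -subr_eq0 -normr_eq0 eq_le normr_ge0 andbT.
  apply/ler_addgt0Pl => e e0; rewrite addr0.
  pose n := (Num.truncn e^-1).+2.
  have en : e^-1 < n%:R.
    have ei : 0 <= e^-1 by rewrite invr_ge0 ltW.
    have /andP[_ /lt_trans] := truncn_itv ei; apply.
    by rewrite ltr_nat.
  rewrite (le_trans (@angle_prob_approx n t _ t0 tpi))//.
  by rewrite -[leRHS]invrK lef_pV2 ?posrE ?invr_gt0// ltW.
move=> /andP[t0 tpi]; have [tl|tg] : th <= pi / 2 \/ pi / 2 <= th by lra.
  exact: half.
have := angle_probC th; rewrite (half (pi - th)); [|lra|lra].
have -> : (pi - th) / pi = 1 - th / pi by rewrite mulrBl divff// gt_eqF.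
by move: (th / pi) => v; lra.
Qed.

End Angle.

(** * Sums of independent Gaussian variables *)

Section StandardFamily.
Context d {T : measurableType d} {R : realType} (P : probability T R).
Local Open Scope ereal_scope.

Local Notation mR := (measurableTypeR R).
Local Notation gauss := (@gauss R).
Local Notation gauss2 := (gauss \x gauss).

(** Indexing by naturals with a bound [N] avoids casts between ordinals when coordinates are rotated
    or a noise coordinate is appended. Independence and the standard law are stated in one
    formula. *)
Definition iid_std (N : nat) (g : nat -> T -> mR) :=
  (forall i, (i < N)%N -> measurable_fun [set: T] (g i)) /\
  forall B : nat -> set mR, (forall i, measurable (B i)) ->
    P (\bigcap_(i < N) (g i @^-1` B i)) = \prod_(i < N) gauss (B i).

(** The law of the pair, restricted to the event on the other coordinates, is a finite measure known
    on rectangles. Keeping that event in the statement is what preserves independence under a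
    rotation. *)
Lemma iid_std_pair N g (i j : nat) (B : nat -> set mR) (S : set (mR * mR)) :
  iid_std N g -> (i < N)%N -> (j < N)%N -> i != j ->
  (forall k, measurable (B k)) -> measurable S ->
  P ([set t | S (g i t, g j t)] `&`
     \bigcap_(k in [set k | (k < N)%N && (k != i) && (k != j)]) (g k @^-1` B k)) =
  gauss2 S * \prod_(k < N | (k != i :> nat) && (k != j :> nat)) gauss (B k).
Proof.
move=> [mg gE] iN jN ij mB mS.
set E := \bigcap_(k in _) _; set p := \prod_(k < N | _) _.
have mE : measurable E.
  apply: bigcap_measurableType => k /= /andP[/andP[kN _] _].
  exact: measurable_preimage (mg _ kN) _.
have p0 : 0 <= p by apply: prode_ge0.
have pE : p = (fine p)%:E.
  by rewrite fineK// prode_fin_num// => k _; exact: fin_num_measure.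
have mij : measurable_fun [set: T] (fun t => (g i t, g j t)).
  by apply: measurable_fun_pair; exact: mg.
have fp0 : (0 <= fine p)%R by exact: fine_ge0.
pose m1 := image_measure (mrestr P mE) mij.
pose m2 := mscale (NngNum fp0) gauss2.
rewrite pE muleC.
apply: (@finite_measure_rect_unique R _ _ _ _ m1 m2 _ _ S mS).
  rewrite /m1/= /image_measure/= /pushforward/= /mrestr preimage_setT setTI.
  exact: le_lt_trans (probability_le1 P mE) (ltry 1).
move=> A C mA mC.
transitivity (p * (gauss A * gauss C)); last first.
  by rewrite -product_measure1E// [X in X * _]pE.
rewrite /m1/= /image_measure/= /pushforward/= /mrestr.
pose B' k := if k == i then A else if k == j then C else B k.
have mB' k : measurable (B' k) by rewrite /B'; case: ifP => _ //; case: ifP.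
have B'i : B' i = A by rewrite /B' eqxx.
have B'j : B' j = C by rewrite /B' eq_sym (negbTE ij) eqxx.
have B'k k : k != i -> k != j -> B' k = B k.
  by move=> /negbTE ki /negbTE kj; rewrite /B' ki kj.
have := gE _ mB'; rewrite (bigD1 (Ordinal iN))//= (bigD1 (Ordinal jN))/=; last first.
  by rewrite -val_eqE/= eq_sym.
rewrite B'i B'j muleA => e; rewrite [RHS]muleC; move: e.
rewrite (eq_bigr (fun k : 'I_N => gauss (B k))); last first.
  by move=> k /andP[ki kj]; rewrite B'k.
move=> <-; congr (P _); apply/seteqP; split=> t /=.
  move=> [[At Ct] Et] k /= kN.
  have [->|ki] := eqVneq k i; first by rewrite B'i.
  have [->|kj] := eqVneq k j; first by rewrite B'j.
  by rewrite B'k//; apply: Et; rewrite /= kN ki kj.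
move=> h; split; first by split; [rewrite -B'i|rewrite -B'j]; exact: h.
by move=> k /= /andP[/andP[kN ki] kj]; rewrite -B'k//; exact: h.
Qed.

Lemma iid_std_pair_law N g (i j : nat) (S : set (mR * mR)) :
  iid_std N g -> (i < N)%N -> (j < N)%N -> i != j -> measurable S ->
  P [set t | S (g i t, g j t)] = gauss2 S.
Proof.
move=> gN iN jN ij mS.
have := iid_std_pair gN iN jN ij (fun=> measurableT) mS.
rewrite big1 ?mule1; last by move=> k _; exact: probability_setT.
by rewrite bigcapT ?setIT.
Qed.

Definition givens (i j : nat) (c s : R) (g : nat -> T -> mR) : nat -> T -> mR :=
  fun k => if k == i then fun t => (c * g i t + s * g j t)%R
           else if k == j then fun t => (- s * g i t + c * g j t)%R else g k.

(** The preimage of a rectangle under a rotation is no longer a rectangle, hence the appeal to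
    [iid_std_pair] with a general planar set. *)
Lemma iid_std_givens N g i j (c s : R) : iid_std N g ->
  (i < N)%N -> (j < N)%N -> i != j -> (c ^+ 2 + s ^+ 2 = 1)%R ->
  iid_std N (givens i j c s g).
Proof.
move=> gN iN jN ij cs1; have [mg gE] := gN; split=> [k kN|B mB].
  rewrite /givens; case: ifP => _.
    by apply: measurable_funD; apply: measurable_funM => //; exact: mg.
  case: ifP => _; last exact: mg.
  by apply: measurable_funD; apply: measurable_funM => //; exact: mg.
have mBij : measurable (B i `*` B j) by exact: measurableX.
have mrot : measurable (plane_rot c s @^-1` (B i `*` B j)).
  exact: measurable_preimage (mu2_invariant_rot cs1).1 _.
have := iid_std_pair gN iN jN ij mB mrot.
rewrite gauss2_rot// (product_measure1E gauss gauss (mB i) (mB j)).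
have -> : \prod_(k < N) gauss (B k) = gauss (B i) * gauss (B j) *
    \prod_(k < N | (k != i :> nat) && (k != j :> nat)) gauss (B k).
  rewrite (bigD1 (Ordinal iN))//= (bigD1 (Ordinal jN))/= ?muleA//.
  by rewrite -val_eqE/= eq_sym.
move=> <-; congr (P _); apply/seteqP; split=> t /=.
  move=> h; split.
    split=> /=; first by have := h i iN; rewrite /givens /= eqxx.
    by have := h j jN; rewrite /givens /= eq_sym (negbTE ij) eqxx.
  move=> k /= /andP[/andP[kN /negbTE ki] /negbTE kj].
  by have := h k kN; rewrite /givens /= ki kj.
move=> [[/= hi hj] h] k /= kN; rewrite /givens.
have [->//|ki] := eqVneq k i; have [->//|kj] := eqVneq k j.
by apply: h; rewrite /= kN ki kj.
Qed.

(** Polar coordinates; at the origin the angle is arbitrary and taken to be 0. *)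
Lemma givens_coef (p q : R) : exists c s r : R,
  [/\ (c ^+ 2 + s ^+ 2 = 1)%R, (0 <= r)%R, p = (c * r)%R & q = (s * r)%R].
Proof.
pose r := Num.sqrt (p ^+ 2 + q ^+ 2).
have r2 : (r ^+ 2 = p ^+ 2 + q ^+ 2)%R by rewrite sqr_sqrtr// addr_ge0// sqr_ge0.
have r0 : (0 <= r)%R by exact: sqrtr_ge0.
have [rz|rn] := eqVneq r 0%R.
  exists 1%R, 0%R, 0%R; rewrite expr1n expr0n addr0 !mulr0 lexx.
  move/eqP: r2; rewrite rz expr0n eq_sym paddr_eq0 ?sqr_ge0// !sqrf_eq0.
  by move=> /andP[/eqP -> /eqP ->].
exists (p / r)%R, (q / r)%R, r; split; rewrite ?divfK//.
by rewrite !expr_div_n -mulrDl -r2 divff// sqrf_eq0.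
Qed.

(* Each new variable is absorbed by a rotation with the first one, which kills
   its coefficient in the first sum, and then by one with the second one. *)
Lemma iid_std_reduce N (g : nat -> T -> mR) (x y : nat -> R) k :
  iid_std N g -> (1 < k <= N)%N ->
  exists (g' : nat -> T -> mR) (a b c : R),
  [/\ iid_std N g', (forall i, (k <= i)%N -> g' i = g i),
   [/\ (0 <= a)%R, (a ^+ 2 = \sum_(i < k) x i ^+ 2)%R,
   (a * b = \sum_(i < k) x i * y i)%R &
   (b ^+ 2 + c ^+ 2 = \sum_(i < k) y i ^+ 2)%R],
   forall t, (\sum_(i < k) x i * g i t = a * g' 0%N t)%R &
   forall t, (\sum_(i < k) y i * g i t = b * g' 0%N t + c * g' 1%N t)%R].
Proof.
move=> gN; elim: k => // k ih /= kN.
have [k1|k1] := leqP k 1.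
  have {ih} k1E : k = 1%N by apply/eqP; rewrite eqn_leq k1; case/andP: kN.
  rewrite k1E in kN *; have [c [s [r [cs1 r0 x0 x1]]]] := givens_coef (x 0%N) (x 1%N).
  exists (givens 0 1 c s g), r, (c * y 0%N + s * y 1%N)%R, (- s * y 0%N + c * y 1%N)%R.
  split.
  - by apply: iid_std_givens => //; exact: ltnW.
  - by move=> [|[|i]].
  - rewrite !big_ord_recr !big_ord0/= !add0r x0 x1; split => //.
    + by rewrite !exprMn -mulrDl cs1 mul1r.
    + by ring.
    + by rewrite -[RHS]mul1r -cs1; ring.
  - by move=> t; rewrite !big_ord_recr big_ord0/= add0r x0 x1 /givens/=; ring.
  - move=> t; rewrite !big_ord_recr big_ord0/= add0r /givens/=.
    by rewrite -[LHS]mul1r -cs1; ring.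
have [|g1 [a [b [c [g1N g1k [a0 a2 ab bc] gx gy]]]]] := ih; first by rewrite k1 ltnW//; case/andP: kN.
have kN' : (k < N)%N by case/andP: kN.
have k0 : (0 != k)%N by rewrite eq_sym -lt0n (leq_trans _ k1).
have k1' : (1 != k)%N by rewrite eq_sym neq_ltn k1 orbT.
have N0 : (0 < N)%N by rewrite (leq_trans _ kN').
have N1 : (1 < N)%N by rewrite (leq_trans _ kN')// (leq_trans k1).
(* Rotating coordinates 0 and [k] turns the coefficients (a, x k) of the first sum into (r, 0);
   those of the second sum, (b, y k), become (b', e). *)
have [c1 [s1 [r [cs1 r0 ar xr]]]] := givens_coef a (x k).
pose g2 := givens 0 k c1 s1 g1.
pose b' := (c1 * b + s1 * y k)%R; pose e := (- s1 * b + c1 * y k)%R.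
(* Rotating coordinates 1 and [k] gathers (c, e) into [q] and leaves coordinate 0, hence the first
   sum, untouched. *)
have [c2 [s2 [q [cs2 q0 cq eq]]]] := givens_coef c e.
have g2N : iid_std N g2 by exact: iid_std_givens.
have g20 t : g2 0%N t = (c1 * g1 0%N t + s1 * g1 k t)%R by rewrite /g2 /givens eqxx.
have g2k t : g2 k t = (- s1 * g1 0%N t + c1 * g1 k t)%R.
  by rewrite /g2 /givens eq_sym (negbTE k0) eqxx.
have g21 t : g2 1%N t = g1 1%N t by rewrite /g2 /givens/= (negbTE k1').
have G0 : givens 1 k c2 s2 g2 0%N = g2 0%N by rewrite /givens/= (negbTE k0).
exists (givens 1 k c2 s2 g2), r, b', q; split.
- exact: iid_std_givens.
- move=> i ki; rewrite /givens.
  have -> : (i == 1)%N = false by apply/negbTE; rewrite neq_ltn (leq_trans k1 (ltnW ki)) orbT.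
  have ik : (i == k) = false by apply/negbTE; rewrite neq_ltn ki orbT.
  rewrite ik /g2 /givens ik.
  have -> : (i == 0)%N = false by apply/negbTE; rewrite -lt0n (leq_trans _ ki).
  by rewrite g1k// ltnW.
- rewrite !big_ord_recr/= -a2 -ab -bc ar xr cq; split => //.
  + by rewrite !exprMn -mulrDl cs1 mul1r.
  + by rewrite /b'; ring.
  + transitivity (b' ^+ 2 + (c2 ^+ 2 + s2 ^+ 2) * q ^+ 2)%R; first by rewrite cs2 mul1r.
    transitivity (b' ^+ 2 + (c2 * q) ^+ 2 + e ^+ 2)%R; first by rewrite eq; ring.
    transitivity ((c1 ^+ 2 + s1 ^+ 2) * (b ^+ 2 + y k ^+ 2) + (c2 * q) ^+ 2)%R.
      by rewrite /b' /e; ring.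
    by rewrite cs1; ring.
- move=> t; rewrite big_ord_recr/= gx G0 g20 -g1k// ar xr; ring.
- move=> t; rewrite big_ord_recr/= gy -g1k//.
  rewrite G0.
  have -> : givens 1 k c2 s2 g2 1%N t = (c2 * g2 1%N t + s2 * g2 k t)%R.
    by rewrite /givens/=.
  rewrite g21 g20 g2k.
  transitivity (b' * (c1 * g1 0%N t + s1 * g1 k t) + ((c2 * q) * g1 1%N t
     + (s2 * q) * (- s1 * g1 0%N t + c1 * g1 k t)))%R; last by ring.
  rewrite -cq -eq /b' /e.
  transitivity ((c1 ^+ 2 + s1 ^+ 2) * (b * g1 0%N t + y k * g1 k t) + c * g1 1%N t)%R.
    by rewrite cs1; ring.
  by ring.
Qed.

(** The matrix with rows (a, 0) and (b, c) is the Cholesky factor of the Gram matrix of [x] and [y].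
    A reflection of the plane makes [c] nonnegative, so that it can later be recovered from its
    square. *)
Lemma iid_std_sums_law N (g : nat -> T -> mR) (x y : nat -> R) :
  iid_std N g -> (1 < N)%N ->
  exists a b c : R, [/\ (0 <= a)%R, (0 <= c)%R,
    (a ^+ 2 = \sum_(i < N) x i ^+ 2)%R,
    (a * b = \sum_(i < N) x i * y i)%R &
    (b ^+ 2 + c ^+ 2 = \sum_(i < N) y i ^+ 2)%R] /\
  forall D : set (mR * mR), measurable D ->
    Pr P [set t | D (\sum_(i < N) x i * g i t, \sum_(i < N) y i * g i t)%R] =
    Pr gauss2 [set z | D (a * z.1, b * z.1 + c * z.2)%R].
Proof.
move=> gN N1.
have [|g' [a [b [c [g'N _ [a0 a2 ab bc] gx gy]]]]] := @iid_std_reduce N g x y N gN.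
  by rewrite N1 leqnn.
have mL u v w : measurable_fun [set: mR * mR]
    (fun z : mR * mR => (u * z.1, v * z.1 + w * z.2)%R : mR * mR).
  apply: measurable_fun_pair; first exact: measurable_funM.
  by apply: measurable_funD; exact: measurable_funM.
exists a, b, `|c|%R; rewrite real_normK ?num_real//; split => // D mD.
have mS w : measurable [set z : mR * mR | D (a * z.1, b * z.1 + w * z.2)%R].
  exact: measurable_preimage (mL _ _ _) mD.
transitivity (Pr gauss2 [set z | D (a * z.1, b * z.1 + c * z.2)%R]).
  congr fine.
  transitivity (P [set t | D (a * g' 0%N t, b * g' 0%N t + c * g' 1%N t)%R]); last first.
    exact: (iid_std_pair_law g'N (ltnW N1) N1 isT (mS c)).
  by congr (P _); apply/seteqP; split => t /=; rewrite gx gy.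
have [c0|c0] := leP 0%R c; first by rewrite ger0_norm.
rewrite (ltr0_norm c0) -(Pr_gauss2_flip (mS (- c)%R)).
by congr (Pr _ _); apply/seteqP; split => z /=; rewrite mulrNN.
Qed.

End StandardFamily.

(** * Independent families *)

Section IndependentFamilies.
Context d {T : measurableType d} {R : realType} (P : probability T R).
Local Open Scope ereal_scope.

Definition independent_family d' (U : measurableType d') (I : finType)
    (X : I -> T -> U) :=
  (forall i, measurable_fun [set: T] (X i)) /\
  forall D : I -> set U, (forall i, measurable (D i)) ->
    P (\bigcap_i (X i @^-1` D i)) = \prod_i P (X i @^-1` D i).

Definition update (I : eqType) (V : Type) (a : I) (v : V) (f : I -> V) : I -> V :=
  fun i => if i == a then v else f i.

Lemma update_eq (I : eqType) (V : Type) (a : I) (v : V) (f : I -> V) :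
  update a v f a = v.
Proof. by rewrite /update eqxx. Qed.

Lemma update_neq (I : eqType) (V : Type) (a i : I) (v : V) (f : I -> V) :
  i != a -> update a v f i = f i.
Proof. by rewrite /update => /negbTE ->. Qed.

(** One index at a time, a rectangle is traded for an arbitrary measurable set: with the other sets
    fixed, both sides are finite measures in that one set and agree on rectangles. *)
Lemma independent_family_rect d1 d2 (T1 : measurableType d1)
    (T2 : measurableType d2) (I : finType) (X : I -> T -> T1 * T2) :
  (forall i, measurable_fun [set: T] (X i)) ->
  (forall (B : I -> set T1) (C : I -> set T2),
    (forall i, measurable (B i)) -> (forall i, measurable (C i)) ->
    P (\bigcap_i (X i @^-1` (B i `*` C i))) =
    \prod_i P (X i @^-1` (B i `*` C i))) ->
  independent_family X.
Proof.
move=> mX rect; split=> // D mD.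
pose is_rect (S : set (T1 * T2)) := exists A B,
  [/\ measurable A, measurable B & S = A `*` B].
(* [s] lists the indices where the set is already arbitrary. *)
suff gen (s : seq I) (D' : I -> set (T1 * T2)) :
    (forall i, measurable (D' i)) -> (forall i, i \notin s -> is_rect (D' i)) ->
    P (\bigcap_i (X i @^-1` D' i)) = \prod_i P (X i @^-1` D' i).
  by apply: (gen (index_enum I)) => // i; rewrite mem_index_enum.
elim: s D' => [|a s ih] {mD}D mD rD.
  have /choice[B /choice[C BC]] := fun i => rD i isT.
  have -> : D = fun i => B i `*` C i by apply/funext => i; have [] := BC i.
  by apply: (rect B C) => i; have [] := BC i.
pose E := \bigcap_(i in [set i | i != a]) (X i @^-1` D i).
have mE : measurable E.
  apply: fin_bigcap_measurable => [|i _]; first exact: finite_finset.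
  exact: measurable_preimage.
pose c := fine (\prod_(i | i != a) P (X i @^-1` D i)).
have cE : c%:E = \prod_(i | i != a) P (X i @^-1` D i).
  rewrite /c fineK// prode_fin_num// => i _; apply: fin_num_measure.
  exact: measurable_preimage.
have c0 : (0 <= c)%R by apply: fine_ge0; apply: prode_ge0.
pose m1 := image_measure (mrestr P mE) (mX a).
pose m2 := mscale (NngNum c0) (image_measure P (mX a)).
have capE S : \bigcap_i (X i @^-1` update a S D i) = X a @^-1` S `&` E.
  apply/seteqP; split=> t.
    move=> h; split; first by have := h a Logic.I; rewrite update_eq.
    by move=> i /= ia; have := h i Logic.I; rewrite update_neq.
  move=> [ta tE] i _; have [->|ia] := eqVneq i a; first by rewrite update_eq.
  by rewrite update_neq//; exact: tE.
have prodE S : \prod_i P (X i @^-1` update a S D i) = P (X a @^-1` S) * c%:E.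
  rewrite (bigD1 a)//= update_eq cE; congr (_ * _).
  by apply: eq_bigr => i ia; rewrite update_neq.
have DE : D = update a (D a) D.
  by apply/funext => i; rewrite /update; case: eqP => [->|].
rewrite DE capE prodE muleC.
apply: (@finite_measure_rect_unique R _ _ _ _ m1 m2) => //.
  rewrite /m1/= /image_measure/= /pushforward/= /mrestr preimage_setT setTI.
  exact: le_lt_trans (probability_le1 P mE) (ltry 1).
move=> A B mA mB; rewrite /m1/m2/= /mscale/= /image_measure/= /pushforward/= /mrestr.
rewrite -capE muleC -prodE; apply: ih.
  by move=> i; rewrite /update; case: ifP => _ //; exact: measurableX.
move=> i si; have [->|ia] := eqVneq i a.
  by rewrite update_eq; exists A, B.
by rewrite update_neq//; apply: rD; rewrite inE negb_or ia.
Qed.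

(** The same induction, trading indicators for nonnegative functions. Finiteness of the integrals
    makes the product over the other indices a real number, which can scale a measure. *)
Lemma independent_family_integral_prod d' (U : measurableType d') (I : finType)
    (X : I -> T -> U) (h : I -> U -> R) :
  independent_family X ->
  (forall i, measurable_fun [set: U] (h i)) -> (forall i u, (0 <= h i u)%R) ->
  (forall i, \int[P]_t (h i (X i t))%:E < +oo) ->
  \int[P]_t (\prod_i h i (X i t))%:E = \prod_i \int[P]_t (h i (X i t))%:E.
Proof.
move=> [mX XE].
pose is_indic (f : U -> R) := exists2 S, measurable S & f = \1_S.
suff gen (s : seq I) (f : I -> U -> R) : (forall i, measurable_fun [set: U] (f i)) ->
    (forall i u, (0 <= f i u)%R) ->
    (forall i, \int[P]_t (f i (X i t))%:E < +oo) ->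
    (forall i, i \notin s -> is_indic (f i)) ->
    \int[P]_t (\prod_i f i (X i t))%:E = \prod_i \int[P]_t (f i (X i t))%:E.
  move=> mh h0 hoo; apply: (gen (index_enum I)) => // i.
  by rewrite mem_index_enum.
elim: s f => [|a s ih] f mf f0 foo rf.
  have /choice[S SE] : forall i, exists S, measurable S /\ f i = \1_S.
    by move=> i; have [S mS fS] := rf i isT; exists S.
  have mXS i : measurable (X i @^-1` S i).
    by apply: measurable_preimage; have [] := SE i.
  transitivity (P (\bigcap_i (X i @^-1` S i))).
    have mcap : measurable (\bigcap_i (X i @^-1` S i)).
      by apply: fin_bigcap_measurable => [|i _]; first exact: finite_finset.
    rewrite -[RHS]mul1e -[LHS]/(integral _ _ _).
    rewrite -integral_cst//.
    rewrite [RHS]integral_mkcond; apply: eq_integral => t _.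
    rewrite patchE; case: ifPn => [|].
      rewrite inE => tS; rewrite big1// => i _.
      have [_ ->] := SE i; rewrite indicE mem_set//; exact: tS.
    rewrite notin_setE -existsNP => -[i /not_implyP[_ ni]].
    rewrite (bigD1 i)//=; have [_ ->] := SE i.
    by rewrite indicE memNset ?mul0r.
  rewrite XE; last by move=> i; have [] := SE i.
  apply: eq_bigr => i _; have [mS ->] := SE i.
  rewrite -(setIT (X i @^-1` S i)) -integral_indic//.
pose W t := (\prod_(i | i != a) f i (X i t))%R.
have mW : measurable_fun [set: T] W.
  rewrite /W; under eq_fun do rewrite -big_filter.
  by apply: measurable_prod => i _; exact: measurableT_comp.
have W0 t : (0 <= W t)%R by apply: prodr_ge0.
pose c := fine (\prod_(i | i != a) \int[P]_t (f i (X i t))%:E).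
have cE : c%:E = \prod_(i | i != a) \int[P]_t (f i (X i t))%:E.
  rewrite /c fineK// prode_fin_num// => i _.
  by rewrite ge0_fin_numE//; apply: integral_ge0 => t _; rewrite lee_fin.
have c0 : (0 <= c)%R.
  by apply: fine_ge0; apply: prode_ge0 => i _; apply: integral_ge0 => t _; rewrite lee_fin.
pose nu := mscale (NngNum c0) (image_measure P (mX a)).
rewrite (bigD1 a)//= -cE.
transitivity (\int[P]_t ((f a (X a t))%:E * (W t)%:E)).
  by apply: eq_integral => t _; rewrite (bigD1 a)//= EFinM.
(* With the other factors as density [W], the image of [P] under [X a] is [c] times the law of
   [X a]: this is the induction hypothesis with an indicator at [a]. *)
rewrite (@ge0_integral_density R _ _ _ _ P nu W (X a) (EFin \o f a))//; first last.
- by move=> z; rewrite lee_fin.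
- exact/measurable_EFinP.
- move=> S mS; rewrite /nu/= /mscale/= /image_measure/= /pushforward/=.
  transitivity (\int[P]_t (\prod_i update a (\1_S : U -> R) f i (X i t))%:E).
    rewrite integral_mkcond; apply: eq_integral => t _.
    rewrite (bigD1 a)//= update_eq patchE indicE.
    rewrite (eq_bigr (fun i => f i (X i t))); last by move=> i ia; rewrite update_neq.
    rewrite (_ : (t \in X a @^-1` S) = (X a t \in S)); last first.
      by apply/idP/idP => /set_mem tS; exact: mem_set.
    by case: ifP => _; rewrite ?mul1r ?mul0r.
  rewrite ih.
  + rewrite (bigD1 a)//= update_eq muleC cE; congr (_ * _).
      by apply: eq_bigr => i ia; rewrite update_neq.
    rewrite -(setIT (X a @^-1` S)) -integral_indic//.
    exact: measurable_preimage.
  + by move=> i; rewrite /update; case: ifP => _ //; exact: measurable_indic.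
  + by move=> i u; rewrite /update; case: ifP => _ //.
  + move=> i; rewrite /update; case: ifP => _ //.
    apply: (@le_lt_trans _ _ (\int[P]_t cst 1 t)).
      apply: ge0_le_integral => //.
      * apply/measurable_EFinP.
        exact: (measurableT_comp (measurable_indic mS)).
      * by move=> t _; rewrite lee_fin indicE; case: (_ \in _).
    by rewrite (integral_cst _ _ 1)// mul1e [X in X < _]probability_setT ltry.
  + move=> i si; have [->|ia] := eqVneq i a.
      by rewrite update_eq; exists S.
    by rewrite update_neq//; apply: rf; rewrite inE negb_or ia.
have mfa : measurable_fun [set: U] (EFin \o f a) by exact/measurable_EFinP.
have fa0 u : [set: U] u -> 0 <= (EFin \o f a) u by rewrite lee_fin.
rewrite /nu ge0_integral_mscale// muleC; congr (_ * _).
by rewrite ge0_integral_pushforward// => u _; exact: fa0.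
Qed.

End IndependentFamilies.

(** * Chernoff bounds *)

Section Chernoff.
Context {R : realType}.

Lemma expRN_le_quad (l : R) : 0 <= l -> expR (- l) <= 1 - l + 2 * l ^+ 2.
Proof.
move=> l0; rewrite expRN.
apply: (@le_trans _ _ (1 + l)^-1).
  by rewrite lef_pV2 ?posrE ?expR_gt0 ?expR_ge1Dx//; lra.
rewrite -[leLHS]mul1r ler_pdivrMr; last by lra.
have := sqr_ge0 l; have := mulr_ge0 (sqr_ge0 l) l0; nra.
Qed.

(** Halving the exponent before inverting 1 - x <= exp (- x) gives 1 / (1 - l/2)^2, which meets the
    quadratic exactly at l = 1, where both equal 4. *)
Lemma expR_le_quad (l : R) : 0 <= l -> l <= 1 -> expR l <= 1 + l + 2 * l ^+ 2.
Proof.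
move=> l0 l1.
have q0 : 0 < 1 - l / 2 by lra.
have e1 : expR (l / 2) <= (1 - l / 2)^-1.
  rewrite -[l / 2 in leLHS]opprK expRN lef_pV2 ?posrE ?expR_gt0//.
  by have := expR_ge1Dx (- (l / 2)).
have e2 : expR l = expR (l / 2) ^+ 2 by rewrite expr2 -expRD; congr expR; lra.
rewrite e2; apply: (@le_trans _ _ ((1 - l / 2)^-1 ^+ 2)).
  by rewrite ler_pXn2r// ?nnegrE ?expR_ge0// invr_ge0 ltW.
rewrite exprVn -[leLHS]mul1r ler_pdivrMr ?exprn_gt0//.
have -> : (1 + l + 2 * l ^+ 2) * (1 - l / 2) ^+ 2 =
  1 + l ^+ 2 / 4 * ((1 - l) * (5 - 2 * l)) by field.
rewrite lerDl mulr_ge0 ?mulr_ge0 ?sqr_ge0//; lra.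
Qed.

Section Mgf.
Context d {T : measurableType d} (P : probability T R).

Lemma integral_indic_Pr (B : set T) : measurable B ->
  (\int[P]_t (\1_B t)%:E = (Pr P B)%:E)%E.
Proof. by move=> mB; rewrite integral_indic// setIT EFin_Pr. Qed.

(** The difference of indicators is -1, 0 or 1 and vanishes off [V], so the quadratic term is paid
    on [V] only. This is the variance gain on which chaining rests. *)
Lemma mgf_indic_diff (B C V : set T) (l : R) :
  measurable B -> measurable C -> measurable V ->
  (B `\` C) `|` (C `\` B) `<=` V -> 0 <= l -> l <= 1 ->
  (\int[P]_t (expR (l * (\1_B t - \1_C t)))%:E <=
    (expR (l * (Pr P B - Pr P C) + 2 * l ^+ 2 * Pr P V))%:E)%E.
Proof.
move=> mB mC mV BCV l0 l1.
have l2 : 0 <= 2 * l ^+ 2 by rewrite mulr_ge0// sqr_ge0.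
have mind (S : set T) : measurable S -> measurable_fun [set: T] (\1_S : T -> R).
  exact: measurable_indic.
have mexp : measurable_fun [set: T] (fun t => (expR (l * (\1_B t - \1_C t)))%:E).
  apply/measurable_EFinP; apply: measurableT_comp => //.
  by apply: measurable_funM => //; apply: measurable_funB; exact: mind.
have mlind (c : R) (S : set T) : measurable S ->
    measurable_fun [set: T] (fun t => (c * \1_S t)%:E).
  by move=> mS; apply/measurable_EFinP; apply: measurable_funM => //; exact: mind.
have lind c (S : set T) : 0 <= c -> measurable S ->
    (\int[P]_t (c * \1_S t)%:E = (c * Pr P S)%:E)%E.
  move=> c0 mS; under eq_integral do rewrite EFinM.
  have S0 t : [set: T] t -> (0 <= (\1_S t : R)%:E)%E by rewrite lee_fin indicE.
  have mS' : measurable_fun [set: T] (fun t => (\1_S t)%:E : \bar R).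
    by apply/measurable_EFinP; exact: mind.
  by rewrite ge0_integralZl// integral_indic_Pr.
pose J : \bar R := (\int[P]_t (expR (l * (\1_B t - \1_C t)))%:E)%E.
have J0 : (0 <= J)%E by apply: integral_ge0 => t _; rewrite lee_fin expR_ge0.
(* The negative term is moved to the left, so that only nonnegative functions are integrated. *)
have JC : (J + (l * Pr P C)%:E <= (1 + l * Pr P B + 2 * l ^+ 2 * Pr P V)%:E)%E.
  have exp0 t : [set: T] t -> (0 <= (expR (l * (\1_B t - \1_C t)))%:E)%E.
    by rewrite lee_fin expR_ge0.
  have ind0 (c : R) (S : set T) t : 0 <= c -> (0 <= (c * \1_S t)%:E)%E.
    by move=> c0; rewrite lee_fin mulr_ge0// indicE.
  have mC' := mlind l _ mC; have mB' := mlind l _ mB.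
  have mV' := mlind (2 * l ^+ 2) _ mV.
  have mT : measurable_fun [set: T] (fun t => (\1_[set: T] t)%:E : \bar R).
    by apply/measurable_EFinP; exact: mind.
  rewrite -(lind _ _ l0 mC) /J -ge0_integralD//; last by move=> t _; exact: ind0.
  have -> : ((1 + l * Pr P B + 2 * l ^+ 2 * Pr P V)%:E =
      \int[P]_t ((\1_[set: T] t)%:E + (l * \1_B t)%:E + (2 * l ^+ 2 * \1_V t)%:E))%E.
    have T0 t : [set: T] t -> (0 <= (\1_[set: T] t)%:E :> \bar R)%E.
      by rewrite lee_fin indicE.
    have B0 t : [set: T] t -> (0 <= (l * \1_B t)%:E)%E by move=> _; exact: ind0.
    have V0 t : [set: T] t -> (0 <= (2 * l ^+ 2 * \1_V t)%:E)%E.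
      by move=> _; exact: ind0.
    have TB0 t : [set: T] t -> (0 <= (\1_[set: T] t)%:E + (l * \1_B t)%:E)%E.
      by move=> _; rewrite adde_ge0 ?T0 ?B0.
    have mTB : measurable_fun [set: T] (fun t => (\1_[set: T] t)%:E + (l * \1_B t)%:E)%E.
      exact: emeasurable_funD.
    rewrite ge0_integralD// ge0_integralD// integral_indic_Pr// Pr_setT.
    by rewrite (lind _ _ l0 mB) (lind _ _ l2 mV) -!EFinD.
  apply: ge0_le_integral => //.
  - by move=> t _; rewrite -EFinD lee_fin addr_ge0 ?expR_ge0// mulr_ge0// indicE.
  - by apply: emeasurable_funD => //; exact: mlind.
  - apply: emeasurable_funD; last exact: mlind.
    apply: emeasurable_funD; last exact: mlind.
    by apply/measurable_EFinP; exact: mind.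
  - move=> t _; rewrite -!EFinD lee_fin !indicE in_setT.
    have ep := expR_le_quad l0 l1; have en := expRN_le_quad l0.
    have e0 := @expR0 R.
    have [tB|tB] := boolP (t \in B); have [tC|tC] := boolP (t \in C);
      have [tV|tV] := boolP (t \in V) => /=.
    + by rewrite subrr mulr0 expR0 !mulr1; lra.
    + by rewrite subrr mulr0 expR0 !mulr1; lra.
    + by rewrite subr0 !mulr1 mulr0; lra.
    + exfalso; move/negP: tV; apply; rewrite inE; apply: BCV; left.
      by split; [exact: set_mem|move/negP: tC => h ?; apply: h; exact: mem_set].
    + by rewrite sub0r mulrN !mulr1 mulr0; lra.
    + exfalso; move/negP: tV; apply; rewrite inE; apply: BCV; right.
      by split; [exact: set_mem|move/negP: tB => h ?; apply: h; exact: mem_set].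
    + by rewrite subrr !mulr0 expR0 !mulr1; lra.
    + by rewrite subrr !mulr0 expR0; lra.
have Jfin : J \is a fin_num.
  rewrite ge0_fin_numE//; apply: le_lt_trans (ltry (1 + l * Pr P B + 2 * l ^+ 2 * Pr P V)).
  by apply: le_trans JC; rewrite leeDl// lee_fin mulr_ge0// Pr_ge0.
move: JC; rewrite -/J -(fineK Jfin) -EFinD !lee_fin => JC.
apply: le_trans (expR_ge1Dx _); rewrite mulrBr; lra.
Qed.

Context d' (U : measurableType d') (I : finType) (X : I -> T -> U).
Hypothesis indepX : independent_family P X.

(** Markov's inequality for the exponential of the sum, which factorizes by independence. General
    [f] lets it serve both indicators and squared Gaussians. *)
Lemma chernoff_sum (f : I -> U -> R) (b : I -> R) (M : R) :
  (forall i, measurable_fun [set: U] (f i)) ->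
  (forall i, (\int[P]_t (expR (f i (X i t)))%:E <= (expR (b i))%:E)%E) ->
  Pr P [set t | M <= \sum_i f i (X i t)] <= expR (\sum_i b i - M).
Proof.
move=> mf fb; have [mX _] := indepX.
have mfX : measurable_fun [set: T] (fun t => \sum_i f i (X i t)).
  by apply: measurable_sum => i; exact: measurableT_comp.
set S := [set t | _].
have mS : measurable S.
  rewrite (_ : S = (fun t => \sum_i f i (X i t)) @^-1` `[M, +oo[%classic).
    exact: measurable_preimage.
  by apply/seteqP; split => t; rewrite /S/= in_itv/= andbT.
have h : ((expR M * Pr P S)%:E <= (expR (\sum_i b i))%:E)%E.
  apply: (@le_trans _ _ (\int[P]_t (expR (\sum_i f i (X i t)))%:E)%E).
    have S0 t : [set: T] t -> (0 <= (\1_S t : R)%:E)%E by rewrite lee_fin indicE.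
    have mS' : measurable_fun [set: T] (fun t => (\1_S t)%:E : \bar R).
      by apply/measurable_EFinP; exact: measurable_indic.
    have eM : (0 <= (expR M)%:E)%E by rewrite lee_fin expR_ge0.
    rewrite EFinM -integral_indic_Pr// -ge0_integralZl//.
    apply: ge0_le_integral => //.
    - exact: emeasurable_funM.
    - by apply/measurable_EFinP; exact: measurableT_comp.
    - move=> t _; rewrite -EFinM lee_fin indicE.
      have [tS|tS] := boolP (t \in S); last by rewrite mulr0 expR_ge0.
      by rewrite mulr1 ler_expR; rewrite inE in tS.
  under eq_integral do rewrite expR_sum.
  rewrite (independent_family_integral_prod (h := fun i u => expR (f i u)) indepX).
  - rewrite expR_sum -prodEFin.
    suff [] : (0 <= \prod_i \int[P]_t (expR (f i (X i t)))%:E)%E /\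
      (\prod_i \int[P]_t (expR (f i (X i t)))%:E <= \prod_i (expR (b i))%:E)%E by [].
    elim/big_ind2 : _ => // [x1 y1 x2 y2 [x10 xy1] [x20 xy2]|i _].
      by split; [exact: mule_ge0|exact: lee_pmul].
    by split=> //; apply: integral_ge0 => t _; rewrite lee_fin expR_ge0.
  - by move=> i; exact: measurableT_comp.
  - by move=> i u; rewrite expR_ge0.
  - by move=> i; apply: le_lt_trans (fb i) (ltry _).
by rewrite expRB ler_pdivlMr ?expR_gt0// mulrC -lee_fin.
Qed.

Lemma chernoff_diff (B C V : set U) (l tau : R) :
  measurable B -> measurable C -> measurable V ->
  (B `\` C) `|` (C `\` B) `<=` V -> 0 <= l -> l <= 1 ->
  Pr P [set t | \sum_i (Pr P (X i @^-1` B) - Pr P (X i @^-1` C)) + tau <=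
     \sum_i (\1_B (X i t) - \1_C (X i t))]
  <= expR (2 * l ^+ 2 * (\sum_i Pr P (X i @^-1` V)) - l * tau).
Proof.
move=> mB mC mV BCV l0 l1; have [mX _] := indepX.
have mXS i (S : set U) : measurable S -> measurable (X i @^-1` S).
  exact: measurable_preimage.
have mind (S : set U) : measurable S -> measurable_fun [set: U] (\1_S : U -> R).
  exact: measurable_indic.
pose f (_ : I) u : R := l * (\1_B u - \1_C u).
have mf i : measurable_fun [set: U] (f i).
  by apply: measurable_funM => //; apply: measurable_funB; exact: mind.
pose b i := l * (Pr P (X i @^-1` B) - Pr P (X i @^-1` C)) +
  2 * l ^+ 2 * Pr P (X i @^-1` V).
have mS (g : I -> U -> R) M : (forall i, measurable_fun [set: U] (g i)) ->
    measurable [set t | M <= \sum_i g i (X i t)].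
  move=> mg; rewrite (_ : [set _ | _] =
      (fun t => \sum_i g i (X i t)) @^-1` `[M, +oo[%classic).
    apply: measurable_preimage => //.
    by apply: measurable_sum => i; exact: measurableT_comp.
  by apply/seteqP; split => t /=; rewrite in_itv/= andbT.
pose M := l * (\sum_i (Pr P (X i @^-1` B) - Pr P (X i @^-1` C)) + tau).
apply: (@le_trans _ _ (Pr P [set t | M <= \sum_i f i (X i t)])).
  apply: Pr_le.
  - apply: (mS (fun _ u => \1_B u - \1_C u)) => i.
    by apply: measurable_funB; exact: mind.
  - exact: mS.
  - by move=> t /= h; rewrite /M /f -mulr_sumr ler_wpM2l.
apply: (le_trans (@chernoff_sum f b M mf _)).
  move=> i; apply: (@mgf_indic_diff (X i @^-1` B) (X i @^-1` C) (X i @^-1` V)) => //.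
  - exact: mXS.
  - exact: mXS.
  - exact: mXS.
  - by move=> t h; exact: (BCV (X i t) h).
rewrite ler_expR /M /b big_split/= -!mulr_sumr; lra.
Qed.

Lemma chernoff_abs_diff (B C V : set U) (l tau v : R) :
  measurable B -> measurable C -> measurable V ->
  (B `\` C) `|` (C `\` B) `<=` V -> 0 <= l -> l <= 1 ->
  \sum_i Pr P (X i @^-1` V) <= v ->
  Pr P [set t | tau <= `|\sum_i (\1_B (X i t) - \1_C (X i t))
     - \sum_i (Pr P (X i @^-1` B) - Pr P (X i @^-1` C))|]
  <= 2 * expR (2 * l ^+ 2 * v - l * tau).
Proof.
move=> mB mC mV BCV l0 l1 Vv; have [mX _] := indepX.
have l2 : 0 <= 2 * l ^+ 2 by rewrite mulr_ge0// sqr_ge0.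
pose dev (B C : set U) := [set t | \sum_i (Pr P (X i @^-1` B) - Pr P (X i @^-1` C)) + tau <=
     \sum_i (\1_B (X i t) - \1_C (X i t)) :> R].
have mdev (B' C' : set U) : measurable B' -> measurable C' -> measurable (dev B' C').
  move=> mB' mC'; pose g t : R := \sum_i (\1_B' (X i t) - \1_C' (X i t)).
  rewrite (_ : dev _ _ = g @^-1`
    `[\sum_i (Pr P (X i @^-1` B') - Pr P (X i @^-1` C')) + tau, +oo[%classic).
    apply: measurable_preimage => //; apply: measurable_sum => i.
    apply: (@measurableT_comp _ _ _ _ _ _ (fun u => \1_B' u - \1_C' u : R)) => //.
    by apply: measurable_funB; exact: measurable_indic.
  by apply/seteqP; split => t; rewrite /dev/= in_itv/= andbT.
have bnd (B' C' : set U) : measurable B' -> measurable C' ->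
    (B' `\` C') `|` (C' `\` B') `<=` V ->
    Pr P (dev B' C') <= expR (2 * l ^+ 2 * v - l * tau).
  move=> mB' mC' BCV'; apply: le_trans (chernoff_diff _ mB' mC' mV BCV' l0 l1) _.
  by rewrite ler_expR lerB// ler_wpM2l.
set S := [set t | _].
have SE : S = dev B C `|` dev C B.
  apply/seteqP; split=> t; rewrite /S /dev /=.
    rewrite ler_normr => /orP[h|h]; [left|right]; first by lra.
    rewrite !sumrB in h *; lra.
  rewrite ler_normr => -[h|h]; apply/orP; [left|right]; first by lra.
  rewrite !sumrB in h *; lra.
rewrite SE (le_trans (Pr_setU_le _ (mdev _ _ mB mC) (mdev _ _ mC mB)))//.
rewrite mulr_natl mulr2n lerD//; first exact: bnd.
by apply: bnd => //; rewrite setUC.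
Qed.

End Mgf.
End Chernoff.

(** * Noisy Gaussian rows *)

Section GaussianRow.
Context {R : realType} (n : nat).

Local Notation mR := (measurableTypeR R).
Local Notation gauss := (@gauss R).
Local Notation gauss2 := (gauss \x gauss)%E.
Local Notation row_type := (n.-tuple mR * mR)%type.

Definition lin0 (x : 'cV[R]_n) (z : row_type) : R := \sum_j x j 0 * tnth z.1 j.
Definition lin (x : 'cV[R]_n) (z : row_type) : R := lin0 x z + z.2.

Lemma measurable_lin0 x : measurable_fun [set: row_type] (lin0 x).
Proof.
apply: measurable_sum => j; apply: measurable_funM => //.
exact: (measurableT_comp (measurable_tnth j) measurable_fst).
Qed.

Lemma measurable_lin x : measurable_fun [set: row_type] (lin x).
Proof. by apply: measurable_funD => //; exact: measurable_lin0. Qed.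

Lemma lin0B x y z : lin0 (x - y) z = lin0 x z - lin0 y z.
Proof. by rewrite -sumrB; apply: eq_bigr => j _; rewrite !mxE mulrBl. Qed.

Lemma linB x y z : lin x z - lin y z = lin0 (x - y) z.
Proof. by rewrite lin0B /lin; ring. Qed.

Lemma lin0Z (c : R) x z : lin0 (c *: x) z = c * lin0 x z.
Proof. by rewrite mulr_sumr; apply: eq_bigr => j _; rewrite mxE mulrA. Qed.

Lemma dotpZ (c : R) (x : 'cV[R]_n) : dotp (c *: x) (c *: x) = c ^+ 2 * dotp x x.
Proof. by rewrite mulr_sumr; apply: eq_bigr => j _; rewrite !mxE; ring. Qed.

Context d {T : measurableType d} (P : probability T R).

Definition gaussian_row (sigma : R) (Z : T -> row_type) :=
  measurable_fun [set: T] Z /\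
  forall (B : 'I_n -> set mR) (C : set mR),
    (forall j, measurable (B j)) -> measurable C ->
    P ([set t | forall j, B j (tnth (Z t).1 j)] `&` [set t | C (Z t).2]) =
    ((\prod_j gauss (B j)) * centered_normal sigma C)%E.

Variables (sigma : R) (Z : T -> row_type).
Hypotheses (sigma0 : 0 <= sigma) (gZ : gaussian_row sigma Z) (n1 : (1 < n)%N).

Let mZ : measurable_fun [set: T] Z := gZ.1.

Let coord (j : nat) (t : T) : mR := nth 0 (Z t).1 j.

Let coordE (j : 'I_n) t : coord j t = tnth (Z t).1 j.
Proof. by rewrite /coord -tnth_nth. Qed.

Let mcoord j : (j < n)%N -> measurable_fun [set: T] (coord j).
Proof.
move=> jn; have -> : coord j = (fun t => tnth (Z t).1 (Ordinal jn)).
  by apply/funext => t; rewrite -coordE.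
exact: (measurableT_comp (measurable_tnth (Ordinal jn))
  (measurableT_comp measurable_fst mZ)).
Qed.

Let mZ2 : measurable_fun [set: T] (fun t => (Z t).2).
Proof. exact: measurableT_comp. Qed.

Let centered_normalT : centered_normal sigma [set: mR] = 1%E.
Proof.
rewrite /centered_normal; case: eqP => _; first by rewrite diracT.
exact: (@probability_setT _ _ _ (normal_prob 0 sigma)).
Qed.

Let capE (B : nat -> set mR) :
  \bigcap_(j < n) (coord j @^-1` B j) = [set t | forall j : 'I_n, B j (tnth (Z t).1 j)].
Proof.
apply/seteqP; split => t /= h j.
  by have := h j (ltn_ord j); rewrite /= coordE.
by move=> jn; have := h (Ordinal jn); rewrite /= -coordE.
Qed.

Let iid0 : iid_std P n coord.
Proof.
split=> // B mB; rewrite capE.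
have := gZ.2 (fun j => B j) setT (fun j => mB j) measurableT.
by rewrite centered_normalT mule1 => <-; congr (P _); rewrite setIT.
Qed.

Let coord1 (j : nat) : T -> mR :=
  if (j < n)%N then coord j else fun t => sigma^-1 * (Z t).2.

Let iid1 : 0 < sigma -> iid_std P n.+1 coord1.
Proof.
move=> s0; split=> [j _|B mB].
  rewrite /coord1; case: ifP => [|_]; first exact: mcoord.
  exact: measurable_funM.
have mC : measurable ((fun v : mR => sigma^-1 * v : mR) @^-1` B n).
  by apply: measurable_preimage => //; exact: measurable_funM.
have := gZ.2 (fun j => B j) _ (fun j => mB j) mC.
rewrite /centered_normal gt_eqF// normal_probZ//.
rewrite big_ord_recr/= => <-; congr (P _); rewrite -capE.
apply/seteqP; split => t.
  move=> h; split=> [j /= jn|].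
    by have := h j (ltnW jn); rewrite /coord1 jn.
  by have := h n (ltnSn n); rewrite /coord1/= ltnn.
move=> [h hn] j /=; rewrite ltnS leq_eqVlt => /orP[/eqP ->|jn].
  by rewrite /coord1 ltnn.
by rewrite /coord1 jn; exact: h.
Qed.

(** The default value is the one that matters at index [n]: the weight of the normalized noise. *)
Let wt (x : 'cV[R]_n) (j : nat) : R := if insub j is Some k then x k 0 else sigma.

Let wtE x (j : 'I_n) : wt x j = x j 0.
Proof. by rewrite /wt valK. Qed.

Let wtn x : wt x n = sigma.
Proof. by rewrite /wt insubN// ltnn. Qed.

Let lin0E x t : \sum_(j < n) wt x j * coord j t = lin0 x (Z t).
Proof. by apply: eq_bigr => j _; rewrite wtE coordE. Qed.

Let dotpE x y : \sum_(j < n) wt x j * wt y j = dotp x y.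
Proof. by apply: eq_bigr => j _; rewrite !wtE. Qed.

Let dotpEE x : \sum_(j < n) wt x j ^+ 2 = dotp x x.
Proof. by apply: eq_bigr => j _; rewrite !wtE. Qed.

Lemma lin0_law x y : exists a b c : R,
  [/\ 0 <= a, 0 <= c, a ^+ 2 = dotp x x, a * b = dotp x y &
      b ^+ 2 + c ^+ 2 = dotp y y] /\
  forall D : set (mR * mR), measurable D ->
    Pr P [set t | D (lin0 x (Z t), lin0 y (Z t))] =
    Pr gauss2 [set z | D (a * z.1, b * z.1 + c * z.2)].
Proof.
have := iid_std_sums_law (wt x) (wt y) iid0 n1.
rewrite !dotpEE dotpE => -[a [b [c [abc law]]]]; exists a, b, c; split => // D mD.
rewrite -law//; congr (Pr P _).
by apply/seteqP; split=> t /=; rewrite !lin0E.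
Qed.

(** For positive [sigma] the noise is one more standard coordinate of weight [sigma] in both sums,
    which adds [sigma ^+ 2] to every inner product. For [sigma = 0] it cannot be normalized, but
    [lin] and [lin0] agree almost surely. *)
Lemma lin_law x y : exists a b c : R,
  [/\ 0 <= a, 0 <= c, a ^+ 2 = dotp x x + sigma ^+ 2,
      a * b = dotp x y + sigma ^+ 2 &
      b ^+ 2 + c ^+ 2 = dotp y y + sigma ^+ 2] /\
  forall D : set (mR * mR), measurable D ->
    Pr P [set t | D (lin x (Z t), lin y (Z t))] =
    Pr gauss2 [set z | D (a * z.1, b * z.1 + c * z.2)].
Proof.
move: sigma0; rewrite le_eqVlt => /predU1P[/esym s0|s0].
  have [a [b [c [abc law]]]] := lin0_law x y.
  exists a, b, c; rewrite s0 expr0n !addr0; split => // D mD; rewrite -law//.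
  have mlin2 : measurable_fun [set: T] (fun t => (lin x (Z t), lin y (Z t)) : mR * mR).
    apply: measurable_fun_pair; apply: measurableT_comp => //; exact: measurable_lin.
  have mlin02 : measurable_fun [set: T] (fun t => (lin0 x (Z t), lin0 y (Z t)) : mR * mR).
    apply: measurable_fun_pair; apply: measurableT_comp => //; exact: measurable_lin0.
  have mN : measurable [set t | (Z t).2 != 0].
    rewrite (_ : [set _ | _] = (fun t => (Z t).2) @^-1` (~` [set 0])).
      by apply: measurable_preimage => //; exact: measurableC.
    by apply/seteqP; split=> t /= /eqP.
  have N0 : Pr P [set t | (Z t).2 != 0] = 0.
    have mC0 : measurable (~` [set 0] : set mR) by exact: measurableC.
    have := gZ.2 (fun=> setT) _ (fun=> measurableT) mC0.
    rewrite big1 ?mul1e; last by move=> j _; exact: probability_setT.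
    rewrite /centered_normal s0 eqxx diracE memNset; last by move=> /=; apply.
    move=> e; suff -> : [set t | (Z t).2 != 0] =
        [set t | forall j : 'I_n, setT (tnth (Z t).1 j)] `&`
        [set t | (~` [set 0] : set mR) (Z t).2] by rewrite /Pr e.
    by apply/seteqP; split=> t /=; [move/eqP => h; split|move=> [_] /eqP].
  have mD1 := measurable_preimage mlin2 mD; have mD0 := measurable_preimage mlin02 mD.
  have half (S S' : set T) : measurable S -> measurable S' ->
      S `<=` S' `|` [set t | (Z t).2 != 0] -> Pr P S <= Pr P S'.
    move=> mS mS' SS'; apply: le_trans (Pr_le _ mS (measurableU _ _ mS' mN) SS') _.
    by apply: le_trans (Pr_setU_le _ mS' mN) _; rewrite N0 addr0.
  apply/eqP; rewrite eq_le; apply/andP; split; apply: half => // t /= h.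
    have [t0|t0] := eqVneq (Z t).2 0; last by right.
    by left; move: h; rewrite /lin t0 !addr0.
  have [t0|t0] := eqVneq (Z t).2 0; last by right.
  by left; rewrite /lin t0 !addr0.
have linE v t : \sum_(j < n.+1) wt v j * coord1 j t = lin v (Z t).
  rewrite big_ord_recr/= wtn /lin -lin0E; congr (_ + _).
    by apply: eq_bigr => j _; rewrite /coord1 ltn_ord.
  by rewrite /coord1 ltnn mulrA divff ?mul1r// gt_eqF.
have := iid_std_sums_law (wt x) (wt y) (iid1 s0) (ltnW n1).
rewrite !big_ord_recr/= !dotpEE dotpE !wtn -expr2.
move=> [a [b [c [abc law]]]]; exists a, b, c; split => // D mD.
rewrite -law//; congr (Pr P _).
by apply/seteqP; split=> t /=; rewrite !linE.
Qed.

End GaussianRow.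

(** * Sign changes and tails for a single noisy row *)

Section RowEstimates.
Context {R : realType} (n : nat).

Local Notation mR := (measurableTypeR R).
Local Notation gauss := (@gauss R).
Local Notation gauss2 := (gauss \x gauss)%E.
Local Notation row_type := (n.-tuple mR * mR)%type.

Context d {T : measurableType d} (P : probability T R).
Variables (sigma : R) (Z : T -> row_type).
Hypotheses (sigma0 : 0 <= sigma) (gZ : gaussian_row P sigma Z) (n1 : (1 < n)%N).

Let mZ : measurable_fun [set: T] Z := gZ.1.

Lemma gauss2_fst (S : set mR) : measurable S ->
  Pr gauss2 [set z | S z.1] = Pr gauss S.
Proof.
move=> mS; congr fine.
transitivity ((gauss \x gauss)%E (S `*` setT)).
  by congr (_ _); apply/seteqP; split => z //= [].
rewrite (product_measure1E gauss gauss mS measurableT).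
by rewrite [X in (_ * X)%E]probability_setT mule1.
Qed.

Lemma measurable_norm_le d' (U : measurableType d') (f : U -> R) (c : R) :
  measurable_fun [set: U] f -> measurable [set u | `|f u| <= c].
Proof.
move=> mf; rewrite (_ : [set _ | _] = f @^-1` `[(- c), c]%classic).
  exact: measurable_preimage.
by apply/seteqP; split => u /=; rewrite in_itv/= ler_norml.
Qed.

Lemma measurable_norm_ge d' (U : measurableType d') (f : U -> R) (c : R) :
  measurable_fun [set: U] f -> measurable [set u | c <= `|f u|].
Proof.
move=> mf; rewrite (_ : [set _ | _] = (fun u => `|f u|) @^-1` `[c, +oo[%classic).
  by apply: measurable_preimage => //; exact: measurableT_comp.
by apply/seteqP; split => u /=; rewrite in_itv/= andbT.
Qed.

(** For unit vectors the planar vectors (a, 0) and (b, c) have the same length, and their angle is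
    the arccosine in [dsigma]; [angle_probE] concludes, since the positive factor [a] does not
    affect signs. *)
Lemma Pr_mismatch_lin (x y : 'cV[R]_n) : dotp x x = 1 -> dotp y y = 1 ->
  Pr P (Z @^-1` mismatch (lin x) (lin y)) = dsigma sigma x y.
Proof.
move=> x1 y1.
have [a [b [c [[a0 c0 a2 ab bc] law]]]] := lin_law sigma0 gZ n1 x y.
rewrite x1 in a2; rewrite y1 in bc.
have s1 : 0 < 1 + sigma ^+ 2 by rewrite ltr_wpDr ?sqr_ge0.
have ap : 0 < a.
  by rewrite lt_neqAle a0 andbT; apply/eqP => az; rewrite -az expr0n/= in a2; lra.
pose D := mismatch (fst : mR * mR -> mR) snd.
have mD : measurable D by exact: measurable_mismatch.
have -> : Z @^-1` mismatch (lin x) (lin y) = [set t | D (lin x (Z t), lin y (Z t))].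
  by [].
rewrite law//.
set rho := (dotp x y + sigma ^+ 2) / (1 + sigma ^+ 2).
have rhoE : rho = b / a.
  by rewrite /rho -ab -a2; field; rewrite gt_eqF.
have bE : b = a * rho by rewrite rhoE mulrC divfK// gt_eqF.
have rho2 : a ^+ 2 * (1 - rho ^+ 2) = c ^+ 2.
  have : b ^+ 2 + c ^+ 2 = a ^+ 2 by rewrite bc a2.
  by rewrite bE exprMn; lra.
have rho1 : rho ^+ 2 <= 1.
  by rewrite -subr_ge0 -(pmulr_rge0 _ (exprn_gt0 2 ap)) rho2 sqr_ge0.
have rhob : -1 <= rho <= 1 by rewrite -ler_norml -[leRHS]sqrtr1 -sqrtr_sqr ler_sqrt.
(* The normalization 0 <= c selects this root. *)
have cE : c = a * sin (acos rho).
  rewrite sin_acos// -[LHS](ger0_norm c0) -sqrtr_sqr -rho2 sqrtrM ?sqr_ge0//.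
  by rewrite sqrtr_sqr ger0_norm.
have th : 0 <= acos rho <= pi by rewrite acos_ge0//= acos_lepi.
rewrite /dsigma -/rho mulrC -(angle_probE th) /angle_prob; congr (Pr _ _).
apply/seteqP; rewrite /D /mismatch /ray_coord; split => z /=;
  rewrite bE cE cos0 sin0 mul0r addr0 mul1r acosK ?in_itv//= -!mulrA -mulrDr;
  by rewrite !(pmulr_rgt0 _ ap).
Qed.

(** A standard deviation of at least 1/2 rescales the interval to half-length at most 2 tau. The
    threshold 1/4, rather than norm 1, accommodates net points. *)
Lemma Pr_lin_small (x : 'cV[R]_n) (tau : R) : 4^-1 <= dotp x x -> 0 <= tau ->
  Pr P (Z @^-1` [set z | `|lin x z| <= tau]) <= 4 * tau.
Proof.
move=> x4 tau0.
have [a [b [c [[a0 _ a2 _ _] law]]]] := lin_law sigma0 gZ n1 x 0.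
have a2g : 2^-1 ^+ 2 <= a ^+ 2.
  by rewrite a2 (_ : 2^-1 ^+ 2 = 4^-1 :> R) ?(le_trans x4) ?lerDl ?sqr_ge0//; field.
have a2' : 2^-1 <= a by rewrite -(ler_pXn2r (ltn0Sn 1)) ?nnegrE// invr_ge0.
have ap : 0 < a by lra.
have mD : measurable [set z : mR * mR | `|z.1| <= tau] by exact: measurable_norm_le.
have -> : Z @^-1` [set z | `|lin x z| <= tau] =
  [set t | [set z : mR * mR | `|z.1| <= tau] (lin x (Z t), lin 0 (Z t))] by [].
rewrite law//=.
have ta0 : 0 <= tau / a by rewrite divr_ge0.
have -> : [set z : mR * mR | `|a * z.1| <= tau] =
    [set z | `[(- (tau / a)), tau / a]%classic z.1].
  apply/seteqP; split => z /=; rewrite in_itv/= -ler_norml normrM (gtr0_norm ap).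
    by rewrite ler_pdivlMr// mulrC.
  by rewrite ler_pdivlMr// mulrC.
rewrite gauss2_fst//.
apply: (@le_trans _ _ (2 * (tau / a))).
  by rewrite -lee_fin EFin_Pr// gauss_itv_le.
have : tau / a <= tau * 2 by rewrite ler_wpM2l// -[leRHS]invrK lef_pV2 ?posrE// invr_gt0.
lra.
Qed.

Lemma integral_exp_lin0_sqr (w : 'cV[R]_n) : dotp w w <= 1 ->
  (\int[P]_t (expR (lin0 w (Z t) ^+ 2 / 4))%:E <= 2%:E)%E.
Proof.
move=> w1.
have [a [b [c [[a0 _ a2 _ _] law]]]] := lin0_law gZ n1 w 0.
have mwZ : measurable_fun [set: T] (fun t => lin0 w (Z t) : mR).
  by apply: measurableT_comp => //; exact: measurable_lin0.
have ma : measurable_fun [set: mR] (fun s : mR => a * s : mR) by exact: measurable_funM.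
have mh : measurable_fun [set: mR] (fun s : R => (expR (s ^+ 2 / 4))%:E).
  apply/measurable_EFinP; apply: measurableT_comp => //.
  by apply: measurable_funM => //; exact: measurable_funX.
have h0 (s : R) : (0 <= (expR (s ^+ 2 / 4))%:E)%E by rewrite lee_fin expR_ge0.
have -> : (\int[P]_t (expR (lin0 w (Z t) ^+ 2 / 4))%:E =
    \int[image_measure P mwZ]_s (expR (s ^+ 2 / 4))%:E)%E.
  by rewrite ge0_integral_pushforward.
have -> : (\int[image_measure P mwZ]_s (expR (s ^+ 2 / 4))%:E =
    \int[image_measure gauss ma]_s (expR (s ^+ 2 / 4))%:E)%E.
  apply: eq_measure_integral => S mS _.
  rewrite /image_measure/= /pushforward.
  have mSS : measurable [set z : mR * mR | S z.1] by exact: (measurable_preimage measurable_fst).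
  have := law _ mSS; rewrite /= (gauss2_fst (measurable_preimage ma mS)).
  move=> /(congr1 (@EFin R)).
  have mS1 := measurable_preimage ma mS; have mS2 := measurable_preimage mwZ mS.
  by rewrite (EFin_Pr gauss mS1) -(EFin_Pr P mS2) => <-.
rewrite ge0_integral_pushforward//=.
by apply: gauss_exp_sqr_le; rewrite a2.
Qed.

(** Markov's inequality for the exponential of a square, weakened by exp q >= q; a tail of Chebyshev
    type is enough here. *)
Lemma Pr_lin0_large (w : 'cV[R]_n) (r tau : R) : 0 < r -> 0 < tau ->
  dotp w w <= r ^+ 2 ->
  Pr P (Z @^-1` [set z | tau <= `|lin0 w z|]) <= 8 * r ^+ 2 / tau ^+ 2.
Proof.
move=> r0 tau0 wr.
pose v := r^-1 *: w.
have v1 : dotp v v <= 1.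
  by rewrite dotpZ exprVn mulrC ler_pdivrMr ?exprn_gt0// mul1r.
set S := [set z | _].
have mS : measurable (Z @^-1` S).
  apply: measurable_preimage => //; apply: measurable_norm_ge; exact: measurable_lin0.
pose q := tau ^+ 2 / (4 * r ^+ 2).
have q0 : 0 < q by rewrite divr_gt0 ?exprn_gt0// mulr_gt0// exprn_gt0.
have qS : (q%:E * (Pr P (Z @^-1` S))%:E <= 2%:E)%E.
  apply: le_trans (integral_exp_lin0_sqr v1).
  have S0 t : [set: T] t -> (0 <= (\1_(Z @^-1` S) t : R)%:E)%E by rewrite lee_fin indicE.
  have mS' : measurable_fun [set: T] (fun t => (\1_(Z @^-1` S) t)%:E : \bar R).
    by apply/measurable_EFinP; exact: measurable_indic.
  have q0' : (0 <= q%:E)%E by rewrite lee_fin ltW.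
  rewrite -integral_indic_Pr// -ge0_integralZl//.
  apply: ge0_le_integral => //.
  - by move=> t _; apply: mule_ge0 => //; exact: S0.
  - exact: emeasurable_funM.
  - apply/measurable_EFinP; apply: measurableT_comp => //.
    apply: measurable_funM => //; apply: measurable_funX.
    by apply: measurableT_comp => //; exact: measurable_lin0.
  - move=> t _; rewrite -EFinM lee_fin indicE.
    have [tS|tS] := boolP (t \in _); last by rewrite mulr0 expR_ge0.
    rewrite inE /S/= in tS.
    rewrite mulr1 (le_trans _ (expR_ge1Dx _))// lin0Z exprMn /q.
    apply: ler_wpDl => //.
    rewrite exprVn (_ : _ * _ / 4 = lin0 w (Z t) ^+ 2 / (4 * r ^+ 2)); last first.
      by field; rewrite gt_eqF.
    rewrite ler_pM2r ?invr_gt0 ?mulr_gt0 ?exprn_gt0//.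
    rewrite -(real_normK (num_real (lin0 w (Z t)))).
    by rewrite ler_pXn2r ?nnegrE// ltW.
rewrite -EFinM lee_fin in qS.
have -> : 8 * r ^+ 2 / tau ^+ 2 = 2 / q.
  by rewrite /q; field; rewrite !gt_eqF.
by rewrite ler_pdivlMr// mulrC.
Qed.

(** Opposite signs force |lin x| <= |lin x - lin y|, and the noise cancels in the difference. *)
Lemma mismatch_subset (x y : 'cV[R]_n) (tau : R) :
  mismatch (lin x) (lin y) `<=`
  [set z | `|lin x z| <= tau] `|` [set z | tau <= `|lin0 (y - x) z|].
Proof.
move=> z; rewrite /mismatch/= => xy.
have [h|h] := leP `|lin x z| tau; [by left|right].
apply: (le_trans (ltW h)); rewrite -linB; move: xy.
by case: (ltP 0 (lin x z)); case: (ltP 0 (lin y z)) => //= hy hx _;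
  [rewrite gtr0_norm// ler0_norm; lra|rewrite ler0_norm// ger0_norm; lra].
Qed.

Lemma Pr_mismatch_le (x y : 'cV[R]_n) (r tau : R) : 4^-1 <= dotp x x ->
  0 < r -> 0 < tau -> dotp (y - x) (y - x) <= r ^+ 2 ->
  Pr P (Z @^-1` mismatch (lin x) (lin y)) <= 4 * tau + 8 * r ^+ 2 / tau ^+ 2.
Proof.
move=> x4 r0 tau0 xyr.
have mA : measurable [set z : row_type | `|lin x z| <= tau].
  by apply: measurable_norm_le; exact: measurable_lin.
have mB : measurable [set z : row_type | tau <= `|lin0 (y - x) z|].
  by apply: measurable_norm_ge; exact: measurable_lin0.
have mM : measurable (mismatch (lin x) (lin y)).
  by apply: measurable_mismatch; exact: measurable_lin.
have mA' := measurable_preimage mZ mA; have mB' := measurable_preimage mZ mB.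
apply: le_trans (Pr_le _ (measurable_preimage mZ mM) (measurableU _ _ mA' mB') _) _.
  by move=> t; exact: mismatch_subset.
apply: le_trans (Pr_setU_le _ mA' mB') _.
by apply: lerD; [exact: Pr_lin_small x4 (ltW tau0)|exact: Pr_lin0_large].
Qed.

End RowEstimates.

(** * From the matrix and the noise to independent noisy rows *)

Section Rows.
Context {R : realType} d {T : measurableType d} (P : probability T R).
Local Notation mR := (measurableTypeR R).
Variables (m n : nat) (sigma : R).
Variables (A : {RV P >-> m.-tuple (n.-tuple mR)}) (eta : {RV P >-> m.-tuple mR}).
Hypotheses (gA : forall i : 'I_m, gaussian_vector P 1 (fun t => tnth (A t) i))
  (iA : mutually_independent P (fun (i : 'I_m) t => tnth (A t) i))
  (geta : gaussian_vector P sigma eta) (indAeta : independent2 P A eta).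

Definition noisy_row (i : 'I_m) (t : T) : n.-tuple mR * mR :=
  (tnth (A t) i, tnth (eta t) i).

Let mrow (i : 'I_m) : measurable_fun [set: T] (fun t => tnth (A t) i).
Proof. exact: (measurableT_comp (measurable_tnth i) (measurable_funP A)). Qed.

Let mnoise (i : 'I_m) : measurable_fun [set: T] (fun t => tnth (eta t) i).
Proof. exact: (measurableT_comp (measurable_tnth i) (measurable_funP eta)). Qed.

Lemma measurable_noisy_row i : measurable_fun [set: T] (noisy_row i).
Proof. by apply: measurable_fun_pair. Qed.

Let bigcap_setT (I : finType) (F : I -> set T) :
  \bigcap_(i in [set` [set: I]%SET]) F i = \bigcap_i F i.
Proof.
by apply/seteqP; split=> t h i _; apply: h => //=; rewrite finset.in_setT.
Qed.

Let prod_setT (I : finType) (F : I -> \bar R) :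
  (\prod_(i in [set: I]%SET) F i = \prod_i F i)%E.
Proof. by apply: eq_bigl => i; rewrite finset.in_setT. Qed.

Lemma gaussian_noisy_row i : gaussian_row P sigma (noisy_row i).
Proof.
split; first exact: measurable_noisy_row.
move=> B C mB mC.
pose SA := [set a : m.-tuple (n.-tuple mR) | forall j, B j (tnth (tnth a i) j)].
pose SE := [set e : m.-tuple mR | C (tnth e i)].
have mSA : measurable SA.
  rewrite (_ : SA = \bigcap_j ((fun a => tnth (tnth a i) j) @^-1` B j)).
    apply: fin_bigcap_measurable => [|j _]; first exact: finite_finset.
    apply: measurable_preimage => //.
    exact: (measurableT_comp (measurable_tnth j) (measurable_tnth i)).
  by apply/seteqP; split => a /= h j; [move=> _|]; exact: h.
have mSE : measurable SE by apply: (measurable_preimage (measurable_tnth i)).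
transitivity (P (A @^-1` SA `&` eta @^-1` SE)); first by congr (P _).
rewrite indAeta//; congr (_ * _)%E; last exact: geta.2.
have [ind law] := gA i.
have := ind [set: 'I_n]%SET B (fun j _ => mB j).
rewrite bigcap_setT => e; transitivity (P (\bigcap_j (fun t => tnth (tnth (A t) i) j) @^-1` B j)).
  by congr (P _); apply/seteqP; split => t /= h j; [move=> _|]; exact: h.
rewrite e prod_setT; apply: eq_bigr => j _.
by rewrite law// /centered_normal oner_eq0.
Qed.

(** On rectangles, independence of [A] and [eta] separates the two factors and each splits over the
    rows. Sign events mix a row with its noise, hence the passage to arbitrary sets. *)
Lemma independent_noisy_rows : independent_family P noisy_row.
Proof.
apply: independent_family_rect; first exact: measurable_noisy_row.
move=> B C mB mC.
pose SA (D : 'I_m -> set (n.-tuple mR)) :=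
  [set a : m.-tuple (n.-tuple mR) | forall i, D i (tnth a i)].
pose SE (D : 'I_m -> set mR) := [set e : m.-tuple mR | forall i, D i (tnth e i)].
have mSA D : (forall i, measurable (D i)) -> measurable (SA D).
  move=> mD; rewrite (_ : SA D = \bigcap_i ((fun a => tnth a i) @^-1` D i)).
    apply: fin_bigcap_measurable => [|i _]; first exact: finite_finset.
    exact: (measurable_preimage (measurable_tnth i)).
  by apply/seteqP; split => a /= h i; [move=> _|]; exact: h.
have mSE D : (forall i, measurable (D i)) -> measurable (SE D).
  move=> mD; rewrite (_ : SE D = \bigcap_i ((fun a => tnth a i) @^-1` D i)).
    apply: fin_bigcap_measurable => [|i _]; first exact: finite_finset.
    exact: (measurable_preimage (measurable_tnth i)).
  by apply/seteqP; split => a /= h i; [move=> _|]; exact: h.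
have one i : P (noisy_row i @^-1` (B i `*` C i)) =
    (P ((fun t => tnth (A t) i) @^-1` B i) * P ((fun t => tnth (eta t) i) @^-1` C i))%E.
  have := indAeta (measurable_preimage (measurable_tnth i) (mB i))
    (measurable_preimage (measurable_tnth i) (mC i)).
  by move=> e; transitivity (P (A @^-1` ((fun a => tnth a i) @^-1` B i) `&`
    eta @^-1` ((fun a => tnth a i) @^-1` C i))).
transitivity (P (A @^-1` SA B `&` eta @^-1` SE C)).
  congr (P _); apply/seteqP; split => t /=.
    by move=> h; split=> i; have [] := h i Logic.I.
  by move=> [hA hE] i _; split; [exact: hA|exact: hE].
rewrite indAeta; [|exact: mSA|exact: mSE].
under eq_bigr do rewrite one.
rewrite big_split/=; congr (_ * _)%E.
  rewrite -[RHS]prod_setT -iA// bigcap_setT; congr (P _).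
  by apply/seteqP; split => t /= h i; [move=> _|]; exact: h.
rewrite -[RHS]prod_setT -geta.1// bigcap_setT; congr (P _).
by apply/seteqP; split => t /= h i; [move=> _|]; exact: h.
Qed.

End Rows.

(** * Nets of sparse vectors *)

Section SparseNet.
Context {R : realType}.

Definition nsupp n (x : 'cV[R]_n) : nat := #|[set i | (x i 0 != 0)%R]%SET|.

(* A nonzero coordinate is coded by its sign and its magnitude minus one. *)
Definition grid_code (M : nat) := option (bool * 'I_M).
Definition cmag M (c : grid_code M) : nat := if c is Some (_, j) then j.+1 else 0.
Definition cval M (c : grid_code M) : R :=
  if c is Some (b, j) then (-1) ^+ b * j.+1%:R else 0.

(** The second condition is an l1 bound in grid units. An s-sparse vector of the unit ball has l1
    norm at most sqrt s, which at level [k] gives M = s 8^k. *)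
Definition sparse_code M n (s : nat) (z : {ffun 'I_n -> grid_code M}) : bool :=
  (#|[set i | z i != None]%SET| <= s)%N && (\sum_i cmag (z i) <= M)%N.

(** The sum telescopes: exp l >= 1 + l bounds [l] times each term by a difference of consecutive
    exponentials. *)
Lemma sum_expR_le (l : R) (M : nat) : 0 < l ->
  \sum_(j < M) expR (- (l * j.+1%:R)) <= l^-1.
Proof.
move=> l0.
suff h : l * \sum_(j < M) expR (- (l * j.+1%:R)) <= 1 - expR (- (l * M%:R)).
  rewrite -[leRHS]mulr1 ler_pdivlMl//; apply: le_trans h _.
  by rewrite gerBl expR_ge0.
elim: M => [|M ih]; first by rewrite big_ord0 !mulr0 oppr0 expR0 subrr.
rewrite big_ord_recr/= mulrDr; apply: (le_trans (lerD ih (lexx _))).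
have -> : expR (- (l * M%:R)) = expR l * expR (- (l * M.+1%:R)).
  by rewrite -expRD -natr1; congr expR; ring.
have := expR_ge1Dx l; have := expR_ge0 (- (l * M.+1%:R)); nra.
Qed.

(* Weighted counting: each code has weight q e^{-l mag} (1 for a zero), so that
   every net point weighs at least q^s e^{-l M}. *)
Lemma card_net_le M n s (l : R) : (0 < s)%N -> (s <= n)%N -> 0 < l -> l <= 1 ->
  #|[set z : {ffun 'I_n -> grid_code M} | sparse_code s z]%SET|%:R <=
  expR (l * M%:R + 2 * s%:R) * (n%:R / (l * s%:R)) ^+ s.
Proof.
move=> s0 sn l0 l1.
have s0' : 0 < s%:R :> R by rewrite ltr0n.
have n0 : 0 < n%:R :> R by rewrite ltr0n (leq_trans s0).
(* Chosen so that the nonzero symbols weigh at most 2 q / l = 2 s / n together; the total over all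
   codes is then at most (1 + 2 s / n)^n <= exp (2 s). *)
pose q : R := l * s%:R / n%:R.
have q0 : 0 < q by rewrite divr_gt0// mulr_gt0.
(* Hence codes with fewer than [s] nonzero symbols also have weight factor at least q^s. *)
have q1 : q <= 1.
  rewrite ler_pdivrMr// mul1r -[leRHS]mul1r ler_pM// ?ler_nat// ltW//.
pose w (c : grid_code M) : R := (if c is Some _ then q else 1) * expR (- (l * (cmag c)%:R)).
have w0 c : 0 <= w c.
  by rewrite /w mulr_ge0 ?expR_ge0//; case: c => // _; rewrite ltW.
have tot : \sum_(z : {ffun 'I_n -> grid_code M}) \prod_i w (z i) <= expR (2 * s%:R).
  rewrite -(bigA_distr_bigA (fun (_ : 'I_n) c => w c))/= prodr_const card_ord.
  have sw : \sum_c w c <= 1 + 2 * s%:R / n%:R.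
    rewrite (bigD1 None)//= {1}/w /= mulr0 oppr0 expR0 mulr1 lerD2l.
    rewrite (reindex_omap Some id)/=; last by case.
    rewrite (eq_bigl predT); last by move=> c; rewrite eqxx.
    rewrite (eq_bigr (fun p : bool * 'I_M => q * expR (- (l * (p.2).+1%:R)))); last first.
      by move=> [b j].
    rewrite -(pair_bigA _ (fun (_ : bool) j => q * expR (- (l * (j : 'I_M).+1%:R))))/=.
    rewrite big_bool/= -mulr_sumr.
    have qS : q * \sum_(j < M) expR (- (l * j.+1%:R)) <= s%:R / n%:R.
      apply: (@le_trans _ _ (q * l^-1)); first by rewrite ler_wpM2l ?(ltW q0)// sum_expR_le.
      by rewrite /q le_eqVlt; apply/orP; left; apply/eqP; field; rewrite !gt_eqF.
    by rewrite -mulrA mulr_natl mulr2n lerD.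
  apply: (@le_trans _ _ ((1 + 2 * s%:R / n%:R) ^+ n)).
    by rewrite lerXn2r ?nnegrE ?sumr_ge0// addr_ge0// divr_ge0// ?mulr_ge0// ltW.
  have -> : expR (2 * s%:R) = expR (2 * s%:R / n%:R) ^+ n :> R.
    by rewrite -expRM_natr divfK// gt_eqF.
  rewrite lerXn2r ?nnegrE ?expR_ge0 ?expR_ge1Dx//.
pose wmin := q ^+ s * expR (- (l * M%:R)).
have wnet z : sparse_code s z -> wmin <= \prod_i w (z i).
  move=> /andP[zs zM]; rewrite big_split/= -expR_sum.
  rewrite (bigID (fun i => z i != None))/= [X in _ * X * _]big1 ?mulr1; last first.
    by move=> i; rewrite negbK => /eqP ->.
  rewrite (eq_bigr (fun=> q)); last by move=> i; case: (z i).
  rewrite prodr_const; apply: ler_pM; rewrite ?expR_ge0 ?exprn_ge0 ?(ltW q0)//.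
    rewrite (_ : #|_| = #|[set i | z i != None]%SET|); last first.
      by apply: eq_card => i; rewrite !inE.
    by rewrite ler_wiXn2l ?(ltW q0).
  by rewrite ler_expR sumrN -mulr_sumr lerN2 ler_wpM2l ?(ltW l0)// -natr_sum ler_nat.
have wmin0 : 0 < wmin by rewrite mulr_gt0 ?expR_gt0 ?exprn_gt0.
have : #|[set z : {ffun 'I_n -> grid_code M} | sparse_code s z]%SET|%:R * wmin <= expR (2 * s%:R).
  apply: le_trans tot; rewrite mulr_natl -sumr_const.
  apply: (@le_trans _ _ (\sum_(z in [set z : {ffun 'I_n -> grid_code M} | sparse_code s z]%SET) \prod_i w (z i))).
    by apply: ler_sum => z; rewrite inE; exact: wnet.
  rewrite [leRHS](bigID (fun z => z \in [set z : {ffun 'I_n -> grid_code M} | sparse_code s z]%SET))/=.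
  by rewrite lerDl sumr_ge0// => z _; rewrite prodr_ge0.
rewrite -ler_pdivlMr// => /le_trans; apply.
rewrite /wmin invfM expRN invrK expRD -exprVn.
rewrite (_ : q^-1 = n%:R / (l * s%:R)) ?invf_div//.
by rewrite le_eqVlt; apply/orP; left; apply/eqP; ring.
Qed.

(** Rounding towards 0 preserves zeros and never increases magnitudes, so rounded vectors stay
    sparse and in the unit ball. *)
Definition round_to (h u : R) : R := Num.sg u * (Num.truncn (`|u| / h))%:R * h.

Lemma round_to0 h : round_to h 0 = 0.
Proof. by rewrite /round_to sgr0 !mul0r. Qed.

Lemma truncn_norm_le (h u : R) : 0 < h -> (Num.truncn (`|u| / h))%:R * h <= `|u|.
Proof. by move=> h0; rewrite -ler_pdivlMr// truncn_le// divr_ge0// ltW. Qed.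

Lemma round_to_sqr (h u : R) : 0 < h -> round_to h u ^+ 2 <= u ^+ 2.
Proof.
move=> h0; rewrite -(real_normK (num_real u)) -(real_normK (num_real (round_to h u))).
rewrite ler_pXn2r ?nnegrE// /round_to -mulrA normrM.
rewrite (ger0_norm (mulr_ge0 (ler0n _ _) (ltW h0))).
have := truncn_norm_le u h0; rewrite normr_sg.
by case: (u != 0); rewrite ?mul1r// mul0r.
Qed.

Lemma round_to_dist (h u : R) : 0 < h -> (u - round_to h u) ^+ 2 <= h ^+ 2.
Proof.
move=> h0; rewrite -(real_normK (num_real (u - _))) ler_pXn2r ?nnegrE ?(ltW h0)//.
rewrite {1}(numEsg u) /round_to -mulrA -mulrBr normrM.
have t1 := truncn_norm_le u h0.
have t2 : `|u| < (Num.truncn (`|u| / h))%:R * h + h.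
  have uh : 0 <= `|u| / h by rewrite divr_ge0// ltW.
  have /andP[_] := truncn_itv uh; rewrite ltr_pdivrMr// -natr1 mulrDl mul1r//.
rewrite (@ger0_norm _ (`|u| - _)) ?subr_ge0// normr_sg.
case: (u != 0); rewrite ?mul1r ?mul0r ?(ltW h0)//.
by rewrite lerBlDl ltW.
Qed.

Section Chain.
Variables (n s : nat).
Hypothesis s0 : (0 < s)%N.

(** With at most [s] coordinates in error by one mesh, the Euclidean error is at most 8^-k. *)
Definition mesh (k : nat) : R := (8 ^+ k * Num.sqrt s%:R)^-1.

(* Level 0 is the origin, so that the deviation vanishes where chains start. *)
Definition chain (k : nat) (x : 'cV[R]_n) : 'cV[R]_n :=
  if k is 0 then 0 else \col_i round_to (mesh k) (x i 0).

Definition net_pt (k : nat) (z : {ffun 'I_n -> grid_code (s * 8 ^ k)}) : 'cV[R]_n :=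
  if k is 0 then 0 else \col_i (cval (z i) * mesh k).

Lemma mesh_gt0 k : 0 < mesh k.
Proof. by rewrite invr_gt0 mulr_gt0 ?exprn_gt0// sqrtr_gt0 ltr0n. Qed.

Lemma sum_support_sqr (x : 'cV[R]_n) (c : R) : 0 <= c ->
  (forall i, x i 0 ^+ 2 <= c) -> (nsupp x <= s)%N -> dotp x x <= s%:R * c.
Proof.
move=> c0 xc xs.
apply: (@le_trans _ _ (\sum_(i in [set i | (x i 0 != 0)%R]%SET) c)).
  rewrite /dotp (bigID (fun i => i \in [set i | (x i 0 != 0)%R]%SET))/=.
  rewrite [X in _ + X]big1 ?addr0.
    by apply: ler_sum => i _; rewrite -expr2.
  by move=> i; rewrite inE negbK => /eqP ->; rewrite mul0r.
by rewrite sumr_const -[leLHS]mulr_natl ler_wpM2r// ler_nat.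
Qed.

Lemma nsupp_le (x y : 'cV[R]_n) : (forall i, x i 0 = 0 -> y i 0 = 0) ->
  (nsupp y <= nsupp x)%N.
Proof.
move=> xy; apply: subset_leq_card; apply/fintype.subsetP => i; rewrite !inE.
by apply: contraNN => /eqP /xy ->.
Qed.

Lemma chain_supp k (x : 'cV[R]_n) i : x i 0 = 0 -> chain k x i 0 = 0.
Proof.
by case: k => [|k] xi; rewrite /chain mxE// xi round_to0.
Qed.

Lemma nsupp_sub_chain k (x : 'cV[R]_n) : (nsupp x <= s)%N ->
  (nsupp (x - chain k x) <= s)%N.
Proof.
move=> xs; apply: leq_trans xs; apply: nsupp_le => i xi.
by rewrite mxE [X in _ + X]mxE chain_supp// xi subr0.
Qed.

Lemma dotp_ge0 (x : 'cV[R]_n) : 0 <= dotp x x.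
Proof. by apply: sumr_ge0 => i _; rewrite -expr2 sqr_ge0. Qed.

Lemma chain_norm k (x : 'cV[R]_n) : dotp (chain k x) (chain k x) <= dotp x x.
Proof.
case: k => [|k].
  rewrite {1}/dotp big1 ?dotp_ge0// => i _; by rewrite mxE mul0r.
apply: ler_sum => i _; rewrite mxE -!expr2.
exact: round_to_sqr (mesh_gt0 _).
Qed.

Lemma chain_dist k (x : 'cV[R]_n) : (nsupp x <= s)%N -> dotp x x <= 1 ->
  dotp (x - chain k x) (x - chain k x) <= (8 ^- k) ^+ 2.
Proof.
move=> xs x1; case: k => [|k].
  by rewrite /chain subr0 expr0 invr1 expr1n.
have -> : (8 ^- k.+1) ^+ 2 = s%:R * mesh k.+1 ^+ 2 :> R.
  rewrite /mesh; have : 8 ^+ k.+1 != 0 :> R by rewrite expf_neq0.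
  move: (8 ^+ k.+1) => a a0; rewrite [in RHS]exprVn exprMn sqr_sqrtr//.
  by field; rewrite a0 pnatr_eq0 -lt0n s0.
apply: sum_support_sqr (nsupp_sub_chain _ xs); first exact: sqr_ge0.
by move=> i; rewrite !mxE; exact: round_to_dist (mesh_gt0 _).
Qed.

Lemma chain_eq_net_pt k (x : 'cV[R]_n) (z : {ffun 'I_n -> grid_code (s * 8 ^ k)}) :
  (forall i, round_to (mesh k) (x i 0) = cval (z i) * mesh k) ->
  chain k x = net_pt z.
Proof. by case: k z => // k z xz; apply/colP => i; rewrite !mxE. Qed.

Lemma chain_in_net k (x : 'cV[R]_n) : (nsupp x <= s)%N -> dotp x x <= 1 ->
  exists2 z : {ffun 'I_n -> grid_code (s * 8 ^ k)}, sparse_code s z & chain k x = net_pt z.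
Proof.
move=> xs x1.
have h0 := mesh_gt0 k.
pose t i := Num.truncn (`|x i 0| / mesh k).
have tsum : (\sum_i t i <= s * 8 ^ k)%N.
  rewrite -(ler_nat R) natr_sum natrM natrX.
  have s0' : 0 < s%:R :> R by rewrite ltr0n.
  set rs : R := Num.sqrt s%:R.
  have rs0 : 0 < rs by rewrite sqrtr_gt0.
  have rs2 : rs ^+ 2 = s%:R by rewrite sqr_sqrtr// ltW.
  pose b i : R := (x i 0 != 0)%:R.
  have bs : \sum_i b i <= s%:R.
    rewrite -natr_sum ler_nat; apply: leq_trans xs.
    by rewrite /nsupp -sum1_card [leqRHS]big_mkcond/=; apply: leq_sum => i _; rewrite inE; case: eqP.
  (* The arithmetic-geometric inequality sqrt s |x_i| <= (s x_i^2 + 1) / 2 on the support; summed,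
     it gives the l1 bound s 8^k. *)
  have ti i : (t i)%:R <= 8 ^+ k * ((s%:R * (x i 0 * x i 0) + b i) / 2).
    apply: (@le_trans _ _ (`|x i 0| / mesh k)).
      by rewrite /t truncn_le// divr_ge0// ltW.
    rewrite /mesh invrK mulrCA ler_wpM2l ?exprn_ge0//.
    rewrite -/rs -rs2 /b; have [->|xi] := eqVneq (x i 0) 0.
      by rewrite normr0 !mul0r mulr0 addr0 mul0r.
    rewrite -expr2 -(real_normK (num_real (x i 0))) /=.
    have := sqr_ge0 (rs * `|x i 0| - 1).
    by rewrite mulr1n; lra.
  apply: le_trans (ler_sum _ (fun i _ => ti i)) _.
  rewrite -mulr_sumr mulrC ler_wpM2r ?exprn_ge0// -mulr_suml big_split/=.
  rewrite -mulr_sumr ler_pdivrMr//.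
  have : s%:R * dotp x x <= s%:R by rewrite -[leRHS]mulr1 ler_wpM2l// ltW.
  by rewrite /dotp; lra.
have tM i : (t i <= s * 8 ^ k)%N.
  by apply: leq_trans tsum; rewrite (bigD1 i)//= leq_addr.
pose z : {ffun 'I_n -> grid_code (s * 8 ^ k)} :=
  [ffun i => if t i is j.+1 then omap (pair (x i 0 < 0)) (insub j) else None].
have zmag i : cmag (z i) = t i.
  rewrite ffunE; have := tM i; case: (t i) => // j jM.
  by rewrite insubT.
have zval i : cval (z i) = Num.sg (x i 0) * (t i)%:R.
  rewrite ffunE; have := tM i; case E: (t i) => [|j] jM; first by rewrite mulr0.
  rewrite insubT/= ; congr (_ * _).
  have xi : x i 0 != 0.
    apply: contra_eq_neq E => xi0; by rewrite /t xi0 normr0 mul0r truncn0.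
  by rewrite [in RHS]sgr_def xi mulr1n.
exists z.
  apply/andP; split; last by under eq_bigr do rewrite zmag.
  apply: leq_trans xs; apply: subset_leq_card; apply/fintype.subsetP => i; rewrite !inE.
  apply: contraNN => /eqP xi; have := zmag i; rewrite /t xi normr0 mul0r truncn0.
  by case: (z i) => // -[].
by apply: chain_eq_net_pt => i; rewrite /round_to zval.
Qed.

End Chain.

End SparseNet.

(** * Exceptional events *)

Section SparseComplexity.
Context {R : realType}.
Variables (n s : nat).
Hypotheses (s0 : (0 < s)%N) (sn : (s <= n)%N).
Local Notation D := (sparse_complexity R n s).

Lemma expR1_ge2 : 2 <= expR 1 :> R.
Proof. by have := @expR_ge1Dx R 1; lra. Qed.

Let s0' : 0 < s%:R :> R. Proof. by rewrite ltr0n. Qed.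
Let ns1 : 1 <= n%:R / s%:R :> R.
Proof. by rewrite ler_pdivlMr// mul1r ler_nat. Qed.

Lemma sparse_complexityE : D = s%:R + s%:R * ln (n%:R / s%:R).
Proof.
have ns0 : 0 < n%:R / s%:R :> R by exact: lt_le_trans ns1.
rewrite /sparse_complexity -mulrA lnM ?posrE ?expR_gt0// expRK.
by rewrite mulrDr mulr1.
Qed.

Lemma sparse_complexity_ge1 : 1 <= D.
Proof.
rewrite sparse_complexityE (@le_trans _ _ s%:R) ?ler1n// lerDl.
by rewrite mulr_ge0// ln_ge0.
Qed.

(** Taking l = 8^-k turns the factor exp (l M) into exp s. The linear term [s] of the complexity
    absorbs such factors, and 8 <= e^3 makes the entropy linear in [k]. *)
Lemma card_net_le_expR k :
  #|[set z : {ffun 'I_n -> grid_code (s * 8 ^ k)} | sparse_code s z]%SET|%:R <=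
  expR (3 * k.+1%:R * D).
Proof.
have e0 : 0 < 8 ^+ k :> R by rewrite exprn_gt0.
have l0 : 0 < 8 ^- k :> R by rewrite invr_gt0.
have l1 : 8 ^- k <= 1 :> R by rewrite invf_le1// exprn_ege1// ler1n.
apply: le_trans (card_net_le _ s0 sn l0 l1) _.
have -> : 8 ^- k * (s * 8 ^ k)%:R = s%:R :> R.
  by rewrite natrM natrX mulrCA mulVf ?mulr1// gt_eqF.
have -> : n%:R / (8 ^- k * s%:R) = 8 ^+ k * (n%:R / s%:R) :> R.
  by rewrite invfM invrK mulrCA.
have n0 : 0 < n%:R / s%:R :> R by exact: lt_le_trans ns1.
have e8 : 8 ^+ k <= expR (3 * k%:R) :> R.
  rewrite expRM_natr lerXn2r ?nnegrE ?expR_ge0//.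
  have -> : expR 3 = expR 1 ^+ 3 :> R by rewrite -expRM_natl mulr1.
  have -> : 8 = 2 ^+ 3 :> R by rewrite -natrX.
  by rewrite lerXn2r ?nnegrE ?expR_ge0// expR1_ge2.
have ln0 : 0 <= ln (n%:R / s%:R) :> R by rewrite ln_ge0.
apply: (@le_trans _ _ (expR (s%:R + 2 * s%:R) *
    expR ((3 * k%:R + ln (n%:R / s%:R)) * s%:R))).
  have en : 0 <= 8 ^+ k * (n%:R / s%:R) :> R by apply: mulr_ge0; exact: ltW.
  rewrite ler_wpM2l ?expR_ge0// [leRHS]expRM_natr.
  apply: lerXn2r; rewrite ?nnegrE ?expR_ge0//.
  by rewrite expRD lnK ?posrE// ler_wpM2r// ltW.
rewrite -expRD ler_expR sparse_complexityE -natr1.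
move: (ln _) ln0 => l ln0; have k0 : 0 <= k%:R :> R by [].
have := mulr_ge0 (ltW s0') ln0; have := mulr_ge0 k0 (mulr_ge0 (ltW s0') ln0).
nra.
Qed.

End SparseComplexity.

Section UnionBound.
Context {R : realType} d {T : measurableType d} (P : probability T R).

Lemma Pr_bigsetU_card_le (I : finType) (Q : pred I) (F : I -> set T) (c N : R) :
  0 <= c -> (forall i, measurable (F i)) -> (forall i, Q i -> Pr P (F i) <= c) ->
  #|[set i | Q i]%SET|%:R <= N ->
  Pr P (\big[setU/set0]_(i | Q i) F i) <= N * c.
Proof.
move=> c0 mF Fc QN; apply: le_trans (Pr_bigsetU_le _ _ (fun i _ => mF i)) _.
apply: (@le_trans _ _ (\sum_(i | Q i) c)); first exact: ler_sum.
rewrite sumr_const -[leLHS]mulr_natl ler_wpM2r//; apply: le_trans QN.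
by rewrite ler_nat; apply: eq_leq; apply: eq_card => i; rewrite inE.
Qed.

Lemma bigsetU_in (I : finType) (Q : pred I) (F : I -> set T) i t :
  Q i -> F i t -> (\big[setU/set0]_(i | Q i) F i) t.
Proof. by move=> Qi Fit; rewrite (bigD1 i)//=; left. Qed.

Lemma measurable_bigsetU (I : finType) (Q : pred I) (F : I -> set T) :
  (forall i, measurable (F i)) -> measurable (\big[setU/set0]_(i | Q i) F i).
Proof. by move=> mF; exact: bigsetU_measurable. Qed.

End UnionBound.

(** * Deviation of a single link *)

Section BadEvents.
Context {R : realType} d {T : measurableType d} (P : probability T R).
Local Notation mR := (measurableTypeR R).
Variables (m n s : nat) (sigma : R).
Local Notation row_type := (n.-tuple mR * mR)%type.
Variable (Z : 'I_m -> T -> row_type).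
Hypotheses (sigma0 : 0 <= sigma) (gZ : forall i, gaussian_row P sigma (Z i))
  (indZ : independent_family P Z) (s0 : (0 < s)%N) (sn : (s <= n)%N) (n1 : (1 < n)%N).

Let mZ i : measurable_fun [set: T] (Z i) := (gZ i).1.
Implicit Types u v a b : 'cV[R]_n.

Definition mis u v : set row_type := mismatch (lin u) (lin v).

Lemma measurable_mis u v : measurable (mis u v).
Proof. by apply: measurable_mismatch; exact: measurable_lin. Qed.

Definition mis_count u v t : R := \sum_i \1_(mis u v) (Z i t).
Definition mis_mean u v : R := \sum_i Pr P (Z i @^-1` mis u v).

(** If neither endpoint changes sign when moved, the comparison is unchanged. The right-hand side is
    the set [V] of the Chernoff bound, so the variance of a link depends on the short moves, not on
    the distance from [a] to [b]. *)
Lemma mis_triangle a b a' b' :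
  (mis a' b' `\` mis a b) `|` (mis a b `\` mis a' b') `<=` mis a a' `|` mis b b'.
Proof.
move=> z; rewrite /mis /mismatch/=.
case: (0 < lin a z); case: (0 < lin b z); case: (0 < lin a' z);
  case: (0 < lin b' z) => //=; by [left|right|case=> -[//|//]; case|case=> -[]].
Qed.

Lemma mis_count_triangle a b a' b' t :
  `|mis_count a' b' t - mis_count a b t| <= mis_count a a' t + mis_count b b' t.
Proof.
rewrite -sumrB -big_split/=; apply: le_trans (ler_norm_sum _ _ _) _.
apply: ler_sum => i _; rewrite !indicE.
have tri := @mis_triangle a b a' b' (Z i t).
have [h1|h1] := boolP (_ \in mis a' b'); have [h2|h2] := boolP (_ \in mis a b).
- by rewrite subrr normr0 addr_ge0.
- rewrite subr0 normr1; case: tri.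
  + by left; split; [exact: set_mem|move=> h; move/negP: h2; apply; exact: mem_set].
  + by move=> h; rewrite (mem_set h) lerDl.
  + by move=> h; rewrite (mem_set h) lerDr.
- rewrite sub0r normrN normr1; case: tri.
  + by right; split; [exact: set_mem|move=> h; move/negP: h1; apply; exact: mem_set].
  + by move=> h; rewrite (mem_set h) lerDl.
  + by move=> h; rewrite (mem_set h) lerDr.
- by rewrite subrr normr0 addr_ge0.
Qed.

Let mpre i (S : set row_type) : measurable S -> measurable (Z i @^-1` S).
Proof. exact: measurable_preimage. Qed.

Lemma mis_mean_triangle a b a' b' :
  `|mis_mean a' b' - mis_mean a b| <= mis_mean a a' + mis_mean b b'.
Proof.
rewrite -sumrB -big_split/=; apply: le_trans (ler_norm_sum _ _ _) _.
apply: ler_sum => i _.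
have mV : measurable (mis a a' `|` mis b b') by apply: measurableU; exact: measurable_mis.
have half c e c' e' : mis c' e' `\` mis c e `<=` mis a a' `|` mis b b' ->
    Pr P (Z i @^-1` mis c' e') <= Pr P (Z i @^-1` mis c e) +
      (Pr P (Z i @^-1` mis a a') + Pr P (Z i @^-1` mis b b')).
  move=> sub; have mm x y := mpre i (measurable_mis x y).
  have mU := measurableU _ _ (mm a a') (mm b b').
  apply: le_trans (lerD (lexx _) (Pr_setU_le _ (mm a a') (mm b b'))).
  apply: le_trans (Pr_setU_le _ (mm c e) mU).
  apply: (Pr_le _ (mm c' e') (measurableU _ _ (mm c e) mU)).
  move=> t h; have [h'|h'] := pselect (mis c e (Z i t)); first by left.
  by right; exact: (sub (Z i t) (conj h h')).
have tri := @mis_triangle a b a' b'.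
rewrite ler_norml; apply/andP; split.
  have := @half a' b' a b (fun z h => tri z (or_intror h)); lra.
have := @half a b a' b' (fun z h => tri z (or_introl h)); lra.
Qed.

Definition link_bad (tau : R) a b a' b' : set T :=
  [set t | tau <= `|(mis_count a' b' t - mis_count a b t) -
                    (mis_mean a' b' - mis_mean a b)|].

Lemma measurable_mis_count u v : measurable_fun [set: T] (mis_count u v).
Proof.
apply: measurable_sum => i.
exact: (measurableT_comp (measurable_indic (measurable_mis u v)) (mZ i)).
Qed.

Lemma measurable_link_bad tau a b a' b' : measurable (link_bad tau a b a' b').
Proof.
apply: (@measurable_norm_ge R _ _ (fun t => (mis_count a' b' t - mis_count a b t) -
                    (mis_mean a' b' - mis_mean a b))).
by apply: measurable_funB => //; apply: measurable_funB; exact: measurable_mis_count.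
Qed.

Lemma Pr_link_bad (l tau v : R) a b a' b' : 0 <= l -> l <= 1 ->
  mis_mean a a' + mis_mean b b' <= v ->
  Pr P (link_bad tau a b a' b') <= 2 * expR (2 * l ^+ 2 * v - l * tau).
Proof.
move=> l0 l1 mv.
have mV : measurable (mis a a' `|` mis b b') by apply: measurableU; exact: measurable_mis.
have -> : link_bad tau a b a' b' = [set t | tau <=
    `|\sum_i (\1_(mis a' b') (Z i t) - \1_(mis a b) (Z i t)) -
      \sum_i (Pr P (Z i @^-1` mis a' b') - Pr P (Z i @^-1` mis a b))|].
  by apply/seteqP; split=> t; rewrite /link_bad/= !sumrB.
apply: (chernoff_abs_diff indZ tau (measurable_mis a' b') (measurable_mis a b) mV
  (@mis_triangle a b a' b') l0 l1).
apply: le_trans mv; rewrite /mis_mean -big_split/=; apply: ler_sum => i _.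
by rewrite preimage_setU; apply: Pr_setU_le; exact: mpre (measurable_mis _ _).
Qed.

End BadEvents.

(** * Union bounds over the nets *)

Section UnionOverNets.
Context {R : realType} d {T : measurableType d} (P : probability T R).
Local Notation mR := (measurableTypeR R).
Variables (m n s : nat) (sigma : R).
Local Notation row_type := (n.-tuple mR * mR)%type.
Variable (Z : 'I_m -> T -> row_type).
Hypotheses (sigma0 : 0 <= sigma) (gZ : forall i, gaussian_row P sigma (Z i))
  (indZ : independent_family P Z) (s0 : (0 < s)%N) (sn : (s <= n)%N) (n1 : (1 < n)%N).
Variables (eps delta : R).
Hypotheses (eps0 : 0 < eps) (eps1 : eps < 1) (delta0 : 0 < delta) (delta1 : delta < 1).
Local Notation D := (sparse_complexity R n s).
Local Notation L := (ln (2 / eps) + sparse_complexity R n s).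
Hypothesis (mL : 16 ^+ 7 * (delta ^- 2 * L) <= m%:R).

Let mZ i : measurable_fun [set: T] (Z i) := (gZ i).1.
Let D1 : 1 <= D. Proof. exact: sparse_complexity_ge1. Qed.

Let e0 : 0 < 2 / eps. Proof. by rewrite divr_gt0. Qed.

Let ln_eps : 0 <= ln (2 / eps).
Proof. by rewrite ln_ge0// ler_pdivlMr// mul1r (le_trans (ltW eps1))// ler1n. Qed.

Let DL : D <= L. Proof. by rewrite lerDr. Qed.
Let L1 : 1 <= L. Proof. exact: le_trans DL. Qed.
Let L0 : 0 < L. Proof. exact: lt_le_trans L1. Qed.

Let mdelta : 16 ^+ 7 * L <= m%:R * delta ^+ 2.
Proof.
have := mL; rewrite mulrCA mulrC ler_pdivrMr ?exprn_gt0//.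
Qed.

Let m0 : 0 < m%:R :> R.
Proof.
apply: lt_le_trans mL; rewrite mulr_gt0 ?exprn_gt0// mulr_gt0// invr_gt0 exprn_gt0//.
Qed.

Let expL : expR (- L) <= eps / 4.
Proof.
rewrite opprD expRD expRN lnK ?posrE// invf_div.
have : expR (- D) <= 2^-1.
  rewrite expRN lef_pV2 ?posrE ?expR_gt0//; apply: le_trans (expR_ge1Dx _).
  by have := D1; lra.
have := eps0; move: (expR _) => x; nra.
Qed.

(** Of the k + 5 factors exp (- L), one supplies eps / 4 and the others 1/2 each. *)
Lemma expR_L_le k : expR (- (k%:R + 5) * L) <= eps / 64 * 2 ^- k.
Proof.
rewrite mulNr -mulrN mulrDl expRD.
have h : expR (- L) <= 2^-1 by have := expL; have := eps1; lra.
have p0 := expR_ge0 (- L).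
have -> : expR (5 * - L) = expR (- L) ^+ 5 by rewrite expRM_natl.
rewrite expRM_natl mulrC; apply: ler_pM; rewrite ?exprn_ge0//.
  rewrite exprS; apply: (@le_trans _ _ ((eps / 4) * 2^-1 ^+ 4)).
    apply: ler_pM; rewrite ?exprn_ge0//.
    by rewrite lerXn2r ?nnegrE.
  by rewrite (_ : 2^-1 ^+ 4 = 16^-1 :> R) ?le_eqVlt; [apply/orP; left; apply/eqP; field|field].
by rewrite -exprVn lerXn2r ?nnegrE.
Qed.

Lemma mis_mean_le (a b : 'cV[R]_n) (r tau : R) : 4^-1 <= dotp a a ->
  0 < r -> 0 < tau -> dotp (b - a) (b - a) <= r ^+ 2 ->
  mis_mean P Z a b <= m%:R * (4 * tau + 8 * r ^+ 2 / tau ^+ 2).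
Proof.
move=> a4 r0 tau0 abr; apply: (@le_trans _ _ (\sum_(i < m) (4 * tau + 8 * r ^+ 2 / tau ^+ 2))).
  by apply: ler_sum => i _; exact: (Pr_mismatch_le sigma0 (gZ i) n1 a4 r0 tau0 abr).
by rewrite sumr_const card_ord -[leLHS]mulr_natl.
Qed.

(** Covers two moves, each with the constant 36 of [mis_mean_chain]. *)
Let v_ (k : nat) : R := 128 * 4 ^- k.
(** The sum over all levels is delta / 4. *)
Let tau_ (k : nat) : R := delta / 16 * (3 / 4) ^+ k.

Let pt (k : nat) (z : {ffun 'I_n -> grid_code (s * 8 ^ k)}) : 'cV[R]_n := net_pt z.

(** The union runs over all quadruples of codes; the guard empties those whose moves are too long
    for the variance bound. Actual chain links pass it. *)
Definition links_bad_set (k : nat) : set T :=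
  \big[setU/set0]_(z1 : {ffun 'I_n -> grid_code (s * 8 ^ k)} | sparse_code s z1)
  \big[setU/set0]_(z2 : {ffun 'I_n -> grid_code (s * 8 ^ k)} | sparse_code s z2)
  \big[setU/set0]_(z3 : {ffun 'I_n -> grid_code (s * 8 ^ k.+1)} | sparse_code s z3)
  \big[setU/set0]_(z4 : {ffun 'I_n -> grid_code (s * 8 ^ k.+1)} | sparse_code s z4)
    (if mis_mean P Z (pt z1) (pt z3) + mis_mean P Z (pt z2) (pt z4) <= m%:R * v_ k
     then link_bad P Z (m%:R * tau_ k) (pt z1) (pt z2) (pt z3) (pt z4) else set0).

Lemma measurable_links_bad_set k : measurable (links_bad_set k).
Proof.
do 4 (apply: measurable_bigsetU => ?).
by case: ifP => _; [exact: (measurable_link_bad gZ)|exact: measurable0].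
Qed.

Let card_le k : #|[set z : {ffun 'I_n -> grid_code (s * 8 ^ k)} | sparse_code s z]%SET|%:R
  <= expR (3 * k.+1%:R * L).
Proof.
apply: le_trans (card_net_le_expR s0 sn k) _.
by rewrite ler_expR ler_wpM2l// mulr_ge0.
Qed.

Let pow94 k : k.+1%:R <= (9 / 4) ^+ k :> R.
Proof.
elim: k => [|k ih]; first by rewrite expr0.
rewrite exprS -natr1; have : 1 <= k.+1%:R :> R by rewrite ler1n.
by move: ih; move: (_ ^+ _) => x; lra.
Qed.

Lemma Pr_links_bad_set k : delta * 4 ^+ k <= 256 ->
  Pr P (links_bad_set k) <= eps / 32 * 2 ^- k.
Proof.
move=> dk.
have p4 : 0 < 4 ^+ k :> R by rewrite exprn_gt0.
have v0 : 0 < v_ k by rewrite /v_ mulr_gt0// invr_gt0.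
have t0 : 0 < tau_ k by rewrite /tau_ mulr_gt0 ?exprn_gt0// divr_gt0.
(* The minimizer of 2 l^2 v - l tau; the hypothesis on [delta] and [k] keeps it at most 1. *)
pose l := tau_ k / (4 * v_ k).
have l0 : 0 <= l by rewrite divr_ge0 ?(ltW t0)// mulr_ge0// ltW.
have l1 : l <= 1.
  rewrite ler_pdivrMr ?mulr_gt0// mul1r /tau_ /v_.
  have p1 : (3 / 4) ^+ k <= 1 :> R.
    by apply: exprn_ile1; [rewrite divr_ge0|rewrite ler_pdivrMr// mul1r ler_nat].
  have d4 : delta <= 256 * 4 ^- k by rewrite ler_pdivlMr.
  apply: (@le_trans _ _ (delta / 16)); last by have := delta0; lra.
  by rewrite ler_piMr// divr_ge0// ltW.
(* The two nets of level k and two of level k + 1 cost (12 k + 18) L in the exponent, so 23 (k + 1)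
   L leaves (11 k + 5) L. *)
pose c := 2 * expR (- (23 * k.+1%:R * L)).
have c0 : 0 <= c by rewrite mulr_ge0// expR_ge0.
have ptl a b a' b' : mis_mean P Z a a' + mis_mean P Z b b' <= m%:R * v_ k ->
    Pr P (link_bad P Z (m%:R * tau_ k) a b a' b') <= c.
  move=> mv; apply: le_trans (Pr_link_bad gZ indZ _ l0 l1 mv) _.
  rewrite /c ler_pM2l// ler_expR.
  have -> : 2 * l ^+ 2 * (m%:R * v_ k) - l * (m%:R * tau_ k) =
      - (m%:R * tau_ k ^+ 2 / (8 * v_ k)).
    by rewrite /l; field; rewrite gt_eqF.
  rewrite lerN2 /tau_ /v_.
  have -> : m%:R * (delta / 16 * (3 / 4) ^+ k) ^+ 2 / (8 * (128 * 4 ^- k)) =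
      (m%:R * delta ^+ 2) / (16 ^+ 4 * 4) * (9 / 4) ^+ k.
    have -> : (9 / 4 : R) = (3 / 4) ^+ 2 * 4 by field.
    rewrite [in RHS]exprMn -[in RHS]exprM mulnC exprM.
    by move: ((3 / 4) ^+ k) (4 ^+ k) p4 => x y y0; field; rewrite gt_eqF.
  have X1 : 23 * L <= (m%:R * delta ^+ 2) / (16 ^+ 4 * 4).
    have w0 : 0 < 16 ^+ 4 :> R by rewrite exprn_gt0.
    rewrite ler_pdivlMr ?mulr_gt0//; apply: le_trans mdelta.
    rewrite (exprD 16 4 3); move: (16 ^+ 4) w0 => w w0.
    have := mulr_gt0 L0 w0; lra.
  rewrite [leLHS]mulrAC; apply: ler_pM X1 (pow94 k); last exact: ler0n.
  by rewrite mulr_ge0// ltW.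
have mlb a b a' b' : measurable (link_bad P Z (m%:R * tau_ k) a b a' b').
  exact: (measurable_link_bad gZ).
pose N k := expR (3 * k.+1%:R * L).
have N0 j : 0 <= N j by exact: expR_ge0.
apply: (@le_trans _ _ (N k * (N k * (N k.+1 * (N k.+1 * c))))).
  apply: Pr_bigsetU_card_le => //; first by rewrite !mulr_ge0.
    move=> z1; do 3 (apply: measurable_bigsetU => ?); case: ifP => // _.
  move=> z1 _; apply: Pr_bigsetU_card_le => //; first by rewrite !mulr_ge0.
    move=> z2; do 2 (apply: measurable_bigsetU => ?); case: ifP => // _.
  move=> z2 _; apply: Pr_bigsetU_card_le => //; first by rewrite !mulr_ge0.
    move=> z3; apply: measurable_bigsetU => ?; case: ifP => // _.
  move=> z3 _; apply: Pr_bigsetU_card_le => //.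
    by move=> z4; case: ifP.
  move=> z4 _; case: ifP => [|_]; first exact: ptl.
  by rewrite /Pr measure0.
have -> : N k * (N k * (N k.+1 * (N k.+1 * c))) =
    2 * expR (- (11 * k%:R + 5) * L).
  rewrite /N /c ![_ * (2 * _)]mulrCA -!expRD; congr (2 * expR _).
  by rewrite -!natr1; ring.
apply: (@le_trans _ _ (2 * expR (- (k%:R + 5) * L))).
  rewrite ler_pM2l// ler_expR ler_pM2r// lerN2 lerD2r ler_peMl//; lra.
by have := expR_L_le k; move: (expR _) => x; lra.
Qed.

Definition small_count (tau : R) (u : 'cV[R]_n) (t : T) : R :=
  \sum_i \1_([set z : row_type | `|lin u z| <= tau]) (Z i t).

Definition small_bad (tau : R) (u : 'cV[R]_n) : set T :=
  [set t | m%:R * (5 * tau) <= small_count tau u t].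

Let measurable_small (tau : R) (u : 'cV[R]_n) :
  measurable [set z : row_type | `|lin u z| <= tau].
Proof. by apply: measurable_norm_le; exact: measurable_lin. Qed.

Lemma measurable_small_bad tau u : measurable (small_bad tau u).
Proof.
have mc : measurable_fun [set: T] (small_count tau u).
  apply: measurable_sum => i.
  exact: (measurableT_comp (measurable_indic (measurable_small tau u)) (mZ i)).
rewrite (_ : small_bad _ _ = small_count tau u @^-1` `[m%:R * (5 * tau), +oo[%classic).
  exact: measurable_preimage.
by apply/seteqP; split => t; rewrite /small_bad/= in_itv/= andbT.
Qed.

(** With [C] empty and [V] the event itself, the variance is bounded by the mean 4 m tau, so the
    exponent is linear in [tau]: at l = 1/16 it is 2 l^2 (4 m tau) - l m tau = - m tau / 32. *)
Lemma Pr_small_bad tau u : 0 <= tau -> 4^-1 <= dotp u u ->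
  Pr P (small_bad tau u) <= expR (- (m%:R * tau / 32)).
Proof.
move=> tau0 u4; pose S := [set z : row_type | `|lin u z| <= tau].
have mS : measurable S by exact: measurable_small.
have mean : \sum_(i < m) Pr P (Z i @^-1` S) <= m%:R * (4 * tau).
  apply: (@le_trans _ _ (\sum_(i < m) (4 * tau))).
    by apply: ler_sum => i _; exact: (Pr_lin_small sigma0 (gZ i) n1 u4 tau0).
  by rewrite sumr_const card_ord -[leLHS]mulr_natl.
have sub : (S `\` set0) `|` (set0 `\` S) `<=` S by rewrite setD0 set0D setU0.
have l0 : 0 <= 16^-1 :> R by rewrite invr_ge0.
have l1 : 16^-1 <= 1 :> R by rewrite invf_le1// ler1n.
have := chernoff_diff indZ (m%:R * tau) mS measurable0 mS sub l0 l1.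
have -> : \sum_i (Pr P (Z i @^-1` S) - Pr P (Z i @^-1` set0)) =
    \sum_(i < m) Pr P (Z i @^-1` S).
  by apply: eq_bigr => i _; rewrite preimage_set0 {2}/Pr measure0 subr0.
move=> h; apply: le_trans (le_trans _ h) _.
  apply: Pr_le; first exact: measurable_small_bad.
    have mc : measurable_fun [set: T] (fun t => \sum_i (\1_S (Z i t) - \1_set0 (Z i t)) : R).
      apply: measurable_sum => i; apply: measurable_funB.
        exact: (measurableT_comp (measurable_indic mS) (mZ i)).
      exact: (measurableT_comp (measurable_indic measurable0) (mZ i)).
    rewrite (_ : [set _ | _] = (fun t => \sum_i (\1_S (Z i t) - \1_set0 (Z i t)) : R) @^-1`
        `[\sum_(i < m) Pr P (Z i @^-1` S) + m%:R * tau, +oo[%classic).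
      exact: measurable_preimage.
    by apply/seteqP; split => t; rewrite /= in_itv/= andbT.
  move=> t; rewrite /small_bad /small_count /= -/S => ht.
  have -> : \sum_i (\1_S (Z i t) - \1_set0 (Z i t)) = \sum_i \1_S (Z i t) :> R.
    by apply: eq_bigr => i _; rewrite indic0 subr0.
  by apply: le_trans ht; lra.
rewrite ler_expR.
have : 2 * 16^-1 ^+ 2 * (\sum_(i < m) Pr P (Z i @^-1` S)) <=
    2 * 16^-1 ^+ 2 * (m%:R * (4 * tau)) by rewrite ler_wpM2l// mulr_ge0// exprn_ge0.
lra.
Qed.

Definition balls_bad_set (k : nat) : set T :=
  \big[setU/set0]_(z : {ffun 'I_n -> grid_code (s * 8 ^ k)} | sparse_code s z)
    (if 4^-1 <= dotp (pt z) (pt z) then small_bad (4 ^- k) (pt z) else set0).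

Lemma measurable_balls_bad_set k : measurable (balls_bad_set k).
Proof.
apply: measurable_bigsetU => z.
by case: ifP => _; [exact: measurable_small_bad|exact: measurable0].
Qed.

Let pow4 k : k.+1%:R <= 4 ^+ k :> R.
Proof.
elim: k => [|k ih]; first by rewrite expr0.
rewrite exprS -natr1; have : 1 <= k.+1%:R :> R by rewrite ler1n.
by move: ih; move: (_ ^+ _) => x; lra.
Qed.

Lemma Pr_balls_bad_set k : delta <= 4 ^+ 5 * 4 ^- k ->
  Pr P (balls_bad_set k) <= eps / 64.
Proof.
move=> dk; have tau0 : 0 < 4 ^- k :> R by rewrite invr_gt0 exprn_gt0.
have c0 := expR_ge0 (- (m%:R * 4 ^- k / 32) : R).
apply: le_trans (Pr_bigsetU_card_le c0 _ _ (card_le k)) _.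
- by move=> z; case: ifP => _; [exact: measurable_small_bad|exact: measurable0].
- move=> z _; case: ifP => [h|_]; last by rewrite /Pr measure0.
  exact: Pr_small_bad (ltW tau0) h.
rewrite -expRD; have := expR_L_le 0; rewrite expr0 invr1 mulr1 add0r.
apply: le_trans; rewrite ler_expR.
have y0 : 0 < 4 ^+ 5 :> R by rewrite exprn_gt0.
(* The sample-size constant is spent here: the two factors 4^5 convert the two factors [delta], and
   256 / 32 = 8 pays 3 (k + 1) for the net and 5 for the probability. *)
have yE : 16 ^+ 7 = (4 ^+ 5 * 4 ^+ 5) * 256 :> R.
  by rewrite -exprMn -natrM (exprD _ 5 2); congr (_ * _); rewrite -natrX.
move: (4 ^+ 5) y0 yE dk => y y0 yE dk.
have k10 : 0 < k.+1%:R :> R by [].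
(* One factor [delta] is exchanged for 4^-k, the other absorbs the entropy factor k + 1. *)
have mt : 256 * L * k.+1%:R <= m%:R * 4 ^- k.
  have dk1 : delta * k.+1%:R <= y.
    apply: (@le_trans _ _ (y * 4 ^- k * 4 ^+ k)).
      by apply: ler_pM => //; exact: ltW.
    by rewrite mulfVK// expf_neq0.
  have h1 : m%:R * delta ^+ 2 * k.+1%:R <= m%:R * 4 ^- k * (y * y).
    rewrite expr2 -!mulrA ler_pM2l//.
    rewrite (_ : 4 ^- k * (y * y) = (y * 4 ^- k) * y); last first.
      by rewrite mulrA; congr (_ * _); exact: mulrC.
    apply: ler_pM => //; first exact: ltW.
    by rewrite mulr_ge0 ?ltW.
  have h2 : 16 ^+ 7 * L * k.+1%:R <= m%:R * 4 ^- k * (y * y).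
    by apply: le_trans h1; rewrite ler_pM2r.
  have yy : 0 < y * y by rewrite mulr_gt0.
  rewrite -(ler_pM2r yy); apply: le_trans h2.
  by rewrite yE le_eqVlt; apply/orP; left; apply/eqP; ring.
have : L <= L * k.+1%:R by rewrite ler_peMr ?ler1n// ltW.
lra.
Qed.

Definition sumsq (w : 'cV[R]_n) (t : T) : R := \sum_i lin0 w (Z i t) ^+ 2.

Definition sumsq_bad (w : 'cV[R]_n) : set T := [set t | m%:R * 8 <= sumsq w t].

Lemma measurable_sumsq_bad w : measurable (sumsq_bad w).
Proof.
have mc : measurable_fun [set: T] (sumsq w).
  apply: measurable_sum => i; apply: measurable_funX.
  exact: (measurableT_comp (measurable_lin0 w) (mZ i)).
rewrite (_ : sumsq_bad _ = sumsq w @^-1` `[m%:R * 8, +oo[%classic).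
  exact: measurable_preimage.
by apply/seteqP; split => t; rewrite /sumsq_bad/= in_itv/= andbT.
Qed.

(** Each square over 4 has exponential moment at most 2 <= e, and the threshold 8 m becomes 2 m, so
    the exponent is m - 2 m. *)
Lemma Pr_sumsq_bad w : dotp w w <= 1 -> Pr P (sumsq_bad w) <= expR (- m%:R).
Proof.
move=> w1; pose f (_ : 'I_m) (z : row_type) := lin0 w z ^+ 2 / 4.
have mf i : measurable_fun [set: row_type] (f i).
  by apply: measurable_funM => //; apply: measurable_funX; exact: measurable_lin0.
have bnd i : (\int[P]_t (expR (f i (Z i t)))%:E <= (expR 1)%:E)%E.
  apply: le_trans (integral_exp_lin0_sqr (gZ i) n1 w1) _.
  by rewrite lee_fin expR1_ge2.
have := chernoff_sum indZ (m%:R * 2) mf bnd.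
rewrite sumr_const card_ord (_ : 1 *+ m - m%:R * 2 = - m%:R :> R); last first.
  by move: (m%:R : R) => x; ring.
apply: le_trans; rewrite le_eqVlt; apply/orP; left; apply/eqP; congr (Pr P _).
have fE t : \sum_i f i (Z i t) = sumsq w t / 4 by rewrite /sumsq mulr_suml.
apply/seteqP; split => t; rewrite /sumsq_bad /= fE; lra.
Qed.

(** One net, of radius 1/8, controls all sparse vectors at once through the peeling in
    [sumsq_le]. *)
Definition op_bad_set : set T :=
  \big[setU/set0]_(z : {ffun 'I_n -> grid_code (s * 8 ^ 1)} | sparse_code s z)
    (if dotp (pt z) (pt z) <= 1 then sumsq_bad (pt z) else set0).

Lemma measurable_op_bad_set : measurable op_bad_set.
Proof.
apply: measurable_bigsetU => z.
by case: ifP => _; [exact: measurable_sumsq_bad|exact: measurable0].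
Qed.

Lemma Pr_op_bad_set : Pr P op_bad_set <= eps / 64.
Proof.
apply: le_trans (Pr_bigsetU_card_le (expR_ge0 (- m%:R)) _ _ (card_le 1)) _.
- by move=> z; case: ifP => _; [exact: measurable_sumsq_bad|exact: measurable0].
- move=> z _; case: ifP => [h|_]; last by rewrite /Pr measure0 expR_ge0.
  exact: Pr_sumsq_bad.
rewrite -expRD; have := expR_L_le 0; rewrite expr0 invr1 mulr1 add0r.
apply: le_trans; rewrite ler_expR.
have md : m%:R * delta ^+ 2 <= m%:R.
  by rewrite ler_piMr// exprn_ile1// ltW.
have : 16 ^+ 7 * L <= m%:R by exact: le_trans mdelta md.
(* The net of level 1 costs 6 L, and 5 L remains for the probability. *)
have : 11 * L <= 16 ^+ 7 * L.
  rewrite ler_pM2r// (exprD 16 1 6) expr1.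
  have : 1 <= 16 ^+ 6 :> R by rewrite exprn_ege1// ler1n.
  by move: (16 ^+ 6) => y; lra.
lra.
Qed.

End UnionOverNets.

(** * Chaining *)

Section Deterministic.
Context {R : realType} d {T : measurableType d} (P : probability T R).
Local Notation mR := (measurableTypeR R).
Variables (m n s : nat) (sigma : R).
Local Notation row_type := (n.-tuple mR * mR)%type.
Variable (Z : 'I_m -> T -> row_type).
Hypotheses (sigma0 : 0 <= sigma) (gZ : forall i, gaussian_row P sigma (Z i))
  (s0 : (0 < s)%N) (n1 : (1 < n)%N).

Let mZ i : measurable_fun [set: T] (Z i) := (gZ i).1.

Lemma dotp_sub_le (u v : 'cV[R]_n) :
  dotp (u - v) (u - v) <= 2 * dotp u u + 2 * dotp v v.
Proof.
rewrite /dotp !mulr_sumr -big_split/=; apply: ler_sum => i _; rewrite !mxE.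
have := sqr_ge0 (u i 0 + v i 0); nra.
Qed.

Lemma sumsqZ (c : R) (w : 'cV[R]_n) t : sumsq Z (c *: w) t = c ^+ 2 * sumsq Z w t.
Proof. by rewrite /sumsq mulr_sumr; apply: eq_bigr => i _; rewrite lin0Z exprMn. Qed.

Lemma sumsqD_le (u v : 'cV[R]_n) t :
  sumsq Z (u - v) t <= 2 * sumsq Z u t + 2 * sumsq Z v t.
Proof.
rewrite /sumsq !mulr_sumr -big_split/=; apply: ler_sum => i _.
by rewrite lin0B; have := sqr_ge0 (lin0 u (Z i t) + lin0 v (Z i t)); nra.
Qed.

Lemma nsuppZ (c : R) (w : 'cV[R]_n) : (nsupp (c *: w) <= nsupp w)%N.
Proof. by apply: nsupp_le => i wi; rewrite mxE wi mulr0. Qed.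

(** The bound depends on the sample point and may be huge; it only starts the induction of
    [sumsq_le]. *)
Lemma sumsq_crude (t : T) : exists2 B : R, 0 <= B &
  forall w : 'cV[R]_n, dotp w w <= 1 -> sumsq Z w t <= B.
Proof.
exists (\sum_(i < m) (\sum_j `|tnth (Z i t).1 j|) ^+ 2).
  by apply: sumr_ge0 => i _; exact: sqr_ge0.
move=> w w1; apply: ler_sum => i _.
have S0 : 0 <= \sum_j `|tnth (Z i t).1 j| by exact: sumr_ge0.
rewrite -(real_normK (num_real (lin0 _ _))) lerXn2r ?nnegrE//.
apply: le_trans (ler_norm_sum _ _ _) _; apply: ler_sum => j _.
rewrite normrM ler_piMl// -(@ler_pXn2r _ 2) ?nnegrE// expr1n real_normK ?num_real//.
apply: le_trans w1; rewrite /dotp (bigD1 j)//= -expr2 lerDl.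
by apply: sumr_ge0 => k _; rewrite -expr2 sqr_ge0.
Qed.

(* Peeling off one net point halves the bound and shrinks the remainder by a
   factor 8, so the crude bound washes out. *)
Lemma sumsq_le (t : T) (w : 'cV[R]_n) : ~ op_bad_set s Z t ->
  (nsupp w <= s)%N -> dotp w w <= 1 -> sumsq Z w t <= m%:R * 32.
Proof.
move=> good; have [B B0 Bw] := sumsq_crude t.
have m0 : 0 <= m%:R :> R by [].
have step N (v : 'cV[R]_n) : (nsupp v <= s)%N -> dotp v v <= 1 ->
    sumsq Z v t <= m%:R * 32 + B / 2 ^+ N.
  elim: N v => [|N ih] v vs v1.
    by rewrite expr0 divr1; apply: le_trans (Bw _ v1) _; rewrite lerDr mulr_ge0.
  have [z zs zE] := chain_in_net s0 1 vs v1.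
  have small : sumsq Z (chain s 1 v) t <= m%:R * 8.
    rewrite leNgt; apply/negP => big; apply: good.
    apply: (bigsetU_in (i := z)) => //.
    by rewrite -zE (le_trans (chain_norm s0 _ _) v1) /sumsq_bad/= ltW.
  (* The remainder, magnified by 8, is again a sparse vector of the unit ball. *)
  pose v' : 'cV[R]_n := 8 *: (v - chain s 1 v).
  have v's : (nsupp v' <= s)%N.
    by apply: leq_trans (nsuppZ _ _) _; exact: nsupp_sub_chain.
  have v'1 : dotp v' v' <= 1.
    rewrite dotpZ; have := chain_dist s0 1 vs v1.
    rewrite expr1 exprVn => h.
    apply: (@le_trans _ _ (8 ^+ 2 * (8 ^+ 2)^-1)); first by rewrite ler_wpM2l// exprn_ge0.
    by rewrite mulfV// expf_neq0.
  have := ih v' v's v'1; rewrite sumsqZ => h.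
  have vE : v = chain s 1 v - (- (v - chain s 1 v)) by rewrite opprK addrC subrK.
  (* The recursion closes because 2 * 8 + 2 * 32 / 64 <= 32, while the crude part is multiplied by 2
     / 64 <= 1/2. *)
  have := sumsqD_le (chain s 1 v) (- (v - chain s 1 v)) t.
  rewrite -vE -scaleN1r sumsqZ sqrrN expr1n mul1r.
  have e2 : B / 2 ^+ N.+1 = B / 2 ^+ N / 2.
    by rewrite exprS; field; rewrite expf_neq0.
  have BN : 0 <= B / 2 ^+ N by rewrite divr_ge0// exprn_ge0.
  rewrite e2; move: h small BN; move: (sumsq _ _ _) (sumsq _ _ _) (B / _) (m%:R : R) m0.
  by move=> a b c e; lra.
move=> ws w1; apply/ler_addgt0Pl => e e0.
pose N := (Num.truncn (B / e)).+1.
apply: le_trans (step N w ws w1) _; rewrite addrC lerD2r.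
rewrite ler_pdivrMr ?exprn_gt0// mulrC -ler_pdivrMr//.
have be0 : 0 <= B / e by rewrite divr_ge0// ltW.
have /andP[_ /ltW h] := truncn_itv be0; apply: le_trans h _.
by rewrite -natrX ler_nat ltnW// ltn_expl.
Qed.

Definition large_count (tau : R) (w : 'cV[R]_n) (t : T) : R :=
  \sum_i \1_([set z : row_type | tau <= `|lin0 w z|]) (Z i t).

(** Markov's inequality for the counting measure on rows. The remainders to which it applies form an
    infinite set, out of reach of a union bound, so uniformity comes from [sumsq_le]. *)
Lemma large_count_le tau (r : R) (w : 'cV[R]_n) t : ~ op_bad_set s Z t ->
  (nsupp w <= s)%N -> 0 < r -> 0 < tau -> dotp w w <= r ^+ 2 ->
  large_count tau w t <= m%:R * 32 * r ^+ 2 / tau ^+ 2.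
Proof.
move=> good ws r0 tau0 wr; rewrite ler_pdivlMr ?exprn_gt0//.
apply: (@le_trans _ _ (sumsq Z w t)).
  rewrite /large_count mulr_suml; apply: ler_sum => i _; rewrite indicE.
  have [h|_] := boolP (_ \in _); last by rewrite mul0r sqr_ge0.
  rewrite inE /= in h; rewrite mul1r -(real_normK (num_real (lin0 w (Z i t)))).
  by rewrite lerXn2r ?nnegrE// ltW.
have v1 : dotp (r^-1 *: w) (r^-1 *: w) <= 1.
  by rewrite dotpZ exprVn mulrC ler_pdivrMr ?exprn_gt0// mul1r.
have := sumsq_le good (leq_trans (nsuppZ _ _) ws) v1.
by rewrite sumsqZ exprVn mulrC ler_pdivrMr ?exprn_gt0.
Qed.

Lemma mis_count_le (tau : R) (x y : 'cV[R]_n) t :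
  mis_count Z x y t <= small_count Z tau x t + large_count tau (y - x) t.
Proof.
rewrite /mis_count /small_count /large_count -big_split/=; apply: ler_sum => i _.
rewrite !indicE.
have [h|_] := boolP (Z i t \in mis x y); last by rewrite addr_ge0.
have [h1|h1] := mismatch_subset tau (set_mem h).
  by rewrite (mem_set h1) lerDl.
by rewrite (mem_set h1) lerDr.
Qed.

(** From 1 <= 2 |chain|^2 + 2 / 64. The index starts at level 1, since level 0 is the origin. *)
Lemma chain_norm_ge k (x : 'cV[R]_n) : (nsupp x <= s)%N -> dotp x x = 1 ->
  4^-1 <= dotp (chain s k.+1 x) (chain s k.+1 x).
Proof.
move=> xs x1; have x1' : dotp x x <= 1 by rewrite x1.
have h := chain_dist s0 k.+1 xs x1'.
have := dotp_sub_le (chain s k.+1 x) (- (x - chain s k.+1 x)).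
rewrite opprK addrC subrK x1 -scaleN1r dotpZ sqrrN expr1n mul1r.
have : (8 ^- k.+1) ^+ 2 <= 64^-1 :> R.
  have e8 : 8 ^- k.+1 <= 8^-1 :> R.
    rewrite lef_pV2 ?posrE ?exprn_gt0// exprS ler_peMr// exprn_ege1// ler1n//.
  apply: (@le_trans _ _ (8^-1 ^+ 2)); first by rewrite lerXn2r ?nnegrE ?invr_ge0 ?exprn_ge0.
  by rewrite le_eqVlt; apply/orP; left; apply/eqP; field.
move: (dotp (chain _ _ _) _) (dotp (x - _) _) h => a b h; lra.
Qed.

Definition dev (u v : 'cV[R]_n) (t : T) : R := mis_count Z u v t - mis_mean P Z u v.

Lemma mis_mean_le_card (u v : 'cV[R]_n) : mis_mean P Z u v <= m%:R.
Proof.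
apply: (@le_trans _ _ (\sum_(i < m) 1)).
  apply: ler_sum => i _; apply: Pr_le1.
  exact: measurable_preimage (mZ i) (measurable_mis u v).
by rewrite sumr_const card_ord.
Qed.

(** This makes r^2 / tau^2 equal to tau for r = 8^-k and tau = 4^-k. *)
Lemma cube_8_4 k : (8 ^- k) ^+ 2 = (4 ^- k) ^+ 3 :> R.
Proof.
have -> : 8 = 2 ^+ 3 :> R by rewrite -natrX.
have -> : (4 : R) = 2 ^+ 2 by rewrite -natrX.
rewrite !exprVn -!exprM; congr (_ ^+ _)^-1; lia.
Qed.

(** The move has length at most 2 * 8^-k, and tau = 4^-k gives 36 = 4 + 8 * 4. At level 0 the
    small-ball estimate fails at the origin, and the trivial bound [m] serves. *)
Lemma mis_mean_chain k (x : 'cV[R]_n) : (nsupp x <= s)%N -> dotp x x = 1 ->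
  mis_mean P Z (chain s k x) (chain s k.+1 x) <= m%:R * (36 * 4 ^- k).
Proof.
move=> xs x1; have x1' : dotp x x <= 1 by rewrite x1.
case: k => [|k].
  apply: le_trans (mis_mean_le_card _ _) _.
  by rewrite expr0 invr1 mulr1 ler_peMr// ler1n.
have e8 : 0 < 8 ^- k.+1 :> R by rewrite invr_gt0 exprn_gt0.
have e4 : 0 < 4 ^- k.+1 :> R by rewrite invr_gt0 exprn_gt0.
have d1 := chain_dist s0 k.+1 xs x1'; have d2 := chain_dist s0 k.+2 xs x1'.
have r0 : 0 < 2 * 8 ^- k.+1 :> R by rewrite mulr_gt0.
have dd : dotp (chain s k.+2 x - chain s k.+1 x) (chain s k.+2 x - chain s k.+1 x)
    <= (2 * 8 ^- k.+1) ^+ 2.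
  have := dotp_sub_le (x - chain s k.+1 x) (x - chain s k.+2 x).
  rewrite (_ : x - chain s k.+1 x - (x - chain s k.+2 x) =
    chain s k.+2 x - chain s k.+1 x); last by rewrite opprB addrC addrA subrK.
  have e3 : (8 ^- k.+2) ^+ 2 <= (8 ^- k.+1) ^+ 2 :> R.
    rewrite lerXn2r ?nnegrE ?invr_ge0 ?exprn_ge0// lef_pV2 ?posrE ?exprn_gt0//.
    by rewrite [leRHS]exprS ler_peMl ?exprn_ge0// ler1n.
  rewrite exprMn; move: d1 d2 e3; move: (dotp _ _) (dotp _ _) (dotp _ _) => a b c; lra.
apply: le_trans (mis_mean_le sigma0 gZ n1 (chain_norm_ge k xs x1) r0 e4 dd) _.
rewrite ler_wpM2l// le_eqVlt; apply/orP; left; apply/eqP.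
have -> : (2 * 8 ^- k.+1) ^+ 2 = 4 * (4 ^- k.+1) ^+ 3 :> R.
  by rewrite exprMn cube_8_4 (_ : 2 ^+ 2 = 4)// -natrX.
by move: (4 ^- k.+1) e4 => y y0; field; rewrite gt_eqF.
Qed.

Lemma dev_link (delta : R) k (x y : 'cV[R]_n) t :
  ~ links_bad_set P s Z delta k t ->
  (nsupp x <= s)%N -> dotp x x = 1 -> (nsupp y <= s)%N -> dotp y y = 1 ->
  `|dev (chain s k.+1 x) (chain s k.+1 y) t - dev (chain s k x) (chain s k y) t|
    <= m%:R * (delta / 16 * (3 / 4) ^+ k).
Proof.
move=> good xs x1 ys y1.
have x1' : dotp x x <= 1 by rewrite x1. have y1' : dotp y y <= 1 by rewrite y1.
have [z1 z1s xk] := chain_in_net s0 k xs x1'.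
have [z2 z2s yk] := chain_in_net s0 k ys y1'.
have [z3 z3s xk1] := chain_in_net s0 k.+1 xs x1'.
have [z4 z4s yk1] := chain_in_net s0 k.+1 ys y1'.
have mean : mis_mean P Z (net_pt z1) (net_pt z3) + mis_mean P Z (net_pt z2) (net_pt z4)
    <= m%:R * (128 * 4 ^- k).
  rewrite -xk -yk -xk1 -yk1.
  have := mis_mean_chain k xs x1; have := mis_mean_chain k ys y1.
  have : 0 <= m%:R * 4 ^- k :> R by rewrite mulr_ge0// invr_ge0 exprn_ge0.
  by move: (mis_mean _ _ _ _) (mis_mean _ _ _ _) (4 ^- k) => a b c; lra.
rewrite leNgt; apply/negP => big; apply: good.
apply: (bigsetU_in (i := z1)) => //; apply: (bigsetU_in (i := z2)) => //.
apply: (bigsetU_in (i := z3)) => //; apply: (bigsetU_in (i := z4)) => //.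
rewrite mean -xk -yk -xk1 -yk1; apply: le_trans (ltW big) _.
rewrite le_eqVlt; apply/orP; left; apply/eqP.
by congr (`| _ |); rewrite /dev; ring.
Qed.

Lemma dev_origin t : dev 0 0 t = 0.
Proof.
have E : mis 0 0 = set0 :> set row_type.
  by apply/seteqP; split => z //; rewrite /mis /mismatch/= eqxx.
rewrite /dev /mis_count /mis_mean E !big1 ?subrr//.
  by move=> i _; rewrite preimage_set0 /Pr measure0.
by move=> i _; rewrite indicE in_set0.
Qed.

Lemma dev_chain (delta : R) K (x y : 'cV[R]_n) t : 0 < delta ->
  (forall k, (k < K)%N -> ~ links_bad_set P s Z delta k t) ->
  (nsupp x <= s)%N -> dotp x x = 1 -> (nsupp y <= s)%N -> dotp y y = 1 ->
  `|dev (chain s K x) (chain s K y) t| <= m%:R * (delta / 4).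
Proof.
move=> d0 good xs x1 ys y1.
(* The exact partial sum of the geometric series is what the induction can carry. *)
suff h : `|dev (chain s K x) (chain s K y) t| <=
    m%:R * (delta / 4 * (1 - (3 / 4) ^+ K)).
  have p0 : 0 <= (3 / 4) ^+ K :> R by rewrite exprn_ge0// divr_ge0.
  apply: le_trans h _; rewrite ler_wpM2l//.
  by have := mulr_ge0 (ltW d0) p0; lra.
elim: K good => [_|K ih good].
  by rewrite dev_origin normr0 expr0 subrr !mulr0.
have h1 := dev_link (good K (ltnSn K)) xs x1 ys y1.
have h2 := ih (fun k kK => good k (ltnW kK)).
have := ler_normD (dev (chain s K.+1 x) (chain s K.+1 y) t -
  dev (chain s K x) (chain s K y) t) (dev (chain s K x) (chain s K y) t).
rewrite subrK exprS => /le_trans; apply; apply: le_trans (lerD h1 h2) _.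
by move: (_ ^+ K) => p; lra.
Qed.

(** The constant is 37 = 5 + 32, from rows where the net point is nearly orthogonal and rows where
    the remainder is large. *)
Lemma mis_count_tail K (x : 'cV[R]_n) t :
  ~ op_bad_set s Z t -> ~ balls_bad_set s Z K.+1 t ->
  (nsupp x <= s)%N -> dotp x x = 1 ->
  mis_count Z (chain s K.+1 x) x t <= m%:R * (37 * 4 ^- K.+1).
Proof.
move=> gop gball xs x1; have x1' : dotp x x <= 1 by rewrite x1.
have t0 : 0 < 4 ^- K.+1 :> R by rewrite invr_gt0 exprn_gt0.
have r0 : 0 < 8 ^- K.+1 :> R by rewrite invr_gt0 exprn_gt0.
have [z zs zE] := chain_in_net s0 K.+1 xs x1'.
have sm : small_count Z (4 ^- K.+1) (chain s K.+1 x) t <= m%:R * (5 * 4 ^- K.+1).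
  rewrite leNgt; apply/negP => big; apply: gball.
  apply: (bigsetU_in (i := z)) => //.
  by rewrite -zE (chain_norm_ge K xs x1) /small_bad/= ltW.
have lg := large_count_le gop (nsupp_sub_chain K.+1 xs) r0 t0 (chain_dist s0 K.+1 xs x1').
apply: le_trans (mis_count_le (4 ^- K.+1) _ _ _) _.
apply: le_trans (lerD sm lg) _.
rewrite cube_8_4 le_eqVlt; apply/orP; left; apply/eqP.
by move: (4 ^- K.+1) t0 => u u0; field; rewrite gt_eqF.
Qed.

Lemma mis_mean_tail K (x : 'cV[R]_n) : (nsupp x <= s)%N -> dotp x x = 1 ->
  mis_mean P Z (chain s K.+1 x) x <= m%:R * (12 * 4 ^- K.+1).
Proof.
move=> xs x1; have x1' : dotp x x <= 1 by rewrite x1.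
have t0 : 0 < 4 ^- K.+1 :> R by rewrite invr_gt0 exprn_gt0.
have r0 : 0 < 8 ^- K.+1 :> R by rewrite invr_gt0 exprn_gt0.
apply: le_trans (mis_mean_le sigma0 gZ n1 (chain_norm_ge K xs x1) r0 t0
  (chain_dist s0 K.+1 xs x1')) _.
rewrite cube_8_4 le_eqVlt; apply/orP; left; apply/eqP.
by move: (4 ^- K.+1) t0 => u u0; field; rewrite gt_eqF.
Qed.

Lemma dev_le (delta : R) K (x y : 'cV[R]_n) t : 0 < delta ->
  4 ^- K.+1 <= delta / 256 ->
  (forall k, (k < K.+1)%N -> ~ links_bad_set P s Z delta k t) ->
  ~ op_bad_set s Z t -> ~ balls_bad_set s Z K.+1 t ->
  (nsupp x <= s)%N -> dotp x x = 1 -> (nsupp y <= s)%N -> dotp y y = 1 ->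
  `|dev x y t| <= m%:R * delta.
Proof.
move=> d0 Kd glink gop gball xs x1 ys y1.
have h0 := dev_chain d0 glink xs x1 ys y1.
have c1 := mis_count_tail gop gball xs x1; have c2 := mis_count_tail gop gball ys y1.
have e1 := mis_mean_tail K xs x1; have e2 := mis_mean_tail K ys y1.
have tc := mis_count_triangle Z (chain s K.+1 x) (chain s K.+1 y) x y t.
have te := mis_mean_triangle gZ (chain s K.+1 x) (chain s K.+1 y) x y.
(* The error budget closes: 1/4 from the chain and 2 * (37 + 12) / 256 from the two tails stay below
   1. *)
have mK : m%:R * 4 ^- K.+1 <= m%:R * (delta / 256) by rewrite ler_wpM2l.
have md : 0 <= m%:R * delta by rewrite mulr_ge0// ltW.
rewrite /dev in h0 *; move: h0 tc te c1 c2 e1 e2 mK.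
rewrite !ler_norml; move: (mis_count Z x y t) (mis_mean P Z x y)
  (mis_count Z (chain _ _ _) (chain _ _ _) t) (mis_mean P Z (chain _ _ _) (chain _ _ _))
  (mis_count Z _ x t) (mis_count Z _ y t) (mis_mean P Z _ x) (mis_mean P Z _ y).
move=> N E N' E' a b a' b' /andP[? ?] /andP[? ?] /andP[? ?] ? ? ? ? ?.
by apply/andP; split; lra.
Qed.

End Deterministic.

(** * The last level, and the theorem *)

Lemma norm2_eq1 (R : realType) n (x : 'cV[R]_n) : norm2 x = 1 -> dotp x x = 1.
Proof.
move=> x1; have : 0 <= dotp x x by exact: dotp_ge0.
by move/sqr_sqrtr; rewrite -/(norm2 x) x1 expr1n => <-.
Qed.

(** The least level where 4^-k falls below delta / 256. Being below makes the tails small;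
    minimality keeps all earlier levels in the Chernoff range and, losing one factor 4, bounds
    [delta] by 4^5 4^-k at the last one. *)
Lemma exists_level (R : realType) (delta : R) : 0 < delta -> delta < 1 ->
  exists K : nat, [/\ 4 ^- K.+1 <= delta / 256, delta <= 4 ^+ 5 * 4 ^- K.+1 &
    forall k, (k < K.+1)%N -> delta * 4 ^+ k <= 256].
Proof.
move=> d0 d1.
have ex : exists k, 4 ^- k <= delta / 256.
  exists (Num.truncn (256 / delta)).+1.
  have h0 : 0 <= 256 / delta by rewrite divr_ge0// ltW.
  have /andP[_ /ltW h] := truncn_itv h0.
  rewrite -[leRHS]invf_div lef_pV2 ?posrE ?exprn_gt0 ?divr_gt0//.
  by apply: le_trans h _; rewrite -natrX ler_nat ltnW// ltn_expl.
have [k kd kmin] := ex_minnP ex.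
have p0 j : 0 < 4 ^+ j :> R by rewrite exprn_gt0.
case: k kd kmin => [|K] kd kmin.
  by exfalso; move: kd; rewrite expr0 invr1; lra.
have below k : (k < K.+1)%N -> delta * 4 ^+ k <= 256.
  move=> kK; have : ~~ (4 ^- k <= delta / 256).
    by apply/negP => /kmin; rewrite leqNgt kK.
  rewrite -ltNge ltr_pdivrMr// mulrC ltr_pdivlMr// => /ltW.
  by [].
exists K; split=> //.
have := below K (ltnSn K); rewrite -ler_pdivlMr// => h; apply: le_trans h _.
rewrite [4 ^+ K.+1]exprS invfM mulrA ler_wpM2r ?invr_ge0 ?(ltW (p0 _))//.
by rewrite exprSr mulfK// -natrX ler_nat.
Qed.

Lemma onebit_mapE (R : realType) m n (a : m.-tuple (n.-tuple (measurableTypeR R)))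
    (e : m.-tuple (measurableTypeR R)) (x : 'cV[R]_n) (k : 'I_m) :
  onebit_map (mx_of_tuples a) (cV_of_tuple e) x k 0 =
  sgn (lin x (tnth a k, tnth e k)).
Proof.
rewrite /onebit_map !mxE /lin /lin0/=; congr (sgn (_ + _)).
by apply: eq_bigr => j _; rewrite !mxE mulrC.
Qed.

Lemma sgn_neq (R : realType) (u v : R) : (sgn u != sgn v) = ((0 < u) != (0 < v)).
Proof.
have n1 : 1 != -1 :> R by rewrite gt_eqF// (lt_trans (ltrN10 _)).
by rewrite /sgn; case: (0 < u); case: (0 < v) => //=; rewrite ?eqxx// eq_sym n1.
Qed.

Theorem theorem2p5 (R : realType) :
  exists C : R, 0 < C /\
  forall (d : measure_display) (T : measurableType d) (P : probability T R)
    (m n : nat) (sigma : R)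
    (A : {RV P >-> m.-tuple (n.-tuple (measurableTypeR R))})
    (eta : {RV P >-> m.-tuple (measurableTypeR R)}),
  0 <= sigma ->
  (forall i : 'I_m, gaussian_vector P 1 (fun t => tnth (A t) i)) ->
  mutually_independent P (fun (i : 'I_m) t => tnth (A t) i) ->
  gaussian_vector P sigma eta ->
  independent2 P A eta ->
  forall (eps delta : R) (s : nat),
  0 < eps < 1 -> 0 < delta < 1 -> (1 <= s < n)%N ->
  C * (delta ^- 2 * (ln (2 / eps) + sparse_complexity R n s)) <= m%:R ->
  with_prob_at_least P (1 - eps)
    [set t | RIP s delta sigma
               (onebit_map (mx_of_tuples (A t)) (cV_of_tuple (eta t)))].
Proof.
(* The value is dictated by the small-ball event, see [Pr_balls_bad_set]. *)
exists (16 ^+ 7); split; first by rewrite exprn_gt0.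
move=> d T P m n sigma A eta sigma0 gA iA geta indAeta eps delta s.
move=> /andP[eps0 eps1] /andP[delta0 delta1] /andP[s0 sn] mL.
have n1 : (1 < n)%N by exact: leq_ltn_trans s0 sn.
have sn' := ltnW sn.
pose Z := noisy_row A eta.
have gZ i : gaussian_row P sigma (Z i) := gaussian_noisy_row gA geta indAeta i.
have indZ : independent_family P Z := independent_noisy_rows iA geta indAeta.
have [K [Kd Kball Klink]] := exists_level delta0 delta1.
pose links := \big[setU/set0]_(k < K.+1 | true) links_bad_set P s Z delta k.
pose bad := links `|` (balls_bad_set s Z K.+1 `|` op_bad_set s Z).
have mlinks : measurable links.
  by apply: measurable_bigsetU => k; exact: (measurable_links_bad_set s gZ).
have mballs := measurable_balls_bad_set s gZ K.+1.
have mop := measurable_op_bad_set s gZ.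
have mbad : measurable bad by apply: measurableU => //; exact: measurableU.
have Pbad : Pr P bad <= eps.
  (* The geometric series over levels doubles eps / 32; the other two events add eps / 64 each. *)
  have h1 : Pr P links <= eps / 16.
    apply: le_trans (Pr_bigsetU_le _ _ _) _.
      by move=> k _; exact: (measurable_links_bad_set s gZ).
    apply: (@le_trans _ _ (\sum_(k < K.+1) eps / 32 * 2 ^- k)).
      apply: ler_sum => k _.
      exact: (Pr_links_bad_set gZ indZ s0 sn' eps0 eps1 delta0 mL (Klink k (ltn_ord k))).
    rewrite -mulr_sumr.
    have geo N : \sum_(k < N) 2 ^- k <= 2 - 2 ^- N * 2 :> R.
      elim: N => [|N ih]; first by rewrite big_ord0 expr0 invr1 mul1r subrr.
      rewrite big_ord_recr/= [2 ^+ N.+1]exprS invfM mulrAC mulVf// mul1r.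
      by move: ih; move: (2 ^- N) => x; lra.
    have := geo K.+1; have : 0 <= 2 ^- K.+1 :> R by rewrite invr_ge0 exprn_ge0.
    move: (2 ^- K.+1) (\sum_(k < _) _) => x y x0 h.
    apply: (@le_trans _ _ (eps / 32 * 2)); last by lra.
    by rewrite ler_wpM2l ?divr_ge0 ?(ltW eps0)//; lra.
  have h2 := Pr_balls_bad_set sigma0 gZ indZ s0 sn' n1 eps0 eps1 delta0 mL Kball.
  have h3 := Pr_op_bad_set gZ indZ s0 sn' n1 eps0 eps1 delta0 delta1 mL.
  apply: le_trans (Pr_setU_le _ mlinks (measurableU _ _ mballs mop)) _.
  have := Pr_setU_le P mballs mop; lra.
exists (~` bad); split; first exact: measurableC.
  move=> t good /=.
  have glink k : (k < K.+1)%N -> ~ links_bad_set P s Z delta k t.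
    move=> kK h; apply: good; left.
    exact: (bigsetU_in (i := Ordinal kK) (F := fun k : 'I_K.+1 => links_bad_set P s Z delta k)).
  have gball : ~ balls_bad_set s Z K.+1 t by move=> h; apply: good; right; left.
  have gop : ~ op_bad_set s Z t by move=> h; apply: good; right; right.
  rewrite /RIP; apply: ub_ereal_sup => _ [[x y] [/= [x1 xs] [y1 ys]] <-].
  rewrite lee_fin; have {}x1 := norm2_eq1 x1; have {}y1 := norm2_eq1 y1.
  (* The sample-size hypothesis excludes m = 0, so the inverse in [hamming_dist] is a genuine
     one. *)
  have m0 : 0 < m%:R :> R.
    rewrite ltr0n lt0n; apply/eqP => m0; move: mL; rewrite m0 leNgt => /negP; apply.
    rewrite mulr_gt0 ?exprn_gt0// mulr_gt0 ?invr_gt0 ?exprn_gt0//.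
    rewrite ltr_wpDl ?(lt_le_trans ltr01 (sparse_complexity_ge1 s0 sn'))//.
    by rewrite ln_ge0// ler_pdivlMr// mul1r (le_trans (ltW eps1))// ler1n.
  have := dev_le sigma0 gZ s0 n1 delta0 Kd glink gop gball xs x1 ys y1.
  have -> : dev P Z x y t = m%:R * (hamming_dist
      (onebit_map (mx_of_tuples (A t)) (cV_of_tuple (eta t)) x)
      (onebit_map (mx_of_tuples (A t)) (cV_of_tuple (eta t)) y) - dsigma sigma x y).
    rewrite /dev mulrBr /hamming_dist mulrA mulfV ?gt_eqF// mul1r; congr (_ - _).
      rewrite -sum1_card natr_sum [RHS]big_mkcond/=; apply: eq_bigr => k _.
      rewrite inE !onebit_mapE sgn_neq indicE.
      have -> : (Z k t \in mis x y) =
          ((0 < lin x (tnth (A t) k, tnth (eta t) k)) !=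
           (0 < lin y (tnth (A t) k, tnth (eta t) k))).
        by apply/idP/idP => [/set_mem|h]; [|apply/mem_set].
      by case: (_ != _).
    rewrite /mis_mean (eq_bigr (fun=> dsigma sigma x y)).
      by rewrite sumr_const card_ord -[LHS]mulr_natl.
    by move=> k _; exact: (Pr_mismatch_lin sigma0 (gZ k) n1 x1 y1).
  by rewrite normrM gtr0_norm// ler_pM2l.
rewrite -(EFin_Pr _ (measurableC mbad)) lee_fin (Pr_setC _ mbad).
by rewrite lerB.
Qed.
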